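(* For an arbitrary sequence of non-negative integers $N_1,N_2,N_3,\ldots$, the logarithm of the Barnes $G$-function has the exact expansion \[ \begin{aligned} \log G(z+1)={}&\frac14 z^2+z\log\Gamma(z+1)-\left(\frac12 z(z+1)+\frac1{12}\right)\log z-\log A\\ &-\sum_{k=1}^\infty\frac{1}{(2\pi k)^2}\sum_{n=0}^{N_k-1}(-1)^n\frac{2(2n+1)!}{(2\pi kz)^{2n+2}}\\ &-\sum_{k=1}^\infty\left(\frac{\widehat T_{2N_k+1}(2\pi kiz)}{2\pi ik^2}e^{2\pi kiz}+\frac{\widehat T_{2N_k+1}(-2\pi kiz)}{2\pi ik^2}e^{-2\pi kiz}\right), \end{aligned} \] provided that $|\arg z|<\pi$.
   Context: $z$ is a nonzero complex number; $\arg z$ and $\log z$ denote principal values; empty sums are zero. The Barnes $G$-function is the entire function given by \[ G(z+1)=(2\pi)^{z/2}e^{-[z(z+1)+\gamma z^2]/2}\prod_{n=1}^\infty\left[\left(1+\frac{z}{n}\right)^n e^{-z+z^2/(2n)}\right], \] where $\gamma$ is the Euler–Mascheroni constant. For $|\arg z|<\pi$, $\log G(z+1)$ and $\log\Gamma(z+1)$ denote the analytic branches on $\mathbb{C}\setminus(-\infty,0]$ that are real for $z>0$. The Glaisher–Kinkelin constant $A$ is given by $\log A=\frac{1}{12}-\zeta'(-1)$, where $\zeta$ is the Riemann zeta function. The (scaled) Terminant function is defined for $p>0$ and $|\arg w|<\pi$ by \[ \widehat T_p(w)=\frac{e^{\pi ip}\Gamma(p)}{2\pi i}\Gamma(1-p,w)=\frac{e^{\pi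 ip}w^{1-p}e^{-w}}{2\pi i}\int_0^{+\infty}\frac{t^{p-1}e^{-t}}{w+t}\,dt, \] where $\Gamma(a,w)$ is the (upper) incomplete gamma function, and by analytic continuation in $w$ elsewhere. In the formula, $\pm 2\pi kiz$ is understood as the point of modulus $2\pi k|z|$ and argument $\arg z\pm\frac{\pi}{2}$; that is, $\widehat T_{2N_k+1}(\pm2\pi kiz)$ is, as a function of $z$, the analytic continuation from the sector $|\arg z|<\frac{\pi}{2}$ to the sector $|\arg z|<\pi$.
   Formalization: For some sequences N_k (e.g. N_k = k^k) the two series over k diverge separately; the formal theorem asserts that the series of combined k-th terms converges to the stated value for every N_k, and gives the display with two separate series whenever one of them converges. *)

(* Defs.v *)
From Stdlib Require Import Reals List ClassicalEpsilon.
From Coquelicot Require Import Coquelicot.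
Open Scope C_scope.

Definition Cexp (z : C) : C :=
  RtoC (exp (Re z)) * (RtoC (cos (Im z)) + Ci * RtoC (sin (Im z))).

(* Principal argument, with values in (-PI, PI] for z <> 0. *)
Definition Carg (z : C) : R :=
  if Rle_dec 0 (Im z) then acos (Re z / Cmod z) else (- acos (Re z / Cmod z))%R.

Definition Clog (z : C) : C := RtoC (ln (Cmod z)) + Ci * RtoC (Carg z).

Definition Clim_seq (u : nat -> C) : C :=
  (real (Lim_seq (fun n => Re (u n))), real (Lim_seq (fun n => Im (u n)))).

(* The finite sum and product of [f n] for [m <= n < m + l]. *)
Definition Csum (m l : nat) (f : nat -> C) : C :=
  fold_right Cplus (RtoC 0) (map f (seq m l)).
Definition Cprod (m l : nat) (f : nat -> C) : C :=
  fold_right Cmult (RtoC 1) (map f (seq m l)).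

Definition sector (a : R) (z : C) : Prop := z <> RtoC 0 /\ (Rabs (Carg z) < a)%R.

(* To be used with open [D] only. *)
Definition holomorphic_on (D : C -> Prop) (f : C -> C) : Prop :=
  forall z : C, D z -> @ex_derive C_AbsRing C_NormedModule f z.

(* The continuation of [f] from [U] to [D]. Its values on [D] are determined
   when [U] is open and nonempty, [D] is open and connected, [U] is included in
   [D], and a continuation exists. *)
Definition analytic_continuation (U D : C -> Prop) (f : C -> C) : C -> C :=
  epsilon (inhabits (fun _ : C => RtoC 0))
    (fun g => holomorphic_on D g /\ forall z : C, U z -> g z = f z).

(* The analytic branch of log f on the plane cut along (-oo, 0] that is real on
   the positive axis. *)
Definition log_branch (f : C -> C) : C -> C :=
  epsilon (inhabits (fun _ : C => RtoC 0))
    (fun L => holomorphic_on (sector PI) L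
              /\ (forall z : C, sector PI z -> Cexp (L z) = f z)
              /\ (forall x : R, (0 < x)%R -> Im (L (RtoC x)) = 0%R)).

Definition euler_gamma : R :=
  real (Lim_seq (fun n : nat => (sum_n_m (fun k : nat => / INR k) 1 n - ln (INR n))%R)).

(* Weierstrass' product. *)
Definition Gamma (z : C) : C :=
  Cexp (- (RtoC euler_gamma * z)) / z
  * Clim_seq (fun m : nat => Cprod 1 m (fun n : nat =>
      / (1 + z / RtoC (INR n)) * Cexp (z / RtoC (INR n)))).

Definition BarnesG (w : C) : C :=
  let z := w - 1 in
  Cexp (z / 2 * RtoC (ln (2 * PI)))
  * Cexp (- ((z * (z + 1) + RtoC euler_gamma * z ^ 2) / 2))
  * Clim_seq (fun m : nat => Cprod 1 m (fun n : nat =>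
      (1 + z / RtoC (INR n)) ^ n * Cexp (- z + z ^ 2 / (2 * RtoC (INR n))))).

Definition logGamma1p : C -> C := log_branch (fun z => Gamma (z + 1)).
Definition logBarnesG1p : C -> C := log_branch (fun z => BarnesG (z + 1)).

Definition zeta_series (s : C) : C :=
  Clim_seq (fun m : nat => Csum 1 m (fun n : nat => Cexp (- s * RtoC (ln (INR n))))).

Definition zeta : C -> C :=
  analytic_continuation (fun s => (1 < Re s)%R) (fun s => s <> RtoC 1) zeta_series.

(* log A, for the Glaisher-Kinkelin constant A. *)
Definition log_glaisher : C := 1 / 12 - C_derive zeta (- (1)).

(* The scaled terminant function for p > 0 and |arg w| < PI. *)
Definition terminant (p : R) (w : C) : C :=
  Cexp (RtoC PI * Ci * RtoC p) * Cexp ((1 - RtoC p) * Clog w) * Cexp (- w)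
  / (2 * RtoC PI * Ci)
  * @RInt_gen C_R_CompleteNormedModule
      (fun t : R => RtoC (Rpower t (p - 1) * exp (- t)) / (w + RtoC t))
      (at_right 0) (Rbar_locally p_infty).

(* The terminant at c z, as a function of z. For c = 2 PI k i or c = - 2 PI k i
   with k > 0, and |arg z| < PI / 2, the principal argument of c z is
   arg z + PI / 2, respectively arg z - PI / 2. *)
Definition terminant_at (p : R) (c : C) : C -> C :=
  analytic_continuation (sector (PI / 2)) (sector PI) (fun z => terminant p (c * z)).

(* Main.v *)
Require Import Defs.
From Stdlib Require Import Reals Arith ZArith Lra Lia ClassicalEpsilon.
From Coquelicot Require Import Coquelicot.

(** Write [S(z)] for [1/6] times the integral over [u > 0] of [B_3({u})/(u + z)^2], where [B_3] is
    the third Bernoulli polynomial and [{u}] the fractional part ([barnes_rem]).  Both sides of the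
    expansion are computed through [S].

    The left side.  On one period the integral defining [S] is elementary: with
    [q(a) = a^2/2 + a/2 + 1/12] it is [- a/2 - 1/4 + q(a) (log (a+1) - log a)] at [a = z + n]
    ([B3_period]).  Summing over [n] and rearranging gives a limit of finite sums of [log (z + n)] and
    [n log (z + n)] ([Stieltjes_B3_lim]); the analogous integral of [B_2] gives log Gamma
    ([Gauss_lim]).  The logarithm of the finite Weierstrass products is made of the same sums, so
    comparing, with Stirling's formula and the definition of Euler's constant for the parts free of [z],
       [log G(z+1) = z^2/4 + z log Gamma(z+1) - q(z) log z - (1/4 - S(1)) - S(z)]
    ([logBarnesG1p_eq]).  That these formulas give the analytic branches needs only that [exp D = 1]
    forces [D' = 0] ([log_branch_eq]).  The constant is [log A]: for [Re s > 1] Euler-Maclaurin summation gives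
       [zeta(s) = 1/(s-1) + 1/2 + s/12 - s(s+1)(s+2)/6 F(s+3)],
    with [F(s)] the integral of [B_3({u}) (1+u)^(-s)]; repeated integration by parts continues [F] to an
    entire function, and [zeta'(-1)] only needs [F(2) = 6 S(1)] ([log_glaisher_eq]).

    The right side.  The [k]-th term [a_k + b_k] does not depend on [N_k].  For [c = 2 pi k i] let
    [E_c(z)] be the integral of [e^(-cu)/(u + z)] over [u > 0] ([expint]).  Dividing [t^(2N)] by [t + w]
    shows that the terminant of order [2N+1] at [w] is, up to the factor [- e^(-w)/(2 pi i)],
    [E_1(w)] plus an explicit sum ([terminant_eq]), and [E_1(cz) = E_c(z)] for [Re z > 0] because both
    solve [y' = c y - 1/z] and are small at infinity ([expint_rotate]).  The function [E_c] is analytic on the whole cut plane, hence gives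
    the continued terminant there ([terminant_at_eq]).  In [b_k] the explicit sums for [c] and [-c]
    cancel [a_k], and what remains is the integral of
    [2 sin (2 pi k u)/(2 pi k)^3] against [1/(u + z)^2] ([term_eq_expansion_term], [sin_mode_is_Cint_inf]).
    These sines are the Fourier modes of [B_3({u})/6], whose partial sums converge uniformly
    ([Bern3_Fourier]); therefore the terms sum to [S(z)] ([expansion_term_sum]).

    Identifying the continuations requires uniqueness of analytic continuation for functions that are
    merely complex differentiable.  It comes from Goursat's lemma, local primitives, a bound of Cauchy
    type, and the resulting identity theorem on discs and along segments ([segment_identity]). *)

Local Open Scope R_scope.

(** * Euler's constant *)

Definition harmonic (n : nat) : R := sum_n_m (fun k : nat => / INR k) 1 n.

Lemma harmonic_S (n : nat) : harmonic (S n) = harmonic n + / INR (S n).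
Proof. unfold harmonic. rewrite sum_n_Sm by lia. reflexivity. Qed.

Lemma ln_1p_le (x : R) : 0 <= x -> ln (1 + x) <= x.
Proof. intros Hx. rewrite <- (ln_exp x) at 2. apply ln_le. lra. apply exp_ineq1_le. Qed.

Lemma ln_1p_ge (x : R) : 0 <= x -> x / (1 + x) <= ln (1 + x).
Proof.
  intros Hx. assert (H : ln (/ (1 + x)) <= - (x / (1 + x))).
  { rewrite <- (ln_exp (- (x / (1 + x)))). apply ln_le. apply Rinv_0_lt_compat; lra.
    eapply Rle_trans; [|apply exp_ineq1_le]. right. field. lra. }
  rewrite ln_Rinv in H by lra. lra.
Qed.

Lemma ln_S (n : nat) : (0 < n)%nat -> ln (INR (S n)) = ln (INR n) + ln (1 + / INR n).
Proof.
  intros Hn. assert (P : 0 < INR n) by (apply lt_0_INR; auto).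
  assert (0 < / INR n) by (apply Rinv_0_lt_compat; auto).
  rewrite <- ln_mult by lra. f_equal. rewrite S_INR. field. lra.
Qed.

(** The sequence decreases and stays nonnegative, since [ln (1 + x)] lies between [x/(1+x)] and
    [x]; this gives the convergence that the definition of [euler_gamma] as a total limit leaves
    open. *)
Lemma euler_gamma_lim : is_lim_seq (fun n => harmonic n - ln (INR n)) euler_gamma.
Proof.
  assert (HD : forall n, (harmonic (S (S n)) - ln (INR (S (S n)))) <= harmonic (S n) - ln (INR (S n))).
  { intros n. rewrite (harmonic_S (S n)), (ln_S (S n)) by lia.
    assert (P : 0 < INR (S n)) by (apply lt_0_INR; lia).
    assert (Q := ln_1p_ge (/ INR (S n)) ltac:(left; apply Rinv_0_lt_compat; auto)).
    replace (/ INR (S n) / (1 + / INR (S n))) with (/ INR (S (S n))) in Q.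
    lra. rewrite (S_INR (S n)). field. split; lra. }
  assert (HB : forall n, 0 <= harmonic n - ln (INR (S n))).
  { induction n as [|n IH].
    - unfold harmonic. rewrite sum_n_m_zero by lia. simpl. rewrite ln_1. unfold zero; simpl. lra.
    - rewrite harmonic_S, (ln_S (S n)) by lia.
      assert (Q := ln_1p_le (/ INR (S n)) ltac:(left; apply Rinv_0_lt_compat, lt_0_INR; lia)). lra. }
  assert (Hex : ex_finite_lim_seq (fun n => harmonic n - ln (INR n))).
  { assert (W : ex_finite_lim_seq (fun n => harmonic (S n) - ln (INR (S n)))); [|destruct W as [w Hw]; exists w; apply is_lim_seq_incr_1; exact Hw].
    apply ex_finite_lim_seq_decr with 0.
    - intros n. apply HD.
    - intros n. rewrite harmonic_S. assert (Q := HB n).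
      assert (0 < / INR (S n)) by (apply Rinv_0_lt_compat, lt_0_INR; lia). lra. }
  apply Lim_seq_correct' in Hex. exact Hex.
Qed.

(** * Wallis' product *)

Definition wallis_int (n : nat) : R := RInt (fun t => sin t ^ n) 0 (PI / 2).

Lemma ex_wallis (n : nat) : ex_RInt (fun t => sin t ^ n) 0 (PI / 2).
Proof.
  apply (ex_RInt_continuous (V := R_CompleteNormedModule)). intros t _.
  apply (ex_derive_continuous (V := R_NormedModule)). auto_derive. auto.
Qed.

Lemma wallis_rec (n : nat) : INR (n + 2) * wallis_int (n + 2) = INR (n + 1) * wallis_int n.
Proof.
  assert (H : is_RInt (fun t => INR (n + 2) * sin t ^ (n + 2) - INR (n + 1) * sin t ^ n) 0 (PI / 2)
     ((fun t => - (cos t * sin t ^ (n + 1))) (PI / 2) - (fun t => - (cos t * sin t ^ (n + 1))) 0)).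
  { apply (is_RInt_derive (V := R_CompleteNormedModule) (fun t => - (cos t * sin t ^ (n + 1)))).
    - intros t _. auto_derive. auto.
      replace (n + 2)%nat with (S (n + 1)) by lia. replace (n + 1)%nat with (S n) by lia.
      rewrite !S_INR. simpl. assert (E := sin2_cos2 t). unfold Rsqr in E.
      transitivity (- (sin t ^ n * (- (sin t * sin t) + (INR n + 1) * (cos t * cos t)))). ring.
      replace (cos t * cos t) with (1 - sin t * sin t) by lra. ring.
    - intros t _. apply (ex_derive_continuous (V := R_NormedModule)). auto_derive. auto. }
  cbv beta in H. rewrite cos_PI2, sin_0 in H.
  assert (Z : 0 ^ (n + 1) = 0) by (rewrite pow_i; auto; lia). rewrite Z in H.
  assert (H2 := is_RInt_minus (V := R_NormedModule) _ _ _ _ _ _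
    (is_RInt_scal (V := R_NormedModule) _ _ _ (INR (n + 2)) _ (RInt_correct (V := R_CompleteNormedModule) _ _ _ (ex_wallis (n + 2))))
    (is_RInt_scal (V := R_NormedModule) _ _ _ (INR (n + 1)) _ (RInt_correct (V := R_CompleteNormedModule) _ _ _ (ex_wallis n)))).
  apply (is_RInt_unique (V := R_CompleteNormedModule)) in H.
  apply (is_RInt_unique (V := R_CompleteNormedModule)) in H2.
  assert (E := eq_trans (eq_sym H) H2).
  unfold minus, plus, opp, scal in E; simpl in E. unfold mult in E; simpl in E.
  unfold wallis_int. lra.
Qed.

(** The quantity [4^n / binomial(2n, n)], through which the Wallis integrals of even and of odd
    order are expressed. *)
Definition wallis_ratio (n : nat) : R := 4 ^ n * INR (fact n) ^ 2 / INR (fact (2 * n)).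

Lemma wallis_ratio_S (n : nat) : wallis_ratio (S n) * INR (2 * n + 1) = wallis_ratio n * INR (2 * n + 2).
Proof.
  unfold wallis_ratio. replace (2 * S n)%nat with (S (S (2 * n))) by lia.
  rewrite !fact_simpl, !mult_INR.
  assert (P1 := INR_fact_lt_0 n). assert (P2 := INR_fact_lt_0 (2 * n)).
  assert (P3 := pos_INR n).
  replace (INR (2 * n + 1)) with (2 * INR n + 1) by (rewrite plus_INR, mult_INR; simpl; ring).
  replace (INR (2 * n + 2)) with (2 * INR n + 2) by (rewrite plus_INR, mult_INR; simpl; ring).
  rewrite !S_INR, mult_INR. simpl (INR 2). simpl pow. field. lra.
Qed.

Lemma wallis_ratio_pos (n : nat) : 0 < wallis_ratio n.
Proof.
  unfold wallis_ratio. apply Rdiv_lt_0_compat. apply Rmult_lt_0_compat; apply pow_lt.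
  lra. apply INR_fact_lt_0. apply INR_fact_lt_0.
Qed.

Lemma wallis_even_odd (n : nat) : wallis_int (2 * n) = PI / 2 / wallis_ratio n /\
  wallis_int (2 * n + 1) = wallis_ratio n / INR (2 * n + 1).
Proof.
  induction n as [|n [IH1 IH2]].
  - split.
    + unfold wallis_int, wallis_ratio. simpl. rewrite RInt_const. unfold scal; simpl. unfold mult; simpl. field.
    + unfold wallis_int, wallis_ratio. simpl.
      assert (H : is_RInt (fun t => sin t * 1) 0 (PI / 2) ((fun t => - cos t) (PI / 2) - (fun t => - cos t) 0)).
      { apply (is_RInt_derive (V := R_CompleteNormedModule) (fun t => - cos t)).
        intros t _. auto_derive; auto. ring.
        intros t _. apply (ex_derive_continuous (V := R_NormedModule)). auto_derive. auto. }
      rewrite (is_RInt_unique (V := R_CompleteNormedModule) _ _ _ _ H). rewrite cos_PI2, cos_0. field.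
  - assert (PS := wallis_ratio_S n). assert (P0 := wallis_ratio_pos n). assert (P1 := wallis_ratio_pos (S n)).
    assert (R1 := wallis_rec (2 * n)). assert (R2 := wallis_rec (2 * n + 1)).
    replace (2 * S n)%nat with (2 * n + 2)%nat by lia.
    replace (2 * n + 2 + 1)%nat with (2 * n + 1 + 2)%nat by lia.
    replace (2 * n + 1 + 1)%nat with (2 * n + 2)%nat in R2 by lia.
    assert (Q0 : 0 < INR (2 * n + 1)) by (apply lt_0_INR; lia).
    assert (Q1 : 0 < INR (2 * n + 2)) by (apply lt_0_INR; lia).
    assert (Q2 : 0 < INR (2 * n + 1 + 2)) by (apply lt_0_INR; lia).
    rewrite IH1 in R1. rewrite IH2 in R2.
    assert (E : wallis_ratio (S n) = wallis_ratio n * INR (2 * n + 2) / INR (2 * n + 1)).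
    { apply Rmult_eq_reg_r with (INR (2 * n + 1)); [|lra]. rewrite PS. field. lra. }
    rewrite E. split.
    + apply Rmult_eq_reg_l with (INR (2 * n + 2)); [|lra]. rewrite R1. field. lra.
    + apply Rmult_eq_reg_l with (INR (2 * n + 1 + 2)); [|lra]. rewrite R2. field. lra.
Qed.

Lemma wallis_decr (n : nat) : wallis_int (S n) <= wallis_int n.
Proof.
  assert (Pi := PI_RGT_0). unfold wallis_int. apply RInt_le. lra. apply ex_wallis. apply ex_wallis.
  intros t Ht. simpl. assert (S0 : 0 <= sin t) by (apply sin_ge_0; lra).
  assert (S1 := SIN_bound t). assert (0 <= sin t ^ n) by (apply pow_le; auto). nra.
Qed.

(** The inequalities [wallis_int (2n+1) <= wallis_int (2n) <= wallis_int (2n-1)], written in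
    terms of the ratio. *)
Lemma wallis_bounds (n : nat) : (0 < n)%nat ->
  PI <= wallis_ratio n ^ 2 / INR n <= PI * (1 + / (2 * INR n)).
Proof.
  intros Hn. destruct n as [|n]. lia.
  destruct (wallis_even_odd (S n)) as [E1 E2]. destruct (wallis_even_odd n) as [_ E3].
  assert (fourier_rem1 := wallis_decr (2 * S n)). assert (fourier_rem2 := wallis_decr (2 * n + 1)).
  replace (S (2 * S n)) with (2 * S n + 1)%nat in fourier_rem1 by lia.
  replace (S (2 * n + 1)) with (2 * S n)%nat in fourier_rem2 by lia.
  rewrite E1, E2 in fourier_rem1. rewrite E1, E3 in fourier_rem2.
  assert (PS := wallis_ratio_S n). assert (P0 := wallis_ratio_pos n). assert (P1 := wallis_ratio_pos (S n)).
  set (p := wallis_ratio (S n)) in *.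
  assert (Q0 : 0 < INR (2 * n + 1)) by (apply lt_0_INR; lia).
  assert (Q1 : 0 < INR (S n)) by (apply lt_0_INR; lia).
  assert (E4 : wallis_ratio n / INR (2 * n + 1) = p / (2 * INR (S n))).
  { replace (INR (2 * n + 2)) with (2 * INR (S n)) in PS.
    2: { rewrite S_INR, plus_INR, mult_INR. simpl. ring. }
    apply Rmult_eq_reg_r with (INR (2 * n + 1) * (2 * INR (S n))).
    2: { apply Rgt_not_eq, Rmult_lt_0_compat; lra. }
    replace (wallis_ratio n / INR (2 * n + 1) * (INR (2 * n + 1) * (2 * INR (S n)))) with (wallis_ratio n * (2 * INR (S n))) by (field; lra).
    rewrite <- PS. field. lra. }
  rewrite E4 in fourier_rem2.
  replace (INR (2 * S n + 1)) with (2 * INR (S n) + 1) in fourier_rem1 by (rewrite plus_INR, mult_INR; simpl; ring).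
  set (m := INR (S n)) in *. split.
  - apply Rmult_le_compat_r with (r := 2 * p) in fourier_rem2; [|lra].
    replace (PI / 2 / p * (2 * p)) with PI in fourier_rem2 by (field; lra).
    eapply Rle_trans. apply fourier_rem2. right. simpl. field. lra.
  - apply Rmult_le_compat_r with (r := p * (2 * m + 1) / m) in fourier_rem1.
    2: { left. apply Rdiv_lt_0_compat; auto. apply Rmult_lt_0_compat; lra. }
    replace (p / (2 * m + 1) * (p * (2 * m + 1) / m)) with (p ^ 2 / m) in fourier_rem1 by (simpl; field; lra).
    eapply Rle_trans. apply fourier_rem1. right. field. lra.
Qed.

(** * Stirling's formula *)

Definition stirling (n : nat) : R := ln (INR (fact n)) - (INR n + / 2) * ln (INR n) + INR n.

(** Approximation of [ln (1 + x)] by its Pade fraction: with [x = 1/n] it compares two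
    consecutive terms of [stirling], because [2x/(2+x) = 1/(n + 1/2)]. *)
Lemma ln_pade (x : R) : 0 <= x -> 0 <= ln (1 + x) - 2 * x / (2 + x) <= x ^ 3 / 12.
Proof.
  intros Hx. destruct (Req_dec x 0) as [-> | Nx].
  { rewrite Rplus_0_r, ln_1. lra. }
  assert (D : forall t, 0 <= t <= x -> is_derive (fun t => ln (1 + t) - 2 * t / (2 + t)) t (t ^ 2 / ((1 + t) * (2 + t) ^ 2))).
  { intros t Ht. auto_derive. lra. field. lra. }
  assert (C : forall t, 0 <= t <= x -> continuity_pt (fun t => ln (1 + t) - 2 * t / (2 + t)) t).
  { intros t Ht. apply continuity_pt_filterlim.
    apply (ex_derive_continuous (V := R_NormedModule) (fun t => ln (1 + t) - 2 * t / (2 + t))).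
    eexists. apply D; auto. }
  assert (E0 : ln (1 + 0) - 2 * 0 / (2 + 0) = 0) by (rewrite Rplus_0_r, ln_1; field).
  split.
  - destruct (MVT_gen (fun t => ln (1 + t) - 2 * t / (2 + t)) 0 x (fun t => t ^ 2 / ((1 + t) * (2 + t) ^ 2))) as [c [Hc E]].
    + intros t Ht. rewrite Rmin_left, Rmax_right in Ht by lra. apply D. lra.
    + intros t Ht. rewrite Rmin_left, Rmax_right in Ht by lra. apply C. lra.
    + rewrite Rmin_left, Rmax_right in Hc by lra. rewrite E0 in E.
      assert (0 <= c ^ 2 / ((1 + c) * (2 + c) ^ 2)).
      { apply Rdiv_le_0_compat. apply pow_le; lra. apply Rmult_lt_0_compat. lra. apply pow_lt; lra. }
      nra.
  - destruct (MVT_gen (fun t => t ^ 3 / 12 - (ln (1 + t) - 2 * t / (2 + t))) 0 x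
      (fun t => t ^ 2 / 4 - t ^ 2 / ((1 + t) * (2 + t) ^ 2))) as [c [Hc E]].
    + intros t Ht. rewrite Rmin_left, Rmax_right in Ht by lra.
      auto_derive. lra. field. lra.
    + intros t Ht. rewrite Rmin_left, Rmax_right in Ht by lra.
      apply continuity_pt_filterlim.
      apply (ex_derive_continuous (V := R_NormedModule) (fun t => t ^ 3 / 12 - (ln (1 + t) - 2 * t / (2 + t)))).
      auto_derive. lra.
    + rewrite Rmin_left, Rmax_right in Hc by lra. rewrite E0 in E.
      assert (c ^ 2 / ((1 + c) * (2 + c) ^ 2) <= c ^ 2 / 4).
      { unfold Rdiv. apply Rmult_le_compat_l. apply pow_le; lra. apply Rinv_le_contravar. lra.
        simpl. nra. }
      nra.
Qed.

Lemma stirling_step (n : nat) : (0 < n)%nat ->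
  0 <= stirling n - stirling (S n) <= / (4 * INR n) - / (4 * INR (S n)).
Proof.
  intros Hn. assert (P : 1 <= INR n) by (change 1 with (INR 1); apply le_INR; lia).
  set (x := / INR n). assert (Hx : 0 < x <= 1).
  { unfold x. split. apply Rinv_0_lt_compat; lra. rewrite <- Rinv_1. apply Rinv_le_contravar; lra. }
  assert (E : stirling n - stirling (S n) = (INR n + / 2) * (ln (1 + x) - 2 * x / (2 + x))).
  { unfold stirling. rewrite fact_simpl, mult_INR, ln_mult, (ln_S n), S_INR by
      (auto; try apply INR_fact_lt_0; try apply lt_0_INR; lia). fold x.
    assert (Ex : 2 * x / (2 + x) = / (INR n + / 2)). { unfold x. field. lra. }
    rewrite Ex, Rmult_minus_distr_l, Rinv_r by lra. ring. }
  rewrite E. assert (Q := ln_pade x ltac:(lra)). split. nra.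
  apply Rle_trans with ((INR n + / 2) * (x ^ 3 / 12)). apply Rmult_le_compat_l; lra.
  rewrite S_INR. replace (INR n) with (/ x) by (unfold x; field; lra).
  replace (/ (4 * / x) - / (4 * (/ x + 1))) with (x * x / (4 * (1 + x))) by (field; lra).
  replace ((/ x + / 2) * (x ^ 3 / 12)) with (x * x * (1 + x / 2) / 12) by (field; lra).
  apply Rmult_le_reg_r with (12 * (1 + x)). lra.
  replace (x * x / (4 * (1 + x)) * (12 * (1 + x))) with (x * x * 3) by (field; lra).
  replace (x * x * (1 + x / 2) / 12 * (12 * (1 + x))) with (x * x * ((1 + x / 2) * (1 + x))) by (field; lra).
  apply Rmult_le_compat_l. nra. nra.
Qed.

(** The increments telescope, so the limit [s] exists. Its value follows from Wallis' product:
    [2 (2 stirling n - stirling (2n))] is the logarithm of [2 wallis_ratio(n)^2 / n], which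
    tends to [ln (2 pi)]. *)
Lemma stirling_lim : is_lim_seq stirling (ln (2 * PI) / 2).
Proof.
  assert (Hex : ex_finite_lim_seq stirling).
  { assert (W : ex_finite_lim_seq (fun n => stirling (S n))); [|destruct W as [w Hw]; exists w; apply is_lim_seq_incr_1; exact Hw].
    apply ex_finite_lim_seq_decr with (stirling 1 - / 4).
    - intros n. assert (Q := stirling_step (S n) ltac:(lia)). lra.
    - assert (B : forall n, stirling 1 - / 4 + / (4 * INR (S n)) <= stirling (S n)).
      { induction n as [|n IH]. simpl INR. lra.
        assert (Q := stirling_step (S n) ltac:(lia)). lra. }
      intros n. specialize (B n).
      assert (0 < / (4 * INR (S n))). { apply Rinv_0_lt_compat. assert (Q := lt_0_INR (S n) ltac:(lia)). lra. }
      lra. }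
  destruct Hex as [s Hs].
  assert (Hs2 : is_lim_seq (fun n => stirling (2 * n)) s).
  { apply is_lim_seq_subseq with (phi := fun n => (2 * n)%nat). 2: exact Hs.
    apply eventually_subseq. intros n. lia. }
  assert (HL : is_lim_seq (fun n => 2 * (2 * stirling n - stirling (2 * n))) (2 * (2 * s - s))).
  { apply (is_lim_seq_scal_l (fun n => 2 * stirling n - stirling (2 * n)) 2 (2 * s - s)).
    apply (is_lim_seq_minus' (fun n => 2 * stirling n) (fun n => stirling (2 * n))); auto.
    apply (is_lim_seq_scal_l stirling 2 s). auto. }
  assert (HW : is_lim_seq (fun n => ln (2 * (wallis_ratio n ^ 2 / INR n))) (ln (2 * PI))).
  { assert (Pi := PI_RGT_0).
    apply is_lim_seq_le_le_loc with (u := fun _ => ln (2 * PI)) (w := fun n => ln (2 * PI) + / (2 * INR n)).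
    - exists 1%nat. intros n Hn. assert (P : 0 < INR n) by (apply lt_0_INR; lia).
      destruct (wallis_bounds n ltac:(lia)) as [B1 B2].
      assert (0 < / (2 * INR n)) by (apply Rinv_0_lt_compat; lra).
      split. apply ln_le; lra.
      apply Rle_trans with (ln (2 * PI * (1 + / (2 * INR n)))).
      apply ln_le; lra. rewrite ln_mult by lra. assert (Q := ln_1p_le (/ (2 * INR n))). lra.
    - apply is_lim_seq_const.
    - replace (ln (2 * PI)) with (ln (2 * PI) + 0) at 1 by ring.
      apply is_lim_seq_plus'. apply is_lim_seq_const.
      apply (is_lim_seq_ext_loc (fun n => / 2 * / INR n)).
      { exists 1%nat. intros n Hn. assert (P : 0 < INR n) by (apply lt_0_INR; lia). field. lra. }
      replace (Finite 0) with (Rbar_mult (/2) 0) by (simpl; f_equal; ring).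
      apply is_lim_seq_scal_l. apply (is_lim_seq_inv INR p_infty). apply is_lim_seq_INR. discriminate. }
  assert (HE : is_lim_seq (fun n => ln (2 * (wallis_ratio n ^ 2 / INR n))) (2 * (2 * s - s))).
  { eapply is_lim_seq_ext_loc; [|exact HL]. exists 1%nat. intros n Hn.
    assert (P : 0 < INR n) by (apply lt_0_INR; lia).
    assert (P1 := INR_fact_lt_0 n). assert (P2 := INR_fact_lt_0 (2 * n)).
    unfold wallis_ratio, stirling.
    assert (A : ln (2 * ((4 ^ n * INR (fact n) ^ 2 / INR (fact (2 * n))) ^ 2 / INR n)) =
      ln 2 + (2 * (INR n * (2 * ln 2) + 2 * ln (INR (fact n)) - ln (INR (fact (2 * n)))) - ln (INR n))).
    { assert (F1 : 0 < 4 ^ n) by (apply pow_lt; lra).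
      assert (F2 : 0 < INR (fact n) ^ 2) by (apply pow_lt; lra).
      assert (F3 : 0 < 4 ^ n * INR (fact n) ^ 2 / INR (fact (2 * n))).
      { apply Rdiv_lt_0_compat; auto. apply Rmult_lt_0_compat; auto. }
      assert (F4 := pow_lt _ 2 F3).
      rewrite ln_mult; [|lra|apply Rdiv_lt_0_compat; auto].
      rewrite ln_div by auto. rewrite ln_pow by auto. rewrite ln_div; auto.
      2: apply Rmult_lt_0_compat; auto.
      rewrite ln_mult by auto. rewrite !ln_pow by lra.
      replace 4 with (2 ^ 2) by ring. rewrite ln_pow by lra. simpl (INR 2). ring. }
    rewrite A. replace (INR (2 * n)) with (2 * INR n) by (rewrite mult_INR; simpl; ring). rewrite (ln_mult 2 (INR n)) by lra. field. }
  assert (E := is_lim_seq_unique _ _ HW). rewrite (is_lim_seq_unique _ _ HE) in E.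
  injection E as E. replace (ln (2 * PI) / 2) with s by lra. exact Hs.
Qed.

(** * The Fourier series of the third Bernoulli polynomial *)

Fixpoint rsum (f : nat -> R) (n : nat) : R :=
  match n with O => 0 | S m => rsum f m + f (S m) end.

Lemma rsum_ext (f g : nat -> R) (n : nat) : (forall k, f k = g k) -> rsum f n = rsum g n.
Proof. intros H. induction n as [|n IH]; simpl; rewrite ?IH, ?H; reflexivity. Qed.

Lemma rsum_0 (f : nat -> R) (n : nat) : (forall k, f k = 0) -> rsum f n = 0.
Proof. intros H. induction n as [|n IH]; simpl; rewrite ?IH, ?H; ring. Qed.

Lemma rsum_scal (c : R) (f : nat -> R) (n : nat) : rsum (fun k => c * f k) n = c * rsum f n.
Proof. induction n as [|n IH]; simpl; rewrite ?IH; ring. Qed.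

Lemma is_derive_rsum (f : nat -> R -> R) (f' : nat -> R) (x : R) (n : nat) :
  (forall k, (0 < k)%nat -> is_derive (f k) x (f' k)) ->
  is_derive (fun t => rsum (fun k => f k t) n) x (rsum f' n).
Proof.
  intros H. induction n as [|n IH]; simpl.
  - apply (@is_derive_const R_AbsRing R_NormedModule).
  - apply (@is_derive_plus R_AbsRing R_NormedModule). exact IH. apply H. lia.
Qed.

Lemma monotone_der (f f' : R -> R) (a b : R) : a <= b ->
  (forall x, a <= x <= b -> is_derive f x (f' x)) -> (forall x, a <= x <= b -> 0 <= f' x) -> f a <= f b.
Proof.
  intros Hab Hd Hp. destruct (MVT_gen f a b f') as [c [Hc E]].
  - intros x Hx. rewrite Rmin_left, Rmax_right in Hx by auto. apply Hd. lra.
  - intros x Hx. rewrite Rmin_left, Rmax_right in Hx by auto.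
    apply continuity_pt_filterlim. apply (ex_derive_continuous (V := R_NormedModule) f).
    eexists. apply Hd. lra.
  - rewrite Rmin_left, Rmax_right in Hc by auto. specialize (Hp c Hc). nra.
Qed.

Section Fourier.
Variable N : nat.

Let M := 2 * INR N + 1.
Let M_pos : 1 <= M.
Proof. unfold M. assert (P := pos_INR N). lra. Qed.

(** Remainders after [N] modes of the Fourier series of [x^3/12 - pi x^2/4 + pi^2 x/6] and of
    its first three derivatives. Each is the derivative of the preceding one, and the last is a
    Dirichlet kernel. *)
Definition fourier_rem0 (x : R) : R := x ^ 3 / 12 - PI * x ^ 2 / 4 + PI ^ 2 * x / 6 - rsum (fun k => sin (INR k * x) / INR k ^ 3) N.
Definition fourier_rem1 (x : R) : R := x ^ 2 / 4 - PI * x / 2 + PI ^ 2 / 6 - rsum (fun k => cos (INR k * x) / INR k ^ 2) N.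
Definition fourier_rem2 (x : R) : R := x / 2 - PI / 2 + rsum (fun k => sin (INR k * x) / INR k) N.
Definition fourier_rem3 (x : R) : R := / 2 + rsum (fun k => cos (INR k * x)) N.

Lemma fourier_rem0_der (x : R) : is_derive fourier_rem0 x (fourier_rem1 x).
Proof.
  unfold fourier_rem0, fourier_rem1. apply (@is_derive_minus R_AbsRing R_NormedModule).
  - auto_derive; auto. field.
  - apply (is_derive_rsum (fun k t => sin (INR k * t) / INR k ^ 3)). intros k Hk.
    assert (P := lt_0_INR k Hk). auto_derive. auto. field. lra.
Qed.

Lemma fourier_rem1_der (x : R) : is_derive fourier_rem1 x (fourier_rem2 x).
Proof.
  unfold fourier_rem1, fourier_rem2.
  replace (x / 2 - PI / 2 + rsum (fun k => sin (INR k * x) / INR k) N)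
    with (x / 2 - PI / 2 - rsum (fun k => - (sin (INR k * x) / INR k)) N).
  2: { rewrite (rsum_ext _ (fun k => (-1) * (sin (INR k * x) / INR k))) by (intros; ring).
       rewrite rsum_scal. ring. }
  apply (@is_derive_minus R_AbsRing R_NormedModule).
  - auto_derive; auto. field.
  - apply (is_derive_rsum (fun k t => cos (INR k * t) / INR k ^ 2)). intros k Hk.
    assert (P := lt_0_INR k Hk). auto_derive. auto. field. lra.
Qed.

Lemma fourier_rem2_der (x : R) : is_derive fourier_rem2 x (fourier_rem3 x).
Proof.
  unfold fourier_rem2, fourier_rem3. apply (@is_derive_plus R_AbsRing R_NormedModule).
  - auto_derive; auto. field.
  - apply (is_derive_rsum (fun k t => sin (INR k * t) / INR k)). intros k Hk.
    assert (P := lt_0_INR k Hk). auto_derive. auto. field. lra.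
Qed.

(** Closed form of the Dirichlet kernel. *)
Lemma fourier_rem3_kernel (x : R) : 2 * sin (x / 2) * fourier_rem3 x = sin ((INR N + / 2) * x).
Proof.
  unfold fourier_rem3. clear. induction N as [|n IH].
  - simpl. replace ((0 + / 2) * x) with (x / 2) by field. field.
  - cbn [rsum]. rewrite S_INR.
    replace (2 * sin (x / 2) * (/ 2 + (rsum (fun k => cos (INR k * x)) n + cos ((INR n + 1) * x))))
     with (2 * sin (x / 2) * (/ 2 + rsum (fun k => cos (INR k * x)) n) + 2 * sin (x / 2) * cos ((INR n + 1) * x)) by ring.
    rewrite IH.
    replace ((INR n + 1 + / 2) * x) with ((INR n + 1) * x + x / 2) by field.
    replace ((INR n + / 2) * x) with ((INR n + 1) * x - x / 2) by field.
    rewrite sin_plus, sin_minus. ring.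
Qed.

Lemma sin_kPI (k : nat) : sin (INR k * PI) = 0.
Proof.
  induction k as [|k IH]. simpl. rewrite Rmult_0_l. apply sin_0.
  rewrite S_INR. replace ((INR k + 1) * PI) with (INR k * PI + PI) by ring. rewrite neg_sin, IH. ring.
Qed.

Lemma fourier_rem2_PI : fourier_rem2 PI = 0.
Proof. unfold fourier_rem2. rewrite rsum_0. ring. intros k. rewrite sin_kPI. unfold Rdiv. ring. Qed.

Lemma fourier_rem0_PI : fourier_rem0 PI = 0.
Proof. unfold fourier_rem0. rewrite rsum_0. field. intros k. rewrite sin_kPI. unfold Rdiv. ring. Qed.

Lemma fourier_rem0_0 : fourier_rem0 0 = 0.
Proof. unfold fourier_rem0. rewrite rsum_0. field. intros k. rewrite Rmult_0_r, sin_0. unfold Rdiv. ring. Qed.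

(** A crude form of Jordan's inequality. *)
Lemma sin_lower (y : R) : 0 <= y <= PI / 2 -> y / 4 <= sin y.
Proof.
  intros Hy. assert (P3 := PI2_3_2). assert (P4 := PI_4).
  assert (H1 : forall t, 0 <= t <= 1 -> t / 2 <= sin t).
  { intros t Ht.
    assert (Q := monotone_der (fun s => sin s - s / 2) (fun s => cos s - / 2) 0 t ltac:(lra)).
    cbv beta in Q. rewrite sin_0 in Q.
    assert (0 - 0 / 2 <= sin t - t / 2); [|lra]. apply Q.
    - intros x Hx. auto_derive; auto. field.
    - intros x Hx. assert (cos (PI / 3) <= cos x) by (apply cos_decr_1; lra).
      rewrite cos_PI3 in H. lra. }
  destruct (Rle_dec y 1) as [L|G].
  - specialize (H1 y ltac:(lra)). lra.
  - specialize (H1 1 ltac:(lra)). assert (sin 1 <= sin y) by (apply sin_incr_1; lra). lra.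
Qed.

(** Integration by parts of the Dirichlet kernel, done with derivatives: [c + fourier_rem2] has
    derivative bounded by [w], which is minus the derivative of [h], so it varies by at most [h
    x - h PI] on [[x, PI]]. *)
Lemma fourier_rem2_bound (x : R) : 0 < x <= PI -> Rabs (fourier_rem2 x) <= 16 / M / x.
Proof.
  intros Hx. assert (Pi := PI_RGT_0).
  set (h := fun t => / (M * sin (t / 2))).
  set (c := fun t => cos ((INR N + / 2) * t) / (M * sin (t / 2))).
  set (w := fun t => cos (t / 2) / (2 * M * sin (t / 2) ^ 2)).
  assert (Hsin : forall t, x <= t <= PI -> 0 < sin (t / 2)) by (intros t Ht; apply sin_gt_0; lra).
  assert (Hcos : forall t, x <= t <= PI -> 0 <= cos (t / 2)) by (intros t Ht; apply cos_ge_0; lra).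
  assert (Dh : forall t, x <= t <= PI -> is_derive h t (- w t)).
  { intros t Ht. specialize (Hsin t Ht). unfold h, w. auto_derive.
    apply Rgt_not_eq, Rmult_lt_0_compat; lra. change (t * / 2) with (t / 2). field. lra. }
  assert (Dc : forall t, x <= t <= PI -> is_derive c t (- fourier_rem3 t - cos ((INR N + / 2) * t) * w t)).
  { intros t Ht. specialize (Hsin t Ht). unfold c, w.
    assert (E : fourier_rem3 t = sin ((INR N + / 2) * t) / (2 * sin (t / 2))).
    { rewrite <- fourier_rem3_kernel. field. lra. }
    rewrite E. auto_derive. apply Rgt_not_eq, Rmult_lt_0_compat; lra.
    change (t * / 2) with (t / 2).
    replace (INR N) with ((M - 1) / 2) by (unfold M; field). field. lra. }
  assert (Hw : forall t, x <= t <= PI -> 0 <= w t).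
  { intros t Ht. unfold w. apply Rdiv_le_0_compat. auto. specialize (Hsin t Ht).
    apply Rmult_lt_0_compat. lra. apply pow_lt; auto. }
  assert (cPI : c PI = 0).
  { unfold c. replace ((INR N + / 2) * PI) with (INR N * PI + PI / 2) by field.
    rewrite cos_plus, cos_PI2, sin_kPI. unfold Rdiv. ring. }
  assert (Hh : 0 < h x). { unfold h. apply Rinv_0_lt_compat, Rmult_lt_0_compat. lra. apply Hsin. lra. }
  assert (HhPI : 0 < h PI). { unfold h. apply Rinv_0_lt_compat, Rmult_lt_0_compat. lra. apply Hsin. lra. }
  assert (Hc1 : Rabs (c x) <= h x).
  { unfold c, h, Rdiv. rewrite Rabs_mult.
    rewrite (Rabs_pos_eq (/ _)) by (left; exact Hh).
    apply Rle_trans with (1 * / (M * sin (x / 2))). apply Rmult_le_compat_r. left; exact Hh.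
    apply Rabs_le. assert (Q := COS_bound ((INR N + / 2) * x)). lra. lra. }
  assert (U : (fourier_rem2 x + c x) - h x <= (fourier_rem2 PI + c PI) - h PI).
  { apply (monotone_der (fun t => (fourier_rem2 t + c t) - h t) (fun t => (fourier_rem3 t + (- fourier_rem3 t - cos ((INR N + / 2) * t) * w t)) - - w t)). lra.
    - intros t Ht. apply (@is_derive_minus R_AbsRing R_NormedModule); auto.
      apply (@is_derive_plus R_AbsRing R_NormedModule); auto. apply fourier_rem2_der.
    - intros t Ht. specialize (Hw t Ht). assert (Q := COS_bound ((INR N + / 2) * t)). nra. }
  assert (V : - (fourier_rem2 x + c x) - h x <= - (fourier_rem2 PI + c PI) - h PI).
  { apply (monotone_der (fun t => - (fourier_rem2 t + c t) - h t) (fun t => - (fourier_rem3 t + (- fourier_rem3 t - cos ((INR N + / 2) * t) * w t)) - - w t)). lra.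
    - intros t Ht. apply (@is_derive_minus R_AbsRing R_NormedModule); auto.
      apply (@is_derive_opp R_AbsRing R_NormedModule).
      apply (@is_derive_plus R_AbsRing R_NormedModule); auto. apply fourier_rem2_der.
    - intros t Ht. specialize (Hw t Ht). assert (Q := COS_bound ((INR N + / 2) * t)). nra. }
  rewrite fourier_rem2_PI, cPI in U, V. apply Rabs_le_between in Hc1.
  assert (B : Rabs (fourier_rem2 x) <= 2 * h x) by (apply Rabs_le; lra).
  eapply Rle_trans. apply B. unfold h.
  assert (Q := sin_lower (x / 2) ltac:(lra)).
  replace (16 / M / x) with (2 * / (M * (x / 2 / 4))) by (field; lra).
  apply Rmult_le_compat_l. lra. apply Rinv_le_contravar. apply Rmult_lt_0_compat; lra.
  apply Rmult_le_compat_l; lra.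
Qed.

(** The bound on [fourier_rem2] blows up at the origin, but [t fourier_rem2(t)] is bounded by
    [e]. It is the derivative of [m(t) = t fourier_rem1(t) - fourier_rem0(t)], so [|m(t)| <= e
    t]; and [m(t)/t^2] is the derivative of [fourier_rem0(t)/t], which is integrated from [x] to
    [PI], at which [fourier_rem0] vanishes. *)
Lemma fourier_rem0_bound_half (x : R) : 0 < x <= PI -> Rabs (fourier_rem0 x) <= 16 / M * PI.
Proof.
  intros Hx. assert (Pi := PI_RGT_0). set (e := 16 / M).
  assert (He : 0 < e) by (unfold e; apply Rdiv_lt_0_compat; lra).
  set (m := fun t => t * fourier_rem1 t - fourier_rem0 t).
  assert (Dm : forall t, is_derive m t (t * fourier_rem2 t)).
  { intros t. unfold m.
    replace (t * fourier_rem2 t) with ((1 * fourier_rem1 t + t * fourier_rem2 t) - fourier_rem1 t) by ring.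
    apply (@is_derive_minus R_AbsRing R_NormedModule); [|apply fourier_rem0_der].
    apply (is_derive_mult (fun t : R => t) fourier_rem1 t 1 (fourier_rem2 t)). apply (@is_derive_id R_AbsRing). apply fourier_rem1_der. apply Rmult_comm. }
  assert (Bm : forall t, 0 <= t <= PI -> Rabs (t * fourier_rem2 t) <= e).
  { intros t Ht. destruct (Req_dec t 0) as [-> | N0]. rewrite Rmult_0_l, Rabs_R0; lra.
    rewrite Rabs_mult, Rabs_pos_eq by lra. assert (Q := fourier_rem2_bound t ltac:(lra)). fold e in Q.
    apply Rmult_le_compat_l with (r := t) in Q; [|lra].
    replace (t * (e / t)) with e in Q by (field; lra). auto. }
  assert (m0 : m 0 = 0) by (unfold m; rewrite fourier_rem0_0; ring).
  assert (Hm : forall t, 0 <= t <= PI -> Rabs (m t) <= e * t).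
  { intros t Ht. apply Rabs_le.
    assert (U := monotone_der (fun s => e * s - m s) (fun s => e - s * fourier_rem2 s) 0 t ltac:(lra)).
    assert (V := monotone_der (fun s => e * s + m s) (fun s => e + s * fourier_rem2 s) 0 t ltac:(lra)).
    cbv beta in U, V. rewrite m0 in U, V.
    assert (U' : e * 0 - 0 <= e * t - m t).
    { apply U. intros s Hs. apply (@is_derive_minus R_AbsRing R_NormedModule); auto. auto_derive; auto; ring.
      intros s Hs. assert (Q := Bm s ltac:(lra)). apply Rabs_le_between in Q. lra. }
    assert (V' : e * 0 + 0 <= e * t + m t).
    { apply V. intros s Hs. apply (@is_derive_plus R_AbsRing R_NormedModule); auto. auto_derive; auto; ring.
      intros s Hs. assert (Q := Bm s ltac:(lra)). apply Rabs_le_between in Q. lra. }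
    lra. }
  assert (Dq : forall t, 0 < t -> is_derive (fun s => fourier_rem0 s / s) t (m t / t ^ 2)).
  { intros t Ht. unfold m.
    replace ((t * fourier_rem1 t - fourier_rem0 t) / t ^ 2) with ((fourier_rem1 t * t - fourier_rem0 t * 1) / t ^ 2) by (field; lra).
    apply (is_derive_div fourier_rem0 (fun s => s) t (fourier_rem1 t) 1). apply fourier_rem0_der. apply (@is_derive_id R_AbsRing). lra. }
  assert (Dl : forall t, 0 < t -> is_derive (fun s => e * ln s) t (e / t)).
  { intros t Ht. auto_derive; auto. field. lra. }
  assert (Bq : forall t, x <= t <= PI -> Rabs (m t / t ^ 2) <= e / t).
  { intros t Ht. unfold Rdiv. rewrite Rabs_mult, (Rabs_pos_eq (/ t ^ 2)) by (left; apply Rinv_0_lt_compat, pow_lt; lra).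
    replace (e * / t) with (e * t * / t ^ 2) by (field; lra).
    apply Rmult_le_compat_r. left; apply Rinv_0_lt_compat, pow_lt; lra. apply Hm. lra. }
  assert (U : fourier_rem0 x / x + e * ln x <= fourier_rem0 PI / PI + e * ln PI).
  { apply (monotone_der (fun s => fourier_rem0 s / s + e * ln s) (fun s => m s / s ^ 2 + e / s)). lra.
    intros s Hs. apply (@is_derive_plus R_AbsRing R_NormedModule). apply Dq; lra. apply Dl; lra.
    intros s Hs. assert (Q := Bq s Hs). apply Rabs_le_between in Q. lra. }
  assert (V : e * ln x - fourier_rem0 x / x <= e * ln PI - fourier_rem0 PI / PI).
  { apply (monotone_der (fun s => e * ln s - fourier_rem0 s / s) (fun s => e / s - m s / s ^ 2)). lra.
    intros s Hs. apply (@is_derive_minus R_AbsRing R_NormedModule). apply Dl; lra. apply Dq; lra.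
    intros s Hs. assert (Q := Bq s Hs). apply Rabs_le_between in Q. lra. }
  rewrite fourier_rem0_PI in U, V. replace (0 / PI) with 0 in U, V by (field; lra).
  assert (L : ln PI - ln x <= PI / x).
  { rewrite <- ln_div by lra. assert (P : 0 < PI / x) by (apply Rdiv_lt_0_compat; lra).
    assert (Q := exp_ineq1_le (ln (PI / x))). rewrite exp_ln in Q by auto. lra. }
  assert (B : Rabs (fourier_rem0 x / x) <= e * (PI / x)) by (apply Rabs_le; split; nra).
  replace (fourier_rem0 x) with (fourier_rem0 x / x * x) by (field; lra). rewrite Rabs_mult, (Rabs_pos_eq x) by lra.
  apply Rmult_le_compat_r with (r := x) in B; [|lra].
  replace (e * (PI / x) * x) with (e * PI) in B by (field; lra). auto.
Qed.

Lemma fourier_rem0_sym (x : R) : fourier_rem0 (2 * PI - x) = - fourier_rem0 x.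
Proof.
  unfold fourier_rem0. rewrite (rsum_ext (fun k => sin (INR k * (2 * PI - x)) / INR k ^ 3) (fun k => (-1) * (sin (INR k * x) / INR k ^ 3))).
  rewrite rsum_scal. field.
  intros k. replace (INR k * (2 * PI - x)) with (- (INR k * x) + 2 * INR k * PI) by ring.
  rewrite sin_period, sin_neg. unfold Rdiv. ring.
Qed.

Lemma fourier_rem0_bound (x : R) : 0 <= x <= 2 * PI -> Rabs (fourier_rem0 x) <= 16 / M * PI.
Proof.
  intros Hx. assert (Pi := PI_RGT_0).
  assert (He : 0 < 16 / M * PI) by (apply Rmult_lt_0_compat; auto; apply Rdiv_lt_0_compat; lra).
  destruct (Req_dec x 0) as [-> | N0]. rewrite fourier_rem0_0, Rabs_R0. lra.
  destruct (Rle_dec x PI). apply fourier_rem0_bound_half; lra.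
  destruct (Req_dec x (2 * PI)) as [E | N1].
  - replace x with (2 * PI - 0) by lra. rewrite fourier_rem0_sym, fourier_rem0_0, Ropp_0, Rabs_R0. lra.
  - replace x with (2 * PI - (2 * PI - x)) by ring. rewrite fourier_rem0_sym, Rabs_Ropp. apply fourier_rem0_bound_half. lra.
Qed.

(** The cubic is [B_3(x)], and the series is [fourier_rem0] rescaled by [2 pi]. The convergence
    is uniform on the closed period, which is what exchanging sum and integral will need. *)
Lemma Bern3_Fourier (x : R) : 0 <= x <= 1 ->
  Rabs (rsum (fun k => 2 * sin (2 * PI * INR k * x) / (2 * PI * INR k) ^ 3) N - (x ^ 3 - 3 / 2 * x ^ 2 + x / 2) / 6)
   <= 4 / INR (S N).
Proof.
  intros Hx. assert (Pi := PI_RGT_0). assert (P3 := PI2_3_2).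
  assert (E : rsum (fun k => 2 * sin (2 * PI * INR k * x) / (2 * PI * INR k) ^ 3) N =
     / (4 * PI ^ 3) * rsum (fun k => sin (INR k * (2 * PI * x)) / INR k ^ 3) N).
  { rewrite <- rsum_scal. clear. assert (Pi := PI_RGT_0). induction N as [|n IH]. reflexivity.
    cbn [rsum]. rewrite IH. f_equal. assert (P := lt_0_INR (S n) ltac:(lia)).
    replace (INR (S n) * (2 * PI * x)) with (2 * PI * INR (S n) * x) by ring. field. lra. }
  rewrite E.
  replace (/ (4 * PI ^ 3) * rsum (fun k => sin (INR k * (2 * PI * x)) / INR k ^ 3) N - (x ^ 3 - 3 / 2 * x ^ 2 + x / 2) / 6)
   with (- (/ (4 * PI ^ 3) * fourier_rem0 (2 * PI * x))) by (unfold fourier_rem0; field; lra).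
  assert (Q : 0 < / (4 * PI ^ 3)). { apply Rinv_0_lt_compat. apply Rmult_lt_0_compat. lra. apply pow_lt; auto. }
  rewrite Rabs_Ropp, Rabs_mult, (Rabs_pos_eq (/ _)) by lra.
  apply Rle_trans with (/ (4 * PI ^ 3) * (16 / M * PI)).
  apply Rmult_le_compat_l. lra. apply fourier_rem0_bound. nra.
  replace (/ (4 * PI ^ 3) * (16 / M * PI)) with (4 * / (PI ^ 2 * M)) by (field; lra).
  unfold Rdiv. apply Rmult_le_compat_l. lra. apply Rinv_le_contravar. apply lt_0_INR; lia.
  rewrite S_INR. unfold M. assert (PN := pos_INR N). assert (1 <= PI ^ 2) by (simpl; nra). nra.
Qed.
End Fourier.

(** * Complex derivatives *)

Open Scope C_scope.
Local Bind Scope C_scope with C.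
Local Arguments Cmod x%_C_scope.
Local Arguments Re z%_C_scope.
Local Arguments Im z%_C_scope.

Lemma choose_fun {A B : Type} (P : A -> B -> Prop) :
  (forall a, exists b, P a b) -> exists f, forall a, P a (f a).
Proof.
  intros H. exists (fun a => proj1_sig (constructive_indefinite_description _ (H a))).
  intros a. apply proj2_sig.
Qed.

(** Stated with a non-strict inequality and without division, so that [h = 0] is allowed and the
    rules of differentiation need no case distinction. *)
Definition Cder (f : C -> C) (z l : C) : Prop :=
  forall eps : R, 0 < eps -> exists d : R, 0 < d /\
    forall h : C, Cmod h < d ->
      Cmod (f (z + h) - f z - l * h) <= eps * Cmod h.

Definition Ccont (f : C -> C) (z : C) : Prop :=
  forall eps : R, 0 < eps -> exists d : R, 0 < d /\
    forall h : C, Cmod h < d -> Cmod (f (z + h) - f z) <= eps.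

Ltac min_split H H1 H2 :=
  pose proof (Rlt_le_trans _ _ _ H (Rmin_l _ _)) as H1;
  pose proof (Rlt_le_trans _ _ _ H (Rmin_r _ _)) as H2.

Lemma Cplus_minus_cancel (y z : C) : z + (y - z) = y.
Proof. ring. Qed.

Lemma Cminus_0_r (x : C) : x - 0 = x.
Proof. ring. Qed.

Lemma Cmod_diag (z : C) : Cmod (z - z) = 0%R.
Proof. replace (z - z) with (RtoC 0) by ring. apply Cmod_0. Qed.

Lemma RtoC_neq (r : R) : r <> 0%R -> RtoC r <> 0.
Proof. intros H E. apply H, RtoC_inj, E. Qed.

Lemma Cmod_minus_sym (x y : C) : Cmod (x - y) = Cmod (y - x).
Proof. rewrite <- (Cmod_opp (x - y)). f_equal. ring. Qed.

Lemma Cmod_minus_le (x y : C) : (Cmod (x - y) <= Cmod x + Cmod y).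
Proof. unfold Cminus. rewrite <- (Cmod_opp y). apply Cmod_triangle. Qed.

Lemma Cmod_triangle_inv (x y : C) : (Cmod x - Cmod y <= Cmod (x - y)).
Proof.
  assert (H := Cmod_triangle (x - y) y).
  replace (x - y + y) with x in H by ring. lra.
Qed.

Lemma Cmod_triangle_inv' (x y : C) : (Cmod x - Cmod y <= Cmod (x + y)).
Proof.
  assert (H := Cmod_triangle_inv x (- y)). rewrite Cmod_opp in H.
  replace (x - - y) with (x + y) in H by ring. lra.
Qed.

Lemma Cder_is_derive (f : C -> C) (z l : C) :
  Cder f z l <-> @is_derive C_AbsRing C_NormedModule f z l.
Proof.
  split; intros H.
  - split.
    + apply (@is_linear_scal_l C_AbsRing C_NormedModule l).
    + intros x Hx.
      assert (Hxz : x = z).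
      { symmetry. apply (is_filter_lim_locally_unique (V := AbsRing_NormedModule C_AbsRing)). exact Hx. }
      subst x. intros eps.
      destruct (H eps (cond_pos eps)) as [d [Hd H']].
      exists (mkposreal d Hd). intros y Hy.
      change (Cmod (y - z) < d) in Hy.
      specialize (H' _ Hy).
      rewrite Cplus_minus_cancel in H'.
      change (Cmod (f y - f z - (y - z) * l) <= eps * Cmod (y - z)).
      rewrite (Cmult_comm (y - z)). exact H'.
  - intros eps Heps. destruct H as [_ H].
    assert (Hl : is_filter_lim (locally (T := AbsRing_UniformSpace C_AbsRing) z) z).
    { intros P HP; exact HP. }
    specialize (H z Hl (mkposreal eps Heps)).
    destruct H as [d H]. exists d. split. apply cond_pos.
    intros h Hh.
    assert (Hb : @ball (AbsRing_UniformSpace C_AbsRing) z d (z + h)).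
    { change (Cmod (z + h - z) < d). replace (z + h - z) with h by ring. exact Hh. }
    specialize (H _ Hb).
    change (Cmod (f (z+h) - f z - (z + h - z) * l) <= eps * Cmod (z + h - z)) in H.
    replace (z + h - z) with h in H by ring.
    rewrite (Cmult_comm l). exact H.
Qed.

Lemma Cder_Ccont (f : C -> C) (z l : C) : Cder f z l -> Ccont f z.
Proof.
  intros H eps Heps. destruct (H 1%R Rlt_0_1) as [d [Hd H']].
  assert (Hl := Cmod_ge_0 l).
  set (k := (Cmod l + 1)%R).
  assert (Hk : (0 < k)) by (unfold k; lra).
  assert (Hq : (0 < eps / k)) by (apply Rdiv_lt_0_compat; lra).
  exists (Rmin d (eps / k)). split.
  { apply Rmin_glb_lt; auto. }
  intros h Hh.
  min_split Hh Hh1 Hh2.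
  specialize (H' h Hh1).
  replace (f (z + h) - f z) with ((f (z + h) - f z - l * h) + l * h) by ring.
  eapply Rle_trans. apply Cmod_triangle. rewrite Cmod_mult.
  apply Rle_trans with (k * Cmod h)%R. unfold k; lra.
  apply Rle_trans with (k * (eps / k))%R.
  apply Rmult_le_compat_l; lra. right. field. lra.
Qed.

Lemma Cder_eq (f : C -> C) (z l l' : C) : Cder f z l -> l = l' -> Cder f z l'.
Proof. intros H <-; exact H. Qed.

Lemma Cder_ext_loc (f g : C -> C) (z l : C) :
  (exists d : R, 0 < d /\ forall h, Cmod h < d -> f (z + h) = g (z + h)) ->
  Cder f z l -> Cder g z l.
Proof.
  intros [d0 [Hd0 E]] H eps Heps.
  destruct (H eps Heps) as [d [Hd H']].
  exists (Rmin d d0). split. apply Rmin_glb_lt; auto.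
  intros h Hh.
  assert (E0 : f z = g z).
  { replace z with (z + 0) by ring. apply E. rewrite Cmod_0. exact Hd0. }
  min_split Hh Ha Hb. rewrite <- E0, <- E; auto.
Qed.

Lemma Cder_ext (f g : C -> C) (z l : C) :
  (forall w, f w = g w) -> Cder f z l -> Cder g z l.
Proof.
  intros E. apply Cder_ext_loc. exists 1%R. split. lra. intros; apply E.
Qed.

Lemma Cder_const (a z : C) : Cder (fun _ => a) z 0.
Proof.
  intros eps Heps. exists 1%R. split. lra. intros h _.
  replace (a - a - 0 * h) with (RtoC 0) by ring. rewrite Cmod_0.
  apply Rmult_le_pos. lra. apply Cmod_ge_0.
Qed.

Lemma Cder_id (z : C) : Cder (fun w => w) z 1.
Proof.
  intros eps Heps. exists 1%R. split. lra. intros h _.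
  replace (z + h - z - 1 * h) with (RtoC 0) by ring. rewrite Cmod_0.
  apply Rmult_le_pos. lra. apply Cmod_ge_0.
Qed.

Lemma Cder_plus (f g : C -> C) (z l m : C) :
  Cder f z l -> Cder g z m -> Cder (fun w => f w + g w) z (l + m).
Proof.
  intros Hf Hg eps Heps.
  assert (He : (0 < eps / 2)) by lra.
  destruct (Hf _ He) as [d1 [Hd1 H1]]. destruct (Hg _ He) as [d2 [Hd2 H2]].
  exists (Rmin d1 d2). split. apply Rmin_glb_lt; auto.
  intros h Hh.
  min_split Hh Ha Hb.
  specialize (H1 _ Ha). specialize (H2 _ Hb).
  replace (f (z + h) + g (z + h) - (f z + g z) - (l + m) * h)
    with ((f (z + h) - f z - l * h) + (g (z + h) - g z - m * h)) by ring.
  eapply Rle_trans. apply Cmod_triangle. lra.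
Qed.

Lemma Cder_comp (f g : C -> C) (z l m : C) :
  Cder g z m -> Cder f (g z) l -> Cder (fun w => f (g w)) z (l * m).
Proof.
  intros Hg Hf eps Heps.
  assert (Hl := Cmod_ge_0 l). assert (Hm := Cmod_ge_0 m).
  set (e1 := (eps / 2 / (Cmod m + 1))%R).
  assert (He1 : (0 < e1)) by (unfold e1; apply Rdiv_lt_0_compat; lra).
  set (e2 := Rmin 1 (eps / 2 / (Cmod l + 1))%R).
  assert (He2 : (0 < e2)).
  { unfold e2. apply Rmin_glb_lt. lra. apply Rdiv_lt_0_compat; lra. }
  destruct (Hf _ He1) as [d1 [Hd1 H1]]. destruct (Hg _ He2) as [d2 [Hd2 H2]].
  set (d3 := (d1 / (Cmod m + 1))%R).
  assert (Hd3 : (0 < d3)) by (unfold d3; apply Rdiv_lt_0_compat; lra).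
  exists (Rmin d2 d3). split. apply Rmin_glb_lt; auto.
  intros h Hh.
  min_split Hh Hb Hc.
  specialize (H2 _ Hb). assert (Hh0 := Cmod_ge_0 h).
  set (k := g (z + h) - g z) in *.
  assert (Hk : (Cmod k <= (Cmod m + 1) * Cmod h)).
  { replace k with ((k - m * h) + m * h) by ring.
    eapply Rle_trans. apply Cmod_triangle. rewrite Cmod_mult.
    assert (e2 <= 1) by apply Rmin_l. nra. }
  assert (Hk1 : (Cmod k < d1)).
  { eapply Rle_lt_trans. apply Hk.
    replace d1 with ((Cmod m + 1) * d3)%R by (unfold d3; field; lra).
    apply Rmult_lt_compat_l; lra. }
  specialize (H1 _ Hk1).
  replace (g z + k) with (g (z + h)) in H1 by (unfold k; ring).
  replace (f (g (z + h)) - f (g z) - l * m * h)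
    with ((f (g (z + h)) - f (g z) - l * k) + l * (k - m * h)) by ring.
  eapply Rle_trans. apply Cmod_triangle. rewrite Cmod_mult.
  assert (T1 : (e1 * Cmod k <= eps / 2 * Cmod h)).
  { apply Rle_trans with (e1 * ((Cmod m + 1) * Cmod h))%R.
    apply Rmult_le_compat_l; lra. right. unfold e1. field. lra. }
  assert (T2 : (Cmod l * Cmod (k - m * h) <= eps / 2 * Cmod h)).
  { apply Rle_trans with ((Cmod l + 1) * (eps / 2 / (Cmod l + 1) * Cmod h))%R.
    apply Rmult_le_compat; try lra. apply Cmod_ge_0.
    eapply Rle_trans. apply H2. apply Rmult_le_compat_r; auto. apply Rmin_r.
    right. field. lra. }
  lra.
Qed.

Lemma Cder_scal (f : C -> C) (a z l : C) :
  Cder f z l -> Cder (fun w => a * f w) z (a * l).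
Proof.
  intros H.
  apply (Cder_comp (fun w => a * w) f z a l H).
  intros eps Heps. exists 1%R. split. lra. intros h _.
  replace (a * (f z + h) - a * f z - a * h) with (RtoC 0) by ring. rewrite Cmod_0.
  apply Rmult_le_pos. lra. apply Cmod_ge_0.
Qed.

Lemma Cder_sqr (z : C) : Cder (fun w => w * w) z (2 * z).
Proof.
  intros eps Heps. exists eps. split. lra. intros h Hh.
  replace ((z + h) * (z + h) - z * z - 2 * z * h) with (h * h) by ring.
  rewrite Cmod_mult. apply Rmult_le_compat_r. apply Cmod_ge_0. lra.
Qed.

Lemma Cder_mult (f g : C -> C) (z l m : C) :
  Cder f z l -> Cder g z m -> Cder (fun w => f w * g w) z (l * g z + f z * m).
Proof.
  intros Hf Hg.
  (* Polarisation: [f g = ((f + g)^2 - (f - g)^2) / 4]. *)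
  assert (A : Cder (fun w => (f w + g w) * (f w + g w)) z (2 * (f z + g z) * (l + m))).
  { apply (Cder_comp (fun w => w * w) (fun w => f w + g w)).
    apply Cder_plus; auto. apply Cder_sqr. }
  assert (Hn : Cder (fun w => f w + - (1) * g w) z (l + - (1) * m)).
  { apply Cder_plus; auto. apply Cder_scal; auto. }
  assert (B : Cder (fun w => (f w + - (1) * g w) * (f w + - (1) * g w)) z
     (2 * (f z + - (1) * g z) * (l + - (1) * m))).
  { apply (Cder_comp (fun w => w * w) (fun w => f w + - (1) * g w)); auto.
    apply Cder_sqr. }
  eapply Cder_eq.
  eapply Cder_ext; [|apply (Cder_plus _ _ _ _ _ (Cder_scal _ (1/4) _ _ A) (Cder_scal _ (- (1/4)) _ _ B))].
  - intros w. simpl. field.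
  - field.
Qed.

Lemma Cder_opp (f : C -> C) (z l : C) : Cder f z l -> Cder (fun w => - f w) z (- l).
Proof.
  intros H. eapply Cder_eq. eapply Cder_ext; [|apply (Cder_scal _ (- (1)) _ _ H)].
  intros; simpl; ring. ring.
Qed.

Lemma Cder_minus (f g : C -> C) (z l m : C) :
  Cder f z l -> Cder g z m -> Cder (fun w => f w - g w) z (l - m).
Proof. intros Hf Hg. apply Cder_plus; auto. apply Cder_opp; auto. Qed.

Lemma Cder_inv_id (z : C) : z <> 0 -> Cder (fun w => / w) z (- / (z * z)).
Proof.
  intros Hz eps Heps.
  assert (Hz' := proj1 (Cmod_gt_0 z) Hz).
  set (d := Rmin (Cmod z / 2) (eps * (Cmod z * Cmod z * Cmod z) / 2)).
  assert (Hd : (0 < d)).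
  { unfold d. apply Rmin_glb_lt. lra.
    apply Rdiv_lt_0_compat; [|lra]. repeat apply Rmult_lt_0_compat; auto. }
  exists d. split; auto.
  intros h Hh.
  min_split Hh Ha Hb.
  assert (Hzh : (Cmod z / 2 <= Cmod (z + h))).
  { assert (H := Cmod_triangle_inv' z h). lra. }
  assert (Hzh0 : z + h <> 0) by (apply Cmod_gt_0; lra).
  replace (/ (z + h) - / z - - / (z * z) * h)
    with (h * h / (z * z * (z + h))).
  2: { field. auto. }
  assert (Hnz : z * z * (z + h) <> 0) by (repeat apply Cmult_neq_0; auto).
  rewrite Cmod_div by auto. rewrite !Cmod_mult.
  assert (Hh0 := Cmod_ge_0 h).
  set (a := Cmod z) in *. set (b := Cmod (z + h)) in *. set (c := Cmod h) in *.
  unfold Rdiv.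
  replace (c * c * / (a * a * b))%R with ((c * / (a * a * b)) * c)%R by ring.
  apply Rmult_le_compat_r; auto.
  apply Rmult_le_reg_r with (a * a * b)%R.
  repeat apply Rmult_lt_0_compat; lra.
  rewrite Rmult_assoc, Rinv_l. 2: { apply Rgt_not_eq. repeat apply Rmult_lt_0_compat; lra. }
  assert (eps * (a * a * (a / 2)) <= eps * (a * a * b)).
  { apply Rmult_le_compat_l. lra. apply Rmult_le_compat_l. nra. lra. }
  lra.
Qed.

Lemma Cder_inv (f : C -> C) (z l : C) :
  f z <> 0 -> Cder f z l -> Cder (fun w => / f w) z (- l / (f z * f z)).
Proof.
  intros Hz H. eapply Cder_eq. eapply (Cder_comp (fun w => / w) f). exact H.
  apply Cder_inv_id; auto. field. auto.
Qed.

Lemma Cder_div (f g : C -> C) (z l m : C) :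
  g z <> 0 -> Cder f z l -> Cder g z m ->
  Cder (fun w => f w / g w) z ((l * g z - f z * m) / (g z * g z)).
Proof.
  intros Hz Hf Hg. eapply Cder_eq. apply (Cder_mult f (fun w => / g w)); eauto.
  apply Cder_inv; eauto. simpl. field. auto.
Qed.

Lemma Cder_pow (f : C -> C) (z l : C) (n : nat) :
  Cder f z l -> Cder (fun w => f w ^ n) z (INR n * f z ^ (pred n) * l).
Proof.
  intros H. induction n as [|n IH].
  - simpl. eapply Cder_eq. apply Cder_const. ring.
  - eapply Cder_eq. apply (Cder_mult f (fun w => f w ^ n)); eauto.
    simpl pred. rewrite S_INR, RtoC_plus. destruct n. simpl. ring. simpl. ring.
Qed.

Lemma Cder_unique (f : C -> C) (z l m : C) : Cder f z l -> Cder f z m -> l = m.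
Proof.
  rewrite !Cder_is_derive. intros Hl Hm.
  rewrite <- (is_C_derive_unique f z l Hl). apply is_C_derive_unique, Hm.
Qed.

(** Extension point: the rules for [Cexp] and [Clog] are added once these functions are known to
    be differentiable. *)
Ltac cder_ext := fail.

(** Differentiates by the structure of the function. Hypotheses are matched syntactically before
    being unified, because unifying two integrals that depend on a parameter may unfold them
    without end. What neither the rules nor the hypotheses cover is left to the user. *)
Ltac cder :=
  cbv beta;
  first [
  lazymatch goal with |- Cder (fun _ => ?a) _ _ => apply (Cder_const a) end |
  lazymatch goal with
  | |- Cder (fun w => w) _ _ => apply Cder_id
  | |- Cder (fun w => @?f w + @?g w) _ _ => apply (Cder_plus f g); cder
  | |- Cder (fun w => @?f w - @?g w) _ _ => apply (Cder_minus f g); cder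
  | |- Cder (fun w => - @?f w) _ _ => apply (Cder_opp f); cder
  | |- Cder (fun w => @?f w * @?g w) _ _ => apply (Cder_mult f g); cder
  | |- Cder (fun w => / @?f w) _ _ => apply (Cder_inv f); [|cder]
  | |- Cder (fun w => @?f w / @?g w) _ _ => apply (Cder_div f g); [|cder|cder]
  | |- Cder (fun w => @?f w ^ ?n) _ _ => eapply (Cder_pow f _ _ n); cder
  | _ => first [
      match goal with H : Cder ?f _ _ |- Cder ?f _ _ => exact H end |
      lazymatch goal with |- Cder (fun w => ?g w) ?z ?l => change (Cder g z l) end;
        match goal with H : Cder ?f _ _ |- Cder ?f _ _ => exact H end |
      cder_ext | eassumption | idtac]
  end ].

Ltac cder_val := eapply Cder_eq; [cder | cbv beta].
Ltac ccont := eapply Cder_Ccont; cder.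

(** * Limits of complex sequences *)

Definition Clim (u : nat -> C) (l : C) : Prop :=
  forall eps : R, 0 < eps -> exists n0 : nat, forall n : nat, (n0 <= n)%nat ->
    Cmod (u n - l) <= eps.

Lemma Clim_const (a : C) : Clim (fun _ => a) a.
Proof.
  intros eps Heps. exists 0%nat. intros n _.
  rewrite Cmod_diag. lra.
Qed.

Lemma Clim_ext (u v : nat -> C) (l : C) :
  (exists m, forall n, (m <= n)%nat -> u n = v n) -> Clim u l -> Clim v l.
Proof.
  intros [m E] H eps Heps. destruct (H eps Heps) as [n0 Hn0].
  exists (max m n0). intros n Hn. rewrite <- E by lia. apply Hn0. lia.
Qed.

Lemma Clim_plus (u v : nat -> C) (a b : C) :
  Clim u a -> Clim v b -> Clim (fun n => u n + v n) (a + b).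
Proof.
  intros Hu Hv eps Heps.
  destruct (Hu (eps / 2)%R) as [n1 H1]. lra.
  destruct (Hv (eps / 2)%R) as [n2 H2]. lra.
  exists (max n1 n2). intros n Hn.
  replace (u n + v n - (a + b)) with ((u n - a) + (v n - b)) by ring.
  eapply Rle_trans. apply Cmod_triangle.
  specialize (H1 n ltac:(lia)). specialize (H2 n ltac:(lia)). lra.
Qed.

Lemma Clim_comp (f : C -> C) (u : nat -> C) (l : C) :
  Ccont f l -> Clim u l -> Clim (fun n => f (u n)) (f l).
Proof.
  intros Hf Hu eps Heps. destruct (Hf eps Heps) as [d [Hd H]].
  destruct (Hu (d / 2)%R) as [n0 Hn]. lra.
  exists n0. intros n Hle. specialize (Hn n Hle).
  replace (u n) with (l + (u n - l)) by ring. apply H. lra.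
Qed.

Lemma Clim_scal (a : C) (u : nat -> C) (l : C) :
  Clim u l -> Clim (fun n => a * u n) (a * l).
Proof.
  apply (Clim_comp (fun w => a * w)).
  ccont.
Qed.

Lemma Clim_opp (u : nat -> C) (l : C) : Clim u l -> Clim (fun n => - u n) (- l).
Proof.
  apply (Clim_comp (fun w => - w)).
  ccont.
Qed.

Lemma Clim_minus (u v : nat -> C) (a b : C) :
  Clim u a -> Clim v b -> Clim (fun n => u n - v n) (a - b).
Proof. intros. apply Clim_plus; auto. apply Clim_opp; auto. Qed.

Lemma Clim_mult (u v : nat -> C) (a b : C) :
  Clim u a -> Clim v b -> Clim (fun n => u n * v n) (a * b).
Proof.
  intros Hu Hv.
  assert (S : forall w l, Clim w l -> Clim (fun n => w n * w n) (l * l)).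
  { intros w l. apply (Clim_comp (fun w => w * w)).
    ccont. }
  assert (A := S _ _ (Clim_plus _ _ _ _ Hu Hv)).
  assert (B := S _ _ (Clim_minus _ _ _ _ Hu Hv)).
  assert (D := Clim_scal (1/4) _ _ (Clim_minus _ _ _ _ A B)).
  replace (a * b) with (1 / 4 * ((a + b) * (a + b) - (a - b) * (a - b))) by field.
  eapply Clim_ext; [|exact D]. exists 0%nat. intros; simpl. field.
Qed.

Lemma Clim_unique (u : nat -> C) (a b : C) : Clim u a -> Clim u b -> a = b.
Proof.
  intros Ha Hb.
  destruct (Req_dec (Cmod (a - b)) 0) as [E | E].
  { apply Cmod_eq_0 in E. replace a with ((a - b) + b) by ring. rewrite E. ring. }
  exfalso. assert (P := Cmod_ge_0 (a - b)).
  destruct (Ha (Cmod (a - b) / 3)%R) as [n1 H1]. lra.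
  destruct (Hb (Cmod (a - b) / 3)%R) as [n2 H2]. lra.
  specialize (H1 (max n1 n2) ltac:(lia)). specialize (H2 (max n1 n2) ltac:(lia)).
  set (w := u (max n1 n2)) in *.
  assert (Q := Cmod_triangle (a - w) (w - b)).
  replace (a - w + (w - b)) with (a - b) in Q by ring.
  rewrite Cmod_minus_sym in H1. lra.
Qed.

Lemma Clim_bound (u : nat -> C) (l : C) (M : R) :
  Clim u l -> (exists m, forall n, (m <= n)%nat -> Cmod (u n) <= M) -> Cmod l <= M.
Proof.
  intros H [m HM]. apply le_epsilon. intros eps Heps.
  destruct (H eps Heps) as [n0 Hn].
  specialize (Hn (max m n0) ltac:(lia)). specialize (HM (max m n0) ltac:(lia)).
  assert (Q := Cmod_triangle_inv l (u (max m n0))).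
  rewrite Cmod_minus_sym in Hn. lra.
Qed.

Lemma Clim_squeeze0 (u : nat -> C) (v : nat -> R) (l : C) :
  (exists m, forall n, (m <= n)%nat -> Cmod (u n - l) <= v n) ->
  is_lim_seq v 0 -> Clim u l.
Proof.
  intros [m Hu] Hv eps Heps.
  apply is_lim_seq_spec in Hv. destruct (Hv (mkposreal eps Heps)) as [n0 Hn].
  exists (max m n0). intros n Hle. eapply Rle_trans. apply Hu. lia.
  specialize (Hn n ltac:(lia)). simpl in Hn. rewrite Rminus_0_r in Hn.
  apply Rabs_def2 in Hn. lra.
Qed.

Lemma Re_minus (a b : C) : Re (a - b) = (Re a - Re b)%R.
Proof. reflexivity. Qed.
Lemma Im_minus (a b : C) : Im (a - b) = (Im a - Im b)%R.
Proof. reflexivity. Qed.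

Lemma Im_le_Cmod (z : C) : Rabs (Im z) <= Cmod z.
Proof. eapply Rle_trans; [|apply Rmax_Cmod]. apply Rmax_r. Qed.

Lemma Cmod_le_ReIm (z : C) : Cmod z <= Rabs (Re z) + Rabs (Im z).
Proof.
  replace z with (RtoC (Re z) + Ci * RtoC (Im z)) at 1.
  eapply Rle_trans. apply Cmod_triangle. rewrite Cmod_mult, Cmod_Ci, !Cmod_R. lra.
  destruct z as [x y]. unfold Ci, RtoC, Cplus, Cmult; simpl. f_equal; ring.
Qed.

Lemma Clim_Re (u : nat -> C) (l : C) : Clim u l -> is_lim_seq (fun n => Re (u n)) (Re l).
Proof.
  intros H. apply is_lim_seq_spec. intros eps.
  destruct (H (eps / 2)%R) as [n0 Hn]. destruct eps; simpl; lra.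
  exists n0. intros n Hle. rewrite <- Re_minus.
  eapply Rle_lt_trans. apply re_le_Cmod. specialize (Hn n Hle).
  destruct eps; simpl in *; lra.
Qed.

Lemma Clim_Im (u : nat -> C) (l : C) : Clim u l -> is_lim_seq (fun n => Im (u n)) (Im l).
Proof.
  intros H. apply is_lim_seq_spec. intros eps.
  destruct (H (eps / 2)%R) as [n0 Hn]. destruct eps; simpl; lra.
  exists n0. intros n Hle. rewrite <- Im_minus.
  eapply Rle_lt_trans. apply Im_le_Cmod. specialize (Hn n Hle).
  destruct eps; simpl in *; lra.
Qed.

Lemma Clim_ReIm (u : nat -> C) (l : C) :
  is_lim_seq (fun n => Re (u n)) (Re l) -> is_lim_seq (fun n => Im (u n)) (Im l) -> Clim u l.
Proof.
  intros Hr Hi eps Heps.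
  apply is_lim_seq_spec in Hr. apply is_lim_seq_spec in Hi.
  assert (He : 0 < eps / 2) by lra.
  destruct (Hr (mkposreal _ He)) as [n1 H1]. destruct (Hi (mkposreal _ He)) as [n2 H2].
  exists (max n1 n2). intros n Hn. eapply Rle_trans. apply Cmod_le_ReIm.
  specialize (H1 n ltac:(lia)). specialize (H2 n ltac:(lia)). simpl in H1, H2.
  rewrite Re_minus, Im_minus. lra.
Qed.

Lemma Clim_R (u : nat -> R) (l : R) : is_lim_seq u l -> Clim (fun n => RtoC (u n)) (RtoC l).
Proof.
  intros H. apply Clim_ReIm; simpl; auto. apply is_lim_seq_const.
Qed.

Lemma Clim_Clim_seq (u : nat -> C) (l : C) : Clim u l -> Clim_seq u = l.
Proof.
  intros H. unfold Clim_seq.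
  rewrite (is_lim_seq_unique _ _ (Clim_Re _ _ H)), (is_lim_seq_unique _ _ (Clim_Im _ _ H)).
  destruct l; reflexivity.
Qed.

Lemma Clim_incr (u : nat -> C) (l : C) (k : nat) :
  Clim u l -> Clim (fun n => u (n + k)%nat) l.
Proof.
  intros H eps Heps. destruct (H eps Heps) as [n0 Hn]. exists n0. intros n Hle.
  apply Hn. lia.
Qed.

Lemma Clim_decr (u : nat -> C) (l : C) : Clim (fun n => u (S n)) l -> Clim u l.
Proof.
  intros H eps Heps. destruct (H eps Heps) as [n0 Hn]. exists (S n0). intros [|n] Hle. lia.
  apply Hn. lia.
Qed.

Lemma Csum_S (m l : nat) (f : nat -> C) : Csum m (S l) f = Csum m l f + f (m + l)%nat.
Proof.
  revert m. induction l as [|l IH]; intros m.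
  - unfold Csum; simpl. rewrite Nat.add_0_r. ring.
  - assert (E : forall m l, Csum m (S l) f = f m + Csum (S m) l f) by reflexivity.
    rewrite E, IH, E. replace (S m + l)%nat with (m + S l)%nat by lia. ring.
Qed.

Lemma sum_n_Csum (u : nat -> C) (n : nat) :
  @sum_n C_AbelianMonoid u n = Csum 0 (S n) u.
Proof.
  induction n as [|n IH].
  - rewrite sum_O. unfold Csum; simpl. ring.
  - rewrite sum_Sn, IH, (Csum_S 0 (S n)). reflexivity.
Qed.

Lemma is_series_Clim (u : nat -> C) (s : C) :
  @is_series C_AbsRing C_NormedModule u s <-> Clim (fun n => Csum 0 n u) s.
Proof.
  split.
  - intros H. unfold is_series in H.
    apply Clim_decr. intros eps Heps.
    assert (Q : 0 < sqrt 2) by (apply sqrt_lt_R0; lra).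
    assert (He : 0 < eps / sqrt 2) by (apply Rdiv_lt_0_compat; auto).
    destruct (proj1 (filterlim_locally _ _) H (mkposreal _ He)) as [n0 Hn].
    exists n0. intros n Hle. specialize (Hn n Hle). rewrite <- sum_n_Csum.
    apply C_NormedModule_mixin_compat2 in Hn. simpl in Hn.
    left. eapply Rlt_le_trans. apply Hn. right. field. lra.
  - intros H. unfold is_series. apply (filterlim_locally (U := C_UniformSpace)).
    intros eps. assert (He : 0 < eps / 2) by (destruct eps; simpl; lra).
    destruct (H _ He) as [n0 Hn]. exists n0. intros n Hle.
    rewrite sum_n_Csum. apply C_NormedModule_mixin_compat1.
    change (Cmod (Csum 0 (S n) u - s) < eps). specialize (Hn (S n) ltac:(lia)).
    destruct eps; simpl in *; lra.
Qed.

(** * Complex integrals over real intervals *)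

Definition is_CRInt (f : R -> C) (a b : R) (l : C) : Prop := @is_RInt C_R_NormedModule f a b l.
Definition ex_CRInt (f : R -> C) (a b : R) : Prop := exists l : C, is_CRInt f a b l.
Definition CRInt (f : R -> C) (a b : R) : C := @RInt C_R_CompleteNormedModule f a b.

Lemma norm_C_R (z : C) : @norm R_AbsRing C_R_NormedModule z = Cmod z.
Proof.
  destruct z as [x y]. unfold norm; simpl. unfold prod_norm, Cmod; simpl.
  f_equal. unfold norm; simpl. unfold abs; simpl.
  rewrite !Rmult_1_r, <- !Rabs_mult, !Rabs_pos_eq by apply Rle_0_sqr. reflexivity.
Qed.

Lemma ball_C_R (z w : C) (e : R) : Cmod (w - z) < e -> @ball C_UniformSpace z e w.
Proof. intros H. apply C_NormedModule_mixin_compat1. exact H. Qed.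

Lemma ball_C_R_inv (z w : C) (e : posreal) :
  @ball C_UniformSpace z e w -> Cmod (w - z) <= 2 * e.
Proof.
  intros [H1 H2]. eapply Rle_trans. apply Cmod_le_ReIm. rewrite Re_minus, Im_minus.
  unfold ball in H1, H2; simpl in H1, H2. unfold AbsRing_ball, abs, minus, plus, opp in H1, H2; simpl in H1, H2.
  unfold Re, Im. unfold Rminus. lra.
Qed.

Definition Rcont (f : R -> C) (x : R) : Prop := @continuous R_UniformSpace C_R_NormedModule f x.

Lemma Rcont_spec (f : R -> C) (x : R) :
  (forall eps, 0 < eps -> exists d, 0 < d /\ forall y : R, Rabs (y - x) < d -> Cmod (f y - f x) <= eps) ->
  Rcont f x.
Proof.
  intros H. unfold Rcont, continuous.
  apply (filterlim_locally (U := C_UniformSpace)). intros eps.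
  assert (He : 0 < eps / 2) by (destruct eps; simpl; lra).
  destruct (H _ He) as [d [Hd Hc]].
  exists (mkposreal d Hd). intros y Hy. apply ball_C_R.
  apply Hc in Hy. destruct eps; simpl in *; lra.
Qed.

Lemma Rcont_spec_inv (f : R -> C) (x : R) : Rcont f x ->
  forall eps, 0 < eps -> exists d, 0 < d /\ forall y : R, Rabs (y - x) < d -> Cmod (f y - f x) <= eps.
Proof.
  intros H eps Heps. assert (He : 0 < eps / 2) by lra.
  destruct (proj1 (filterlim_locally (U := C_UniformSpace) _ _) H (mkposreal _ He)) as [d Hd].
  exists d. split. apply cond_pos. intros y Hy. specialize (Hd y Hy).
  apply ball_C_R_inv in Hd. simpl in Hd. lra.
Qed.

Lemma Ccont_Rcont (f : C -> C) (x : R) : Ccont f x -> Rcont (fun t => f (RtoC t)) x.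
Proof.
  intros H. apply Rcont_spec. intros eps Heps. destruct (H eps Heps) as [d [Hd Hc]].
  exists d. split; auto. intros y Hy.
  replace (RtoC y) with (RtoC x + RtoC (y - x)) by (rewrite <- RtoC_plus; f_equal; ring).
  apply Hc. rewrite Cmod_R. exact Hy.
Qed.

Lemma Rcont_mult (f g : R -> C) (x : R) : Rcont f x -> Rcont g x -> Rcont (fun t => f t * g t) x.
Proof.
  intros Hf Hg. apply Rcont_spec. intros eps Heps.
  assert (Pf := Cmod_ge_0 (f x)). assert (Pg := Cmod_ge_0 (g x)).
  set (e1 := Rmin 1 (eps / 2 / (Cmod (f x) + 1))).
  set (e2 := (eps / 2 / (Cmod (g x) + 1))%R).
  assert (He1 : 0 < e1). { apply Rmin_glb_lt. lra. apply Rdiv_lt_0_compat; lra. }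
  assert (He2 : 0 < e2). { apply Rdiv_lt_0_compat; lra. }
  assert (e1 <= 1) by apply Rmin_l.
  destruct (Rcont_spec_inv _ _ Hf (Rmin 1 e2)) as [d1 [Hd1 H1]]. apply Rmin_glb_lt; lra.
  destruct (Rcont_spec_inv _ _ Hg (eps / 2 / (Cmod (f x) + 1))%R) as [d2 [Hd2 H2]].
  apply Rdiv_lt_0_compat; lra.
  exists (Rmin d1 d2). split. apply Rmin_glb_lt; auto. intros y Hy.
  specialize (H1 y (Rlt_le_trans _ _ _ Hy (Rmin_l _ _))).
  specialize (H2 y (Rlt_le_trans _ _ _ Hy (Rmin_r _ _))).
  assert (A1 : Cmod (f y - f x) <= 1) by (eapply Rle_trans; [apply H1 | apply Rmin_l]).
  assert (A2 : Cmod (f y - f x) <= e2) by (eapply Rle_trans; [apply H1 | apply Rmin_r]).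
  replace (f y * g y - f x * g x) with ((f y - f x) * g x + f y * (g y - g x)) by ring.
  eapply Rle_trans. apply Cmod_triangle. rewrite !Cmod_mult.
  assert (B : Cmod (f y) <= Cmod (f x) + 1).
  { assert (Q := Cmod_triangle_inv (f y) (f x)). lra. }
  assert (T1 : Cmod (f y - f x) * Cmod (g x) <= eps / 2).
  { apply Rle_trans with (e2 * (Cmod (g x) + 1))%R.
    apply Rmult_le_compat; try lra. apply Cmod_ge_0. right. unfold e2. field. lra. }
  assert (T2 : Cmod (f y) * Cmod (g y - g x) <= eps / 2).
  { apply Rle_trans with ((Cmod (f x) + 1) * (eps / 2 / (Cmod (f x) + 1)))%R.
    apply Rmult_le_compat; try lra; apply Cmod_ge_0. right. field. lra. }
  lra.
Qed.

Lemma ex_CRInt_cont (f : R -> C) (a b : R) :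
  (forall x, Rmin a b <= x <= Rmax a b -> Rcont f x) -> ex_CRInt f a b.
Proof. intros H. apply (@ex_RInt_continuous C_R_CompleteNormedModule). exact H. Qed.

Lemma CRInt_correct (f : R -> C) (a b : R) : ex_CRInt f a b -> is_CRInt f a b (CRInt f a b).
Proof. intros H. apply (@RInt_correct C_R_CompleteNormedModule). exact H. Qed.

Lemma CRInt_unique (f : R -> C) (a b : R) (l : C) : is_CRInt f a b l -> CRInt f a b = l.
Proof. intros H. apply (@is_RInt_unique C_R_CompleteNormedModule). exact H. Qed.

Lemma is_CRInt_uniq (f : R -> C) (a b : R) (l l' : C) :
  is_CRInt f a b l -> is_CRInt f a b l' -> l = l'.
Proof. intros H H'. apply CRInt_unique in H. apply CRInt_unique in H'. congruence. Qed.

Lemma is_CRInt_plus (f g : R -> C) (a b : R) (k l : C) :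
  is_CRInt f a b k -> is_CRInt g a b l -> is_CRInt (fun t => f t + g t) a b (k + l).
Proof. apply (@is_RInt_plus C_R_NormedModule). Qed.

Lemma is_CRInt_minus (f g : R -> C) (a b : R) (k l : C) :
  is_CRInt f a b k -> is_CRInt g a b l -> is_CRInt (fun t => f t - g t) a b (k - l).
Proof. apply (@is_RInt_minus C_R_NormedModule). Qed.

Lemma is_CRInt_pair (f : R -> C) (a b : R) (l : C) :
  is_CRInt f a b l <->
  (is_RInt (fun t => Re (f t)) a b (Re l) /\ is_RInt (fun t => Im (f t)) a b (Im l)).
Proof.
  split.
  - intros H. split.
    apply (@is_RInt_fct_extend_fst R_NormedModule R_NormedModule f a b l H).
    apply (@is_RInt_fct_extend_snd R_NormedModule R_NormedModule f a b l H).
  - intros [H1 H2]. destruct l as [u v].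
    apply (@is_RInt_fct_extend_pair R_NormedModule R_NormedModule f a b u v H1 H2).
Qed.

Lemma is_CRInt_scal (c : C) (f : R -> C) (a b : R) (l : C) :
  is_CRInt f a b l -> is_CRInt (fun t => c * f t) a b (c * l).
Proof.
  intros H. apply is_CRInt_pair in H. destruct H as [H1 H2]. apply is_CRInt_pair. split.
  - rewrite re_mult. eapply is_RInt_ext; [|apply (@is_RInt_minus R_NormedModule);
      [apply (@is_RInt_scal R_NormedModule _ _ _ (Re c) _ H1)
      |apply (@is_RInt_scal R_NormedModule _ _ _ (Im c) _ H2)]].
    intros x _. rewrite re_mult. reflexivity.
  - rewrite im_mult. eapply is_RInt_ext; [|apply (@is_RInt_plus R_NormedModule);
      [apply (@is_RInt_scal R_NormedModule _ _ _ (Re c) _ H2)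
      |apply (@is_RInt_scal R_NormedModule _ _ _ (Im c) _ H1)]].
    intros x _. rewrite im_mult. reflexivity.
Qed.

Lemma is_CRInt_Chasles (f : R -> C) (a b c : R) (k l : C) :
  is_CRInt f a b k -> is_CRInt f b c l -> is_CRInt f a c (k + l).
Proof. apply (@is_RInt_Chasles C_R_NormedModule). Qed.

Lemma is_CRInt_ext (f g : R -> C) (a b : R) (l : C) :
  (forall x, Rmin a b < x < Rmax a b -> f x = g x) -> is_CRInt f a b l -> is_CRInt g a b l.
Proof. apply (@is_RInt_ext C_R_NormedModule). Qed.

Lemma is_CRInt_norm (f : R -> C) (g : R -> R) (a b : R) (l : C) (m : R) :
  a <= b -> (forall x, a <= x <= b -> Cmod (f x) <= g x) ->
  is_CRInt f a b l -> is_RInt g a b m -> Cmod l <= m.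
Proof.
  intros Hab Hfg Hf Hg. rewrite <- norm_C_R.
  eapply (@norm_RInt_le C_R_NormedModule f g a b); eauto.
  intros x Hx. rewrite norm_C_R. auto.
Qed.

Lemma is_CRInt_norm_const (f : R -> C) (a b M : R) (l : C) :
  a <= b -> (forall x, a <= x <= b -> Cmod (f x) <= M) ->
  is_CRInt f a b l -> Cmod l <= (b - a) * M.
Proof.
  intros Hab Hf Hl.
  apply (is_CRInt_norm f (fun _ => M) a b l _ Hab Hf Hl).
  apply (@is_RInt_const R_NormedModule).
Qed.

Lemma is_CRInt_swap (f : R -> C) (a b : R) (l : C) : is_CRInt f a b l -> is_CRInt f b a (- l).
Proof. apply (@is_RInt_swap C_R_NormedModule). Qed.

(** Restriction to the real axis, the form in which the fundamental theorem of calculus is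
    applied. *)
Lemma Cder_is_derive_R (f : C -> C) (x : R) (l : C) :
  Cder f x l -> @is_derive R_AbsRing C_R_NormedModule (fun t : R => f (RtoC t)) x l.
Proof.
  intros H. split.
  - apply (@is_linear_scal_l R_AbsRing C_R_NormedModule l).
  - intros y Hy.
    assert (Hxy : y = x).
    { symmetry. apply (is_filter_lim_locally_unique (V := R_NormedModule)). exact Hy. }
    subst y. intros eps.
    destruct (H eps (cond_pos eps)) as [d [Hd H']].
    exists (mkposreal d Hd). clear Hy. intros y Hy.
    change (Rabs (y - x) < d) in Hy.
    specialize (H' (RtoC (y - x))). rewrite Cmod_R in H'. specialize (H' Hy).
    rewrite norm_C_R.
    change (Cmod (f (RtoC y) - f (RtoC x) - @scal R_Ring C_R_ModuleSpace (y - x)%R l) <= eps * Rabs (y - x)%R).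
    rewrite scal_R_Cmult, (Cmult_comm (RtoC (y - x))).
    replace (RtoC y) with (RtoC x + RtoC (y - x)) at 1 by (rewrite <- RtoC_plus; f_equal; ring).
    exact H'.
Qed.

Lemma is_CRInt_FTC (F : C -> C) (f : R -> C) (a b : R) :
  (forall x : R, Rmin a b <= x <= Rmax a b -> Cder F x (f x)) ->
  (forall x : R, Rmin a b <= x <= Rmax a b -> Rcont f x) ->
  is_CRInt f a b (F b - F a).
Proof.
  intros HF Hf.
  apply (@is_RInt_derive C_R_CompleteNormedModule (fun t : R => F (RtoC t)) f a b); auto.
  intros x Hx. apply Cder_is_derive_R. auto.
Qed.

Lemma Cmod_bounded (f : C -> C) (a b : R) : a <= b ->
  (forall t : R, a <= t <= b -> Ccont f t) ->
  exists M, 0 <= M /\ forall t : R, a <= t <= b -> Cmod (f t) <= M.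
Proof.
  intros Hab Hf.
  destruct (continuity_ab_maj (fun t => Cmod (f (RtoC t))) a b Hab) as [t0 [Ht0 _]].
  - intros t Ht eps Heps. destruct (Hf t Ht (eps / 2)%R) as [d [Hd HD]]. lra.
    exists d. split; auto. intros x [_ Hx]. unfold dist in *. simpl in *. unfold R_dist in *.
    specialize (HD (RtoC (x - t))). rewrite Cmod_R in HD. specialize (HD Hx).
    rewrite <- RtoC_plus in HD. replace (t + (x - t))%R with x in HD by ring.
    apply Rle_lt_trans with (eps / 2)%R; [|lra].
    eapply Rle_trans; [|apply HD]. apply Rabs_le. split.
    assert (Z := Cmod_triangle_inv (f t) (f x)). rewrite Cmod_minus_sym in Z. lra.
    apply Cmod_triangle_inv.
  - exists (Cmod (f t0)). split. apply Cmod_ge_0. apply Ht0.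
Qed.

(** * Functions with small derivative along a segment *)

Lemma Cder_line (f : C -> C) (a b l : C) (t : C) :
  Cder f (a + t * b) l -> Cder (fun s => f (a + s * b)) t (l * b).
Proof.
  intros H. eapply (Cder_comp f (fun s => a + s * b)); eauto.
  cder_val. ring.
Qed.

(** The mean value theorem is applied to the real and to the imaginary part, which costs the
    factor 2. *)
Lemma Cder_mvt (f f' : C -> C) (M : R) :
  (forall t : R, 0 <= t <= 1 -> Cder f t (f' t)) ->
  (forall t : R, 0 <= t <= 1 -> Cmod (f' t) <= M) ->
  Cmod (f 1 - f 0) <= 2 * M.
Proof.
  intros Hd HM.
  assert (Q : forall p : C -> R, (p = Re \/ p = Im) ->
     Rabs (p (f 1) - p (f 0)) <= M).
  { intros p Hp.
    assert (D : forall t : R, 0 <= t <= 1 ->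
        is_derive (fun s : R => p (f (RtoC s))) t (p (f' t))).
    { intros t Ht. specialize (Hd t Ht).
      apply is_derive_Reals. intros eps Heps.
      destruct (Hd (eps / 2)%R) as [d [Hd0 H]]. lra.
      exists (mkposreal d Hd0). intros h Hh0 Hh. simpl in Hh.
      specialize (H (RtoC h)). rewrite Cmod_R in H. specialize (H Hh).
      rewrite <- RtoC_plus in H.
      assert (K : Rabs (p (f (RtoC (t + h))) - p (f (RtoC t)) - p (f' t) * h) <= eps / 2 * Rabs h).
      { eapply Rle_trans; [|apply H].
        destruct Hp as [-> | ->].
        - rewrite <- re_scal_r, <- !Re_minus. apply re_le_Cmod.
        - rewrite <- im_scal_r, <- !Im_minus. apply Im_le_Cmod. }
      replace ((p (f (RtoC (t + h))) - p (f (RtoC t))) / h - p (f' t))%R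
        with ((p (f (RtoC (t + h))) - p (f (RtoC t)) - p (f' t) * h) / h)%R by (field; auto).
      unfold Rdiv at 1. rewrite Rabs_mult, Rabs_inv by auto.
      assert (Ph := Rabs_pos_lt h Hh0).
      apply Rle_lt_trans with (eps / 2 * Rabs h * / Rabs h)%R.
      apply Rmult_le_compat_r; auto. left. apply Rinv_0_lt_compat; auto.
      rewrite Rmult_assoc, Rinv_r; lra. }
    destruct (MVT_gen (fun s : R => p (f (RtoC s))) 0 1 (fun s => p (f' (RtoC s)))) as [c [Hc E]].
    - intros x Hx. rewrite Rmin_left, Rmax_right in Hx by lra. apply D. lra.
    - intros x Hx. rewrite Rmin_left, Rmax_right in Hx by lra.
      apply continuity_pt_filterlim.
      apply (ex_derive_continuous (V := R_NormedModule)). eexists. apply D. lra.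
    - rewrite Rmin_left, Rmax_right in Hc by lra.
      rewrite E. rewrite Rminus_0_r, Rmult_1_r.
      eapply Rle_trans; [|apply (HM c Hc)].
      destruct Hp as [-> | ->]. apply re_le_Cmod. apply Im_le_Cmod. }
  eapply Rle_trans. apply Cmod_le_ReIm. rewrite Re_minus, Im_minus.
  assert (Q1 := Q Re (or_introl eq_refl)). assert (Q2 := Q Im (or_intror eq_refl)). lra.
Qed.

Lemma Cder_mvt_seg (f f' : C -> C) (a b : C) (M : R) :
  (forall t : R, 0 <= t <= 1 -> Cder f (a + t * (b - a)) (f' (a + t * (b - a)))) ->
  (forall t : R, 0 <= t <= 1 -> Cmod (f' (a + t * (b - a))) <= M) ->
  Cmod (f b - f a) <= 2 * (M * Cmod (b - a)).
Proof.
  intros Hd HM.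
  replace (f b) with (f (a + 1 * (b - a))) by (f_equal; ring).
  replace (f a) with (f (a + 0 * (b - a))) by (f_equal; ring).
  apply (Cder_mvt (fun t => f (a + t * (b - a))) (fun t => f' (a + t * (b - a)) * (b - a))).
  - intros t Ht. apply Cder_line. auto.
  - intros t Ht. rewrite Cmod_mult. apply Rmult_le_compat_r; auto. apply Cmod_ge_0.
Qed.

Lemma Cder_zero_const (f : C -> C) (a b : C) :
  (forall t : R, 0 <= t <= 1 -> Cder f (a + t * (b - a)) 0) -> f b = f a.
Proof.
  intros H. assert (Q := Cder_mvt_seg f (fun _ => 0) a b 0 H).
  assert (Cmod (f b - f a) <= 0).
  { replace 0%R with (2 * (0 * Cmod (b - a)))%R by ring. apply Q. intros; rewrite Cmod_0; lra. }
  assert (E : f b - f a = 0). { apply Cmod_eq_0. assert (P := Cmod_ge_0 (f b - f a)). lra. }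
  replace (f b) with (f b - f a + f a) by ring. rewrite E. ring.
Qed.

(** * The exponential *)

Lemma Ceq_ReIm (a b : C) : Re a = Re b -> Im a = Im b -> a = b.
Proof. destruct a, b; simpl; congruence. Qed.

Lemma Re_Cexp (z : C) : Re (Cexp z) = (exp (Re z) * cos (Im z))%R.
Proof. unfold Cexp. rewrite re_scal_l. unfold Re, Im, Ci; simpl. ring. Qed.
Lemma Im_Cexp (z : C) : Im (Cexp z) = (exp (Re z) * sin (Im z))%R.
Proof. unfold Cexp. rewrite im_scal_l. unfold Re, Im, Ci; simpl. ring. Qed.

Lemma Cexp_plus (a b : C) : Cexp (a + b) = Cexp a * Cexp b.
Proof.
  apply Ceq_ReIm; [rewrite re_mult | rewrite im_mult];
  rewrite ?Re_Cexp, ?Im_Cexp, re_plus, im_plus, exp_plus, ?cos_plus, ?sin_plus; ring.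
Qed.

Lemma Cexp_R (x : R) : Cexp x = RtoC (exp x).
Proof.
  apply Ceq_ReIm; rewrite ?Re_Cexp, ?Im_Cexp; simpl; rewrite ?cos_0, ?sin_0; ring.
Qed.

Lemma Cexp_0 : Cexp 0 = 1.
Proof. rewrite Cexp_R, exp_0. reflexivity. Qed.

Lemma Cmod_Cexp (z : C) : Cmod (Cexp z) = exp (Re z).
Proof.
  assert (H : (Cmod (Cexp z) ^ 2 = exp (Re z) ^ 2)%R).
  { rewrite Cmod2_alt, Re_Cexp, Im_Cexp.
    assert (Q := sin2_cos2 (Im z)). unfold Rsqr in Q.
    replace ((exp (Re z) * cos (Im z)) ^ 2 + (exp (Re z) * sin (Im z)) ^ 2)%R
      with (exp (Re z) ^ 2 * (sin (Im z) * sin (Im z) + cos (Im z) * cos (Im z)))%R by ring.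
    rewrite Q. ring. }
  assert (P := exp_pos (Re z)). assert (P' := Cmod_ge_0 (Cexp z)).
  apply Rsqr_inj; try lra. unfold Rsqr. simpl in H. lra.
Qed.

Lemma Cexp_neq_0 (z : C) : Cexp z <> 0.
Proof. apply Cmod_gt_0. rewrite Cmod_Cexp. apply exp_pos. Qed.

Lemma Cexp_opp (z : C) : Cexp (- z) = / Cexp z.
Proof.
  assert (H : Cexp z * Cexp (- z) = 1).
  { rewrite <- Cexp_plus, <- Cexp_0. f_equal. ring. }
  assert (N := Cexp_neq_0 z).
  replace (Cexp (- z)) with (/ Cexp z * (Cexp z * Cexp (- z))) by (field; auto).
  rewrite H. ring.
Qed.

Lemma Cexp_minus (a b : C) : Cexp (a - b) = Cexp a / Cexp b.
Proof. unfold Cminus. rewrite Cexp_plus, Cexp_opp. reflexivity. Qed.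

Lemma Cexp_pow (z : C) (n : nat) : Cexp (INR n * z) = Cexp z ^ n.
Proof.
  induction n as [|n IH].
  - simpl. rewrite Cmult_0_l. apply Cexp_0.
  - rewrite S_INR, RtoC_plus, Cmult_plus_distr_r, Cexp_plus, IH, Cmult_1_l. simpl. ring.
Qed.

(** Real derivatives in the form of [Cder]. *)
Lemma derive_eps (f : R -> R) (x l : R) : derivable_pt_lim f x l ->
  forall eps, 0 < eps -> exists d, 0 < d /\ forall h, Rabs h < d ->
    Rabs (f (x + h)%R - f x - l * h) <= eps * Rabs h.
Proof.
  intros H eps Heps. destruct (H eps Heps) as [[d Hd] H']. simpl in H'.
  exists d. split; auto. intros h Hh.
  destruct (Req_dec h 0) as [-> | Hh0].
  { rewrite Rplus_0_r. replace (f x - f x - l * 0)%R with 0%R by ring.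
    rewrite Rabs_R0. lra. }
  specialize (H' h Hh0 Hh).
  replace (f (x + h)%R - f x - l * h)%R with (((f (x + h)%R - f x) / h - l) * h)%R by (field; auto).
  rewrite Rabs_mult. apply Rmult_le_compat_r. apply Rabs_pos. lra.
Qed.

Lemma Cder_Cexp_0 : Cder Cexp 0 1.
Proof.
  intros eps Heps.
  set (e := Rmin 1 (eps / 20)).
  assert (He : 0 < e) by (apply Rmin_glb_lt; lra).
  assert (He1 : e <= 1) by apply Rmin_l.
  assert (He2 : e <= eps / 20) by apply Rmin_r.
  destruct (derive_eps exp 0 1 derivable_pt_lim_exp_0 e He) as [d1 [Hd1 H1]].
  destruct (derive_eps cos 0 _ (derivable_pt_lim_cos 0) e He) as [d2 [Hd2 H2]].
  destruct (derive_eps sin 0 _ (derivable_pt_lim_sin 0) e He) as [d3 [Hd3 H3]].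
  rewrite sin_0 in H2. rewrite cos_0 in H2, H3. rewrite sin_0 in H3. rewrite exp_0 in H1.
  exists (Rmin (Rmin d1 d2) (Rmin d3 e)). split.
  { repeat apply Rmin_glb_lt; lra. }
  intros h Hh.
  assert (Hx := re_le_Cmod h). assert (Hy := Im_le_Cmod h).
  assert (B1 := Rmin_l (Rmin d1 d2) (Rmin d3 e)). assert (B2 := Rmin_r (Rmin d1 d2) (Rmin d3 e)).
  assert (B3 := Rmin_l d1 d2). assert (B4 := Rmin_r d1 d2).
  assert (B5 := Rmin_l d3 e). assert (B6 := Rmin_r d3 e).
  specialize (H1 (Re h) ltac:(lra)). specialize (H2 (Im h) ltac:(lra)). specialize (H3 (Im h) ltac:(lra)).
  rewrite Rplus_0_l in H1, H2, H3.
  rewrite Cplus_0_l, Cexp_0.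
  set (x := Re h) in *. set (y := Im h) in *.
  set (m := Cmod h) in *.
  assert (Hm : 0 <= m) by apply Cmod_ge_0.
  assert (A1 : Rabs (exp x - 1) <= 2 * m).
  { replace (exp x - 1)%R with ((exp x - 1 - 1 * x) + x)%R by ring.
    eapply Rle_trans. apply Rabs_triang. assert (Q := Rabs_pos x). nra. }
  assert (A2 : exp x <= 3).
  { assert (Q := Rle_abs (exp x - 1)). nra. }
  assert (Pe := exp_pos x).
  eapply Rle_trans. apply Cmod_le_ReIm.
  assert (E1 : Re (Cexp h - 1 - 1 * h) = ((exp x - 1 - 1 * x) + exp x * (cos y - 1 - - 0 * y))%R).
  { rewrite !Re_minus, Re_Cexp. fold x y. rewrite Cmult_1_l. fold x. simpl. ring. }
  assert (E2 : Im (Cexp h - 1 - 1 * h) = ((exp x - 1) * y + exp x * (sin y - 0 - 1 * y))%R).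
  { rewrite !Im_minus, Im_Cexp. fold x y. rewrite Cmult_1_l. fold y. simpl. ring. }
  rewrite E1, E2.
  assert (M1 : Rabs (exp x - 1 - 1 * x) <= e * m).
  { eapply Rle_trans. apply H1. apply Rmult_le_compat_l; lra. }
  assert (M2 : Rabs (exp x * (cos y - 1 - - 0 * y)) <= 3 * (e * m)).
  { rewrite Rabs_mult, (Rabs_pos_eq (exp x)) by lra. apply Rmult_le_compat; try lra. apply Rabs_pos.
    eapply Rle_trans. apply H2. apply Rmult_le_compat_l; lra. }
  assert (M3 : Rabs (exp x * (sin y - 0 - 1 * y)) <= 3 * (e * m)).
  { rewrite Rabs_mult, (Rabs_pos_eq (exp x)) by lra. apply Rmult_le_compat; try lra. apply Rabs_pos.
    eapply Rle_trans. apply H3. apply Rmult_le_compat_l; lra. }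
  assert (M4 : Rabs ((exp x - 1) * y) <= 2 * (e * m)).
  { rewrite Rabs_mult. apply Rle_trans with (2 * m * e)%R; [|lra].
    apply Rmult_le_compat; try lra; apply Rabs_pos. }
  assert (T1 := Rabs_triang (exp x - 1 - 1 * x) (exp x * (cos y - 1 - - 0 * y))).
  assert (T2 := Rabs_triang ((exp x - 1) * y) (exp x * (sin y - 0 - 1 * y))).
  assert (e * m <= eps / 20 * m) by (apply Rmult_le_compat_r; lra).
  assert (0 <= eps * m) by (apply Rmult_le_pos; lra).
  lra.
Qed.

Lemma Cder_Cexp (z : C) : Cder Cexp z (Cexp z).
Proof.
  intros eps Heps.
  assert (P := exp_pos (Re z)).
  destruct (Cder_Cexp_0 (eps / exp (Re z)))%R as [d [Hd H]].
  { apply Rdiv_lt_0_compat; auto. }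
  exists d. split; auto. intros h Hh. specialize (H h Hh).
  rewrite Cplus_0_l, Cexp_0 in H. rewrite Cexp_plus.
  replace (Cexp z * Cexp h - Cexp z - Cexp z * h) with (Cexp z * (Cexp h - 1 - 1 * h)) by ring.
  rewrite Cmod_mult, Cmod_Cexp.
  apply Rle_trans with (exp (Re z) * (eps / exp (Re z) * Cmod h))%R.
  apply Rmult_le_compat_l; lra. right. field. lra.
Qed.

Lemma Cder_Cexp_comp (f : C -> C) (z l : C) :
  Cder f z l -> Cder (fun w => Cexp (f w)) z (Cexp (f z) * l).
Proof. intros H. apply (Cder_comp Cexp f); auto. apply Cder_Cexp. Qed.

Ltac cder_ext ::=
  lazymatch goal with
  | |- Cder (fun w => Cexp (@?f w)) _ _ => apply (Cder_Cexp_comp f); cder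
  end.

(** * Goursat's lemma and local primitives *)

Definition segint (f : C -> C) (a b : C) : C :=
  (b - a) * CRInt (fun t => f (a + t * (b - a))) 0 1.

Definition seg_cont (f : C -> C) (a b : C) : Prop :=
  forall t : R, 0 <= t <= 1 -> Ccont f (a + t * (b - a)).

Lemma seg_cont_int (f : C -> C) (a b : C) : seg_cont f a b ->
  is_CRInt (fun t => f (a + t * (b - a))) 0 1 (CRInt (fun t => f (a + t * (b - a))) 0 1).
Proof.
  intros H. apply CRInt_correct, ex_CRInt_cont. intros x Hx.
  rewrite Rmin_left, Rmax_right in Hx by lra.
  apply (Ccont_Rcont (fun t => f (a + t * (b - a)))).
  intros eps Heps. destruct (H x Hx eps Heps) as [d [Hd H']].
  assert (Q := Cmod_ge_0 (b - a)).
  exists (d / (Cmod (b - a) + 1))%R. split. apply Rdiv_lt_0_compat; lra.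
  intros h Hh.
  replace (a + (x + h) * (b - a)) with ((a + x * (b - a)) + h * (b - a)) by ring.
  apply H'. rewrite Cmod_mult.
  assert (Hh0 := Cmod_ge_0 h).
  apply Rle_lt_trans with (Cmod h * (Cmod (b - a) + 1))%R.
  apply Rmult_le_compat_l; lra.
  apply Rmult_lt_compat_r with (r := (Cmod (b - a) + 1)%R) in Hh; [|lra].
  replace (d / (Cmod (b - a) + 1) * (Cmod (b - a) + 1))%R with d in Hh by (field; lra). lra.
Qed.

Lemma segint_swap (f : C -> C) (a b : C) : seg_cont f a b -> segint f b a = - segint f a b.
Proof.
  intros H. apply seg_cont_int in H. unfold segint.
  set (l := CRInt (fun t => f (a + t * (b - a))) 0 1) in *.
  assert (K : is_CRInt (fun t => f (b + t * (a - b))) 0 1 l).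
  { assert (H1 : is_CRInt (fun t => f (a + t * (b - a))) (-1 * 0 + 1)%R (-1 * 1 + 1)%R (- l)).
    { replace (-1 * 0 + 1)%R with 1%R by ring. replace (-1 * 1 + 1)%R with 0%R by ring.
      apply is_CRInt_swap. exact H. }
    apply (@is_RInt_comp_lin C_R_NormedModule) in H1.
    apply (is_CRInt_scal (- (1))) in H1.
    replace (- (1) * - l) with l in H1 by ring.
    eapply is_CRInt_ext; [|exact H1]. intros x _. cbv beta.
    change (@scal R_Ring C_R_NormedModule) with (@scal R_Ring C_R_ModuleSpace).
    rewrite scal_R_Cmult. rewrite RtoC_plus, RtoC_mult.
    replace (RtoC (-1)) with (- (1)) by (rewrite <- RtoC_opp; reflexivity).
    rewrite Cmult_assoc.
    replace (- (1) * - (1)) with (RtoC 1) by ring. rewrite Cmult_1_l. f_equal. ring. }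
  rewrite (CRInt_unique _ _ _ _ K). ring.
Qed.

Lemma segint_mid (f : C -> C) (a b : C) : seg_cont f a b ->
  segint f a b = segint f a ((a + b) / 2) + segint f ((a + b) / 2) b.
Proof.
  intros H. apply seg_cont_int in H. unfold segint.
  assert (Hex : ex_CRInt (fun t => f (a + t * (b - a))) 0 1) by (eexists; exact H).
  assert (E1 := ex_RInt_Chasles_1 (V := C_R_CompleteNormedModule) _ 0 (1/2) 1 ltac:(lra) Hex).
  assert (E2 := ex_RInt_Chasles_2 (V := C_R_CompleteNormedModule) _ 0 (1/2) 1 ltac:(lra) Hex).
  destruct E1 as [l1 H1]. destruct E2 as [l2 H2].
  rewrite (CRInt_unique _ _ _ _ (is_CRInt_Chasles _ _ _ _ _ _ H1 H2)).
  assert (K1 : is_CRInt (fun t => f (a + t * ((a + b) / 2 - a))) 0 1 (2 * l1)).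
  { replace 0%R with (1/2 * 0 + 0)%R in H1 at 1 by ring.
    replace (1/2)%R with (1/2 * 1 + 0)%R in H1 at 2 by ring.
    apply (@is_RInt_comp_lin C_R_NormedModule) in H1. apply (is_CRInt_scal 2) in H1.
    eapply is_CRInt_ext; [|exact H1]. intros x _. cbv beta.
    change (@scal R_Ring C_R_NormedModule) with (@scal R_Ring C_R_ModuleSpace).
    rewrite scal_R_Cmult. rewrite RtoC_plus, RtoC_mult, RtoC_div by lra.
    rewrite Cmult_assoc. replace (2 * (1 / 2)) with (RtoC 1) by field.
    rewrite Cmult_1_l. f_equal. field. }
  assert (K2 : is_CRInt (fun t => f ((a + b) / 2 + t * (b - (a + b) / 2))) 0 1 (2 * l2)).
  { replace (1/2)%R with (1/2 * 0 + 1/2)%R in H2 at 1 by ring.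
    replace 1%R with (1/2 * 1 + 1/2)%R in H2 at 3 by field.
    apply (@is_RInt_comp_lin C_R_NormedModule) in H2. apply (is_CRInt_scal 2) in H2.
    eapply is_CRInt_ext; [|exact H2]. intros x _. cbv beta.
    change (@scal R_Ring C_R_NormedModule) with (@scal R_Ring C_R_ModuleSpace).
    rewrite scal_R_Cmult. rewrite RtoC_plus, RtoC_mult, RtoC_div by lra.
    rewrite Cmult_assoc. replace (2 * (1 / 2)) with (RtoC 1) by field.
    rewrite Cmult_1_l. f_equal. field. }
  rewrite (CRInt_unique _ _ _ _ K1), (CRInt_unique _ _ _ _ K2). field.
Qed.

Lemma segint_bound (f : C -> C) (a b : C) (M : R) : seg_cont f a b ->
  (forall t : R, 0 <= t <= 1 -> Cmod (f (a + t * (b - a))) <= M) ->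
  Cmod (segint f a b) <= Cmod (b - a) * M.
Proof.
  intros H HM. apply seg_cont_int in H. unfold segint. rewrite Cmod_mult.
  apply Rmult_le_compat_l. apply Cmod_ge_0.
  assert (Q := is_CRInt_norm_const _ 0 1 M _ Rle_0_1 HM H). lra.
Qed.

Lemma C2_neq_0 : RtoC 2 <> 0.
Proof. apply RtoC_neq. lra. Qed.

(** Integrals of affine functions depend on the end points only through [b^2 - a^2], so they
    cancel around a triangle. *)
Lemma segint_affine (p q a b : C) :
  is_CRInt (fun t => p + q * (a + t * (b - a))) 0 1 (p + q * (a + b) / 2).
Proof.
  replace (p + q * (a + b) / 2) with
    (((fun t : C => p * t + q * (a * t + t * t * (b - a) / 2)) 1) -
     ((fun t : C => p * t + q * (a * t + t * t * (b - a) / 2)) 0)) by (simpl; field).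
  apply (is_CRInt_FTC (fun t : C => p * t + q * (a * t + t * t * (b - a) / 2))).
  - intros x _. cder_val; [apply C2_neq_0 | field].
  - intros x _. apply (Ccont_Rcont (fun t => p + q * (a + t * (b - a)))).
    ccont.
Qed.

Lemma segint_minus_affine (f : C -> C) (p q a b : C) : seg_cont f a b ->
  segint f a b = segint (fun w => f w - (p + q * w)) a b + (b - a) * p + q * (b * b - a * a) / 2.
Proof.
  intros H. apply seg_cont_int in H. unfold segint.
  rewrite (CRInt_unique _ _ _ _ (is_CRInt_minus _ _ _ _ _ _ H (segint_affine p q a b))).
  field.
Qed.

Definition boundary_int (f : C -> C) (a b c : C) : C := segint f a b + segint f b c + segint f c a.

Lemma ball_convex (c a b : C) (r t : R) :
  Cmod (a - c) <= r -> Cmod (b - c) <= r -> 0 <= t <= 1 -> Cmod (a + t * (b - a) - c) <= r.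
Proof.
  intros Ha Hb Ht.
  replace (a + t * (b - a) - c) with (RtoC (1 - t) * (a - c) + t * (b - c))
    by (rewrite RtoC_minus; ring).
  eapply Rle_trans. apply Cmod_triangle. rewrite !Cmod_mult, !Cmod_R, !Rabs_pos_eq by lra.
  assert (Q1 := Cmod_ge_0 (a - c)). nra.
Qed.

Lemma ball_convex_half (c a b : C) (r : R) :
  Cmod (a - c) <= r -> Cmod (b - c) <= r -> Cmod ((a + b) / 2 - c) <= r.
Proof.
  intros Ha Hb. replace ((a + b) / 2) with (a + RtoC (1/2) * (b - a)).
  apply ball_convex; auto; lra. rewrite RtoC_div by lra. field.
Qed.

Lemma Cmod_half (z : C) : Cmod (z / 2) = (Cmod z / 2)%R.
Proof.
  rewrite Cmod_div by (apply RtoC_neq; lra). rewrite Cmod_R, Rabs_pos_eq by lra. reflexivity.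
Qed.

Lemma half_pow_small (K : R) : 0 <= K -> forall eps, 0 < eps -> exists n, K / 2 ^ n < eps.
Proof.
  intros HK eps Heps.
  destruct (pow_lt_1_zero (1/2) ltac:(rewrite Rabs_pos_eq; lra) (eps / (K + 1)))%R as [n Hn].
  apply Rdiv_lt_0_compat; lra.
  exists n. specialize (Hn n (le_n _)). rewrite Rabs_pos_eq in Hn by (apply pow_le; lra).
  unfold Rdiv in Hn at 1. rewrite Rmult_1_l, pow_inv in Hn.
  assert (P2 : 0 < / 2 ^ n) by (apply Rinv_0_lt_compat, pow_lt; lra).
  apply Rle_lt_trans with ((K + 1) * / 2 ^ n)%R. unfold Rdiv. nra.
  apply Rmult_lt_compat_l with (r := (K + 1)%R) in Hn; [|lra].
  replace ((K + 1) * (eps / (K + 1)))%R with eps in Hn by (field; lra). exact Hn.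
Qed.

Section Goursat.
Variables (f : C -> C) (c : C) (r : R).
Hypothesis Hf : forall z, Cmod (z - c) <= r -> exists l, Cder f z l.

Let K (p : C) := Cmod (p - c) <= r.
Let segok_K a b : K a -> K b -> seg_cont f a b.
Proof.
  intros Ha Hb t Ht. destruct (Hf (a + t * (b - a))) as [l Hl].
  apply ball_convex; auto. eapply Cder_Ccont; eauto.
Qed.

Definition triangle := (C * C * C)%type.
Definition tri_perimeter (T : triangle) : R :=
  let '(a, b, c) := T in (Cmod (a - b) + Cmod (b - c) + Cmod (c - a))%R.
Definition tri_integral (T : triangle) : C := let '(a, b, c) := T in boundary_int f a b c.
Definition tri_inside (T : triangle) : Prop := let '(a, b, c) := T in K a /\ K b /\ K c.
Definition tri_vertex (T : triangle) : C := let '(a, b, c) := T in a.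

(** One of the four triangles cut out by the midpoints carries at least a quarter of the
    integral. The statement has the form that choice turns into a function on all triangles. *)
Lemma tri_bisect (T : triangle) : exists T' : triangle, tri_inside T ->
  tri_inside T' /\ tri_perimeter T' = (tri_perimeter T / 2)%R /\ Cmod (tri_integral T) <= 4 * Cmod (tri_integral T') /\
  Cmod (tri_vertex T' - tri_vertex T) <= tri_perimeter T.
Proof.
  destruct T as [[a b] d].
  destruct (classic (K a /\ K b /\ K d)) as [[Ka [Kb Kd]] | N].
  2: { exists (a, b, d). intros H. destruct (N H). }
  set (mab := (a + b) / 2). set (mbd := (b + d) / 2). set (mda := (d + a) / 2).
  assert (K1 : K mab) by (apply ball_convex_half; auto).
  assert (K2 : K mbd) by (apply ball_convex_half; auto).
  assert (K3 : K mda) by (apply ball_convex_half; auto).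
  assert (E : boundary_int f a b d = boundary_int f a mab mda + boundary_int f mab b mbd + boundary_int f mda mbd d
     + boundary_int f mab mbd mda).
  { unfold boundary_int.
    rewrite (segint_mid f a b), (segint_mid f b d), (segint_mid f d a) by auto.
    fold mab mbd mda.
    rewrite (segint_swap f mab mda), (segint_swap f mbd mab), (segint_swap f mda mbd) by auto.
    ring. }
  assert (Q1 := Cmod_ge_0 (a - b)). assert (Q2 := Cmod_ge_0 (b - d)). assert (Q3 := Cmod_ge_0 (d - a)).
  assert (H4 : exists T', (T' = (a, mab, mda) \/ T' = (mab, b, mbd) \/ T' = (mda, mbd, d) \/
     T' = (mab, mbd, mda)) /\ Cmod (boundary_int f a b d) <= 4 * Cmod (tri_integral T')).
  { destruct (Rle_dec (Cmod (boundary_int f a b d)) (4 * Cmod (boundary_int f a mab mda))) as [L1|N1].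
    { exists (a, mab, mda). auto. }
    destruct (Rle_dec (Cmod (boundary_int f a b d)) (4 * Cmod (boundary_int f mab b mbd))) as [L2|N2].
    { exists (mab, b, mbd). auto. }
    destruct (Rle_dec (Cmod (boundary_int f a b d)) (4 * Cmod (boundary_int f mda mbd d))) as [L3|N3].
    { exists (mda, mbd, d). auto. }
    destruct (Rle_dec (Cmod (boundary_int f a b d)) (4 * Cmod (boundary_int f mab mbd mda))) as [L4|N4].
    { exists (mab, mbd, mda). auto. }
    exfalso.
    assert (T1 := Cmod_triangle (boundary_int f a mab mda + boundary_int f mab b mbd + boundary_int f mda mbd d) (boundary_int f mab mbd mda)).
    assert (T2 := Cmod_triangle (boundary_int f a mab mda + boundary_int f mab b mbd) (boundary_int f mda mbd d)).
    assert (T3 := Cmod_triangle (boundary_int f a mab mda) (boundary_int f mab b mbd)).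
    rewrite <- E in T1. lra. }
  destruct H4 as [T' [HT' HI]]. exists T'. intros _. cbn [tri_integral tri_vertex tri_perimeter].
  assert (S2 : forall x y w : C, (y - x) / 2 = w -> Cmod w = (Cmod (x - y) / 2)%R).
  { intros x y w <-. rewrite Cmod_half, Cmod_minus_sym. reflexivity. }
  assert (S3 : forall x y w : C, (x - y) / 2 = w -> Cmod w = (Cmod (x - y) / 2)%R).
  { intros x y w <-. rewrite Cmod_half. reflexivity. }
  unfold tri_inside. split; [|split; [|split; [exact HI|]]].
  - destruct HT' as [-> | [-> | [-> | ->]]]; auto.
  - destruct HT' as [-> | [-> | [-> | ->]]]; cbn [tri_perimeter].
    + rewrite (S3 a b (a - mab)), (S3 b d (mab - mda)), (S3 d a (mda - a)) by (unfold mab, mbd, mda; field).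
      field.
    + rewrite (S3 a b (mab - b)), (S3 b d (b - mbd)), (S3 d a (mbd - mab)) by (unfold mab, mbd, mda; field).
      field.
    + rewrite (S3 a b (mda - mbd)), (S3 b d (mbd - d)), (S3 d a (d - mda)) by (unfold mab, mbd, mda; field).
      field.
    + rewrite (S2 d a (mab - mbd)), (S2 a b (mbd - mda)), (S2 b d (mda - mab)) by (unfold mab, mbd, mda; field).
      field.
  - destruct HT' as [-> | [-> | [-> | ->]]]; cbn [tri_vertex].
    + rewrite Cmod_diag. lra.
    + rewrite (S2 a b (mab - a)) by (unfold mab; field). lra.
    + rewrite (S3 d a (mda - a)) by (unfold mda; field). lra.
    + rewrite (S2 a b (mab - a)) by (unfold mab; field). lra.
Qed.

Lemma Cauchy_geom (u : nat -> C) (M : R) :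
  (forall n, Cmod (u (S n) - u n) <= M / 2 ^ n) ->
  exists l, forall n, Cmod (u n - l) <= 2 * M / 2 ^ n.
Proof.
  intros H.
  assert (P2 : forall n, 0 < 2 ^ n) by (intros; apply pow_lt; lra).
  assert (HM : 0 <= M).
  { specialize (H 0%nat). simpl in H. assert (Q := Cmod_ge_0 (u 1%nat - u 0%nat)). lra. }
  assert (H1 : forall n k, Cmod (u (n + k)%nat - u n) <= 2 * M / 2 ^ n - 2 * M / 2 ^ (n + k)).
  { intros n k. induction k as [|k IH].
    - rewrite Nat.add_0_r, Cmod_diag. lra.
    - replace (u (n + S k)%nat - u n) with ((u (S (n + k)) - u (n + k)%nat) + (u (n + k)%nat - u n)).
      2: { rewrite Nat.add_succ_r. ring. }
      eapply Rle_trans. apply Cmod_triangle. specialize (H (n + k)%nat).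
      replace (2 ^ (n + S k))%R with (2 * 2 ^ (n + k))%R by (rewrite Nat.add_succ_r; reflexivity).
      assert (2 * M / (2 * 2 ^ (n + k)) = M / 2 ^ (n + k))%R.
      { field. apply Rgt_not_eq, P2. }
      assert (2 * M / 2 ^ (n + k) = 2 * (M / 2 ^ (n + k)))%R by (field; apply Rgt_not_eq, P2).
      lra. }
  assert (Hlim := half_pow_small (2 * M) ltac:(lra)).
  assert (HC : forall p : C -> R, (p = Re \/ p = Im) -> exists l, is_lim_seq (fun n => p (u n)) (Finite l)).
  { intros p Hp.
    assert (HCs : ex_lim_seq_cauchy (fun n => p (u n))).
    { intros eps. destruct (Hlim (eps / 2)%R) as [n0 Hn0]. destruct eps; simpl; lra.
      exists n0. intros n m Hn Hm.
      assert (G : forall k, (n0 <= k)%nat -> Rabs (p (u k) - p (u n0)) <= 2 * M / 2 ^ n0).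
      { intros k Hk. apply Rle_trans with (Cmod (u k - u n0)).
        destruct Hp as [-> | ->]. rewrite <- Re_minus; apply re_le_Cmod.
        rewrite <- Im_minus; apply Im_le_Cmod.
        specialize (H1 n0 (k - n0)%nat). replace (n0 + (k - n0))%nat with k in H1 by lia.
        assert (0 <= 2 * M / 2 ^ k). { apply Rmult_le_pos. lra. left; apply Rinv_0_lt_compat, P2. }
        lra. }
      assert (G1 := G n Hn). assert (G2 := G m Hm).
      replace (p (u n) - p (u m))%R with ((p (u n) - p (u n0)) - (p (u m) - p (u n0)))%R by ring.
      eapply Rle_lt_trans. apply Rabs_triang. rewrite Rabs_Ropp. lra. }
    apply ex_lim_seq_cauchy_corr in HCs. destruct HCs as [l Hl]. exists l. exact Hl. }
  destruct (HC Re (or_introl eq_refl)) as [x Hx]. destruct (HC Im (or_intror eq_refl)) as [y Hy].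
  exists (x, y). intros n.
  assert (HL : Clim u (x, y)) by (apply Clim_ReIm; auto).
  rewrite Cmod_minus_sym.
  apply (Clim_bound (fun k => u (n + k)%nat - u n)).
  - apply Clim_minus; [|apply Clim_const].
    apply (Clim_ext (fun k => u (k + n)%nat)). exists 0%nat. intros; f_equal; lia.
    apply Clim_incr; auto.
  - exists 0%nat. intros k _. eapply Rle_trans. apply H1.
    assert (0 <= 2 * M / 2 ^ (n + k)). { apply Rmult_le_pos. lra. left; apply Rinv_0_lt_compat, P2. }
    lra.
Qed.

(** Bisection: the nested triangles shrink to a point [p], with integrals at least [4^(-n)]
    times the original one. There [f] is an affine function up to [e1 |v - p|], affine functions
    integrate to 0, and the error is at most [3 e1] times the square of the perimeter, which is
    of order [4^(-n)]. *)
Lemma Goursat (a b d : C) : K a -> K b -> K d -> boundary_int f a b d = 0.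
Proof.
  intros Ka Kb Kd.
  destruct (choose_fun _ tri_bisect) as [next Hnext].
  set (T := fix T n := match n with O => (a, b, d) | S n => next (T n) end : triangle).
  set (P0 := tri_perimeter (a, b, d)).
  assert (P2 : forall n, 0 < 2 ^ n) by (intros; apply pow_lt; lra).
  assert (HT : forall n, tri_inside (T n) /\ tri_perimeter (T n) = (P0 / 2 ^ n)%R /\
      Cmod (boundary_int f a b d) <= 4 ^ n * Cmod (tri_integral (T n)) /\
      Cmod (tri_vertex (T (S n)) - tri_vertex (T n)) <= P0 / 2 ^ n).
  { assert (A : forall n, tri_inside (T n) /\ tri_perimeter (T n) = (P0 / 2 ^ n)%R /\
      Cmod (boundary_int f a b d) <= 4 ^ n * Cmod (tri_integral (T n))).
    { induction n as [|n [IK [IP II]]].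
      - cbn [T]. split; [unfold tri_inside; auto|split]. unfold P0. simpl. field.
        simpl. lra.
      - destruct (Hnext (T n) IK) as [K' [P' [I' _]]]. change (T (S n)) with (next (T n)).
        split; [exact K'|split]. rewrite P', IP. simpl. field. apply Rgt_not_eq, P2.
        simpl pow. assert (0 < 4 ^ n) by (apply pow_lt; lra). nra. }
    intros n. destruct (A n) as [IK [IP II]]. repeat split; auto.
    destruct (Hnext (T n) IK) as [_ [_ [_ D]]]. rewrite <- IP. exact D. }
  destruct (Cauchy_geom (fun n => tri_vertex (T n)) P0) as [p Hp].
  { intros n. apply HT. }
  assert (HP0 : 0 <= P0).
  { unfold P0, tri_perimeter. assert (Q1 := Cmod_ge_0 (a - b)). assert (Q2 := Cmod_ge_0 (b - d)).
    assert (Q3 := Cmod_ge_0 (d - a)). lra. }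
  assert (Hsmall := half_pow_small (3 * P0) ltac:(lra)).
  assert (Kp : K p).
  { unfold K. apply le_epsilon. intros eps Heps. destruct (Hsmall eps Heps) as [n Hn].
    specialize (Hp n). destruct (HT n) as [HK _].
    assert (HA : K (tri_vertex (T n))). { destruct (T n) as [[x y] w]. apply HK. }
    unfold K in HA.
    replace (p - c) with ((tri_vertex (T n) - c) - (tri_vertex (T n) - p)) by ring.
    eapply Rle_trans. apply Cmod_minus_le.
    assert (0 <= P0 / 2 ^ n). { apply Rmult_le_pos; auto. left; apply Rinv_0_lt_compat, P2. }
    unfold Rdiv in *. lra. }
  destruct (Hf p Kp) as [l Hl].
  apply Cmod_eq_0. apply Rle_antisym; [|apply Cmod_ge_0].
  apply le_epsilon. intros eps Heps. rewrite Rplus_0_l.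
  assert (He1 : 0 < eps / (3 * P0 * P0 + 1)). { apply Rdiv_lt_0_compat; nra. }
  set (e1 := (eps / (3 * P0 * P0 + 1))%R) in *.
  destruct (Hl e1 He1) as [del [Hdel HD]].
  destruct (Hsmall del Hdel) as [n Hn].
  destruct (HT n) as [HK [HPn [HI _]]]. specialize (Hp n).
  destruct (T n) as [[x y] w] eqn:ET. destruct HK as [Kx [Ky Kw]].
  cbn [tri_vertex tri_integral] in *. cbn [tri_perimeter] in HPn.
  set (Pn := (P0 / 2 ^ n)%R) in *.
  assert (Pn0 : 0 <= Pn). { apply Rmult_le_pos; auto. left; apply Rinv_0_lt_compat, P2. }
  assert (Q1 := Cmod_ge_0 (x - y)). assert (Q2 := Cmod_ge_0 (y - w)). assert (Q3 := Cmod_ge_0 (w - x)).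
  (* The vertices of the n-th triangle are within [3 Pn] of [p], where [Pn] is its perimeter. *)
  assert (B1 : Cmod (x - p) <= 2 * Pn). { unfold Pn, Rdiv in *; lra. }
  assert (B2 : Cmod (y - p) <= 3 * Pn).
  { replace (y - p) with ((x - p) - (x - y)) by ring. eapply Rle_trans. apply Cmod_minus_le. lra. }
  assert (B3 : Cmod (w - p) <= 3 * Pn).
  { replace (w - p) with ((x - p) + (w - x)) by ring. eapply Rle_trans. apply Cmod_triangle. lra. }
  set (g := fun v => f v - ((f p - l * p) + l * v)).
  assert (Hg : forall v, Cmod (v - p) <= 3 * Pn -> Cmod (g v) <= e1 * (3 * Pn)).
  { intros v Hv. specialize (HD (v - p)).
    replace (p + (v - p)) with v in HD by ring.
    replace (g v) with (f v - f p - l * (v - p)) by (unfold g; ring).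
    eapply Rle_trans. apply HD. unfold Pn, Rdiv in *; lra.
    apply Rmult_le_compat_l; lra. }
  assert (Hgok : forall u v, K u -> K v -> seg_cont g u v).
  { intros u v Ku Kv t Ht. destruct (Hf (u + t * (v - u))) as [m Hm].
    apply ball_convex; auto.
    unfold g. ccont. }
  assert (Hgb : forall u v, K u -> K v -> Cmod (u - p) <= 3 * Pn -> Cmod (v - p) <= 3 * Pn ->
     Cmod (segint g u v) <= Cmod (v - u) * (e1 * (3 * Pn))).
  { intros u v Ku Kv Hu Hv. apply segint_bound. auto. intros t Ht. apply Hg.
    apply ball_convex; auto. }
  assert (ETr : boundary_int f x y w = segint g x y + segint g y w + segint g w x).
  { unfold boundary_int.
    rewrite (segint_minus_affine f (f p - l * p) l x y), (segint_minus_affine f (f p - l * p) l y w),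
      (segint_minus_affine f (f p - l * p) l w x) by auto. unfold g. field. }
  assert (G1 := Hgb x y Kx Ky ltac:(lra) B2). assert (G2 := Hgb y w Ky Kw B2 B3).
  assert (G3 := Hgb w x Kw Kx B3 ltac:(lra)).
  assert (GT : Cmod (boundary_int f x y w) <= e1 * 3 * (Pn * Pn)).
  { rewrite ETr. eapply Rle_trans. apply Cmod_triangle.
    assert (T2 := Cmod_triangle (segint g x y) (segint g y w)).
    rewrite (Cmod_minus_sym y x) in G1. rewrite (Cmod_minus_sym w y) in G2. rewrite (Cmod_minus_sym x w) in G3.
    replace (e1 * 3 * (Pn * Pn))%R with ((Cmod (x - y) + Cmod (y - w) + Cmod (w - x)) * (e1 * (3 * Pn)))%R.
    lra. rewrite HPn. ring. }
  eapply Rle_trans. apply HI.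
  apply Rle_trans with (4 ^ n * (e1 * 3 * (Pn * Pn)))%R.
  { apply Rmult_le_compat_l; auto. left; apply pow_lt; lra. }
  replace (4 ^ n * (e1 * 3 * (Pn * Pn)))%R with (e1 * (3 * P0 * P0))%R.
  2: { unfold Pn. replace (4 ^ n)%R with (2 ^ n * 2 ^ n)%R by (rewrite <- Rpow_mult_distr; f_equal; lra).
       field. apply Rgt_not_eq, P2. }
  apply Rle_trans with (e1 * (3 * P0 * P0 + 1))%R. nra. right. unfold e1. field. nra.
Qed.
End Goursat.

(** The primitive is the integral along the radius from the centre; by Goursat's lemma its
    increments are integrals along short segments. *)
Lemma disc_primitive (f : C -> C) (c : C) (r : R) :
  (forall z, Cmod (z - c) < r -> exists l, Cder f z l) ->
  exists F, forall z, Cmod (z - c) < r -> Cder F z (f z).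
Proof.
  intros Hf. exists (fun z => segint f c z). intros z Hz eps Heps.
  set (rho := ((Cmod (z - c) + r) / 2)%R).
  assert (Hrho : rho < r) by (unfold rho; lra).
  assert (Hf' : forall w, Cmod (w - c) <= rho -> exists l, Cder f w l).
  { intros w Hw. apply Hf. lra. }
  assert (Hc : Cmod (c - c) <= rho).
  { rewrite Cmod_diag. unfold rho. assert (Q := Cmod_ge_0 (z - c)). lra. }
  assert (Hz' : Cmod (z - c) <= rho) by (unfold rho; lra).
  destruct (Hf z Hz) as [l Hl].
  destruct (Cder_Ccont _ _ _ Hl eps Heps) as [d [Hd HD]].
  exists (Rmin d ((r - Cmod (z - c)) / 2)). split. apply Rmin_glb_lt; lra.
  intros h Hh.
  min_split Hh Hh1 Hh2.
  assert (Hzh : Cmod (z + h - c) <= rho).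
  { replace (z + h - c) with ((z - c) + h) by ring. eapply Rle_trans. apply Cmod_triangle.
    unfold rho. lra. }
  assert (ok : forall a b, Cmod (a - c) <= rho -> Cmod (b - c) <= rho -> seg_cont f a b).
  { intros a b Ha Hb t Ht. destruct (Hf' (a + t * (b - a))) as [m Hm].
    apply ball_convex; auto. eapply Cder_Ccont; eauto. }
  assert (G := Goursat f c rho Hf' c z (z + h) Hc Hz' Hzh).
  unfold boundary_int in G.
  rewrite (segint_swap f c (z + h)) in G by auto.
  assert (E : segint f c (z + h) - segint f c z = segint f z (z + h)).
  { replace (segint f z (z + h)) with
      (segint f c z + segint f z (z + h) + - segint f c (z + h) + segint f c (z + h) - segint f c z) by ring.
    rewrite G. ring. }
  rewrite E.
  rewrite (segint_minus_affine f (f z) 0 z (z + h)) by auto.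
  replace (segint (fun w => f w - (f z + 0 * w)) z (z + h) + (z + h - z) * f z
     + 0 * ((z + h) * (z + h) - z * z) / 2 - f z * h)
   with (segint (fun w => f w - (f z + 0 * w)) z (z + h)) by field.
  eapply Rle_trans. apply segint_bound with (M := eps).
  - intros t Ht. destruct (Hf' (z + t * (z + h - z))) as [m Hm]. apply ball_convex; auto.
    ccont.
  - intros t Ht. replace (f (z + t * (z + h - z)) - (f z + 0 * (z + t * (z + h - z))))
      with (f (z + t * h) - f z) by (replace (z + h - z) with h by ring; ring).
    apply HD. rewrite Cmod_mult, Cmod_R, Rabs_pos_eq by lra.
    assert (Q := Cmod_ge_0 h). nra.
  - replace (z + h - z) with h by ring. lra.
Qed.

(** * The identity theorem *)

Definition circle (c : C) (r : R) (t : C) : C := c + r * Cexp (Ci * t).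

Lemma circle_mod (c : C) (r t : R) : 0 <= r -> Cmod (circle c r t - c) = r.
Proof.
  intros Hr. unfold circle. replace (c + r * Cexp (Ci * t) - c) with (r * Cexp (Ci * t)) by ring.
  rewrite Cmod_mult, Cmod_R, Cmod_Cexp, Rabs_pos_eq by auto.
  replace (Re (Ci * t)) with 0%R by (simpl; ring). rewrite exp_0. ring.
Qed.

Lemma Cder_circle (c : C) (r : R) (t : C) : Cder (circle c r) t (Ci * (circle c r t - c)).
Proof.
  unfold circle. cder_val. ring.
Qed.

Lemma circle_period (c : C) (r : R) : circle c r (2 * PI)%R = circle c r 0%R.
Proof.
  unfold circle. f_equal. f_equal. apply Ceq_ReIm; rewrite ?Re_Cexp, ?Im_Cexp;
  replace (Re (Ci * (2 * PI)%R)) with 0%R by (simpl; ring);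
  replace (Im (Ci * (2 * PI)%R)) with (2 * PI)%R by (simpl; ring);
  replace (Re (Ci * 0)) with 0%R by (simpl; ring);
  replace (Im (Ci * 0)) with 0%R by (simpl; ring);
  rewrite ?cos_2PI, ?sin_2PI, ?cos_0, ?sin_0; reflexivity.
Qed.

(** With [W] the remainder of the second order Taylor expansion of [u] at [a], the quotient at
    [a + h] is [u'(a) + (l/2) h + W(a+h)/h], and [W' = o(h)] by differentiability of [u'] at
    [a]. *)
Lemma Cder_quotient (u u' : C -> C) (a : C) (r : R) : 0 < r ->
  (forall z, Cmod (z - a) < r -> Cder u z (u' z)) ->
  (exists l, Cder u' a l) ->
  exists l, Cder (fun z => if Ceq_dec z a then u' a else (u z - u a) / (z - a)) a l.
Proof.
  intros Hr Hu [l Hl]. exists (l / 2). intros eps Heps.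
  destruct (Hl (eps / 2)%R) as [d [Hd HD]]. lra.
  exists (Rmin d r). split. apply Rmin_glb_lt; auto. intros h Hh.
  min_split Hh Hh1 Hh2.
  assert (Hh0 := Cmod_ge_0 h).
  destruct (Ceq_dec a a) as [_|N]; [|congruence].
  destruct (Ceq_dec (a + h) a) as [E|N].
  - assert (h = 0). { replace h with (a + h - a) by ring. rewrite E. ring. }
    subst h. replace (u' a - u' a - l / 2 * 0) with (RtoC 0) by field.
    rewrite Cmod_0. lra.
  - assert (Hn : h <> 0). { intros ->. apply N. ring. }
    assert (Pn := proj1 (Cmod_gt_0 h) Hn).
    set (W := fun w => u w - u a - u' a * (w - a) - l / 2 * ((w - a) * (w - a))).
    assert (HW : Cmod (W (a + h) - W a) <= 2 * (eps / 2 * Cmod h * Cmod (a + h - a))).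
    { apply (Cder_mvt_seg W (fun w => u' w - u' a - l * (w - a))).
      - intros t Ht.
        assert (Hin : Cmod (a + t * (a + h - a) - a) < r).
        { replace (a + t * (a + h - a) - a) with (t * h) by ring.
          rewrite Cmod_mult, Cmod_R, Rabs_pos_eq by lra. nra. }
        set (w := a + t * (a + h - a)) in *.
        assert (Huw := Hu w Hin). unfold W. cder_val. field.
      - intros t Ht. assert (HDt := HD (t * h)).
        replace (a + t * (a + h - a)) with (a + t * h) by ring.
        replace (a + t * h - a) with (t * h) by ring.
        rewrite Cmod_mult, Cmod_R, Rabs_pos_eq in HDt by lra.
        eapply Rle_trans. apply HDt. nra. assert (t * Cmod h <= Cmod h) by nra. nra. }
    replace (a + h - a) with h in HW |- * by ring.
    replace ((u (a + h) - u a) / h - u' a - l / 2 * h) with ((W (a + h) - W a) / h).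
    2: { unfold W. field. auto. }
    rewrite Cmod_div by auto. set (m := Cmod (W (a + h) - W a)) in *.
    apply Rmult_le_reg_r with (Cmod h); auto.
    replace (m / Cmod h * Cmod h)%R with m by (field; lra).
    lra.
Qed.

(** The difference quotient [q] of [u] at [a] is differentiable, so it has a primitive and integrates to 0
    around the circle.  Parametrised by the angle this says
       [int u(g) kap = u(a) int kap]   with   [kap = (g - c)/(g - a)].
    Since [Re kap >= 1/2], the last integral is at least [pi] in modulus; using this instead of its value [2 pi]
    costs the factor 2. *)
Lemma Cauchy_estimate (u u' : C -> C) (c a : C) (R0 r M : R) :
  (forall z, Cmod (z - c) < R0 -> Cder u z (u' z)) ->
  (forall z, Cmod (z - c) < R0 -> exists l, Cder u' z l) ->
  Cmod (a - c) < r -> r < R0 ->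
  (forall t : R, 0 <= t <= 2 * PI -> Cmod (u (circle c r t)) <= M) ->
  Cmod (u a) <= 2 * (M * (r / (r - Cmod (a - c)))).
Proof.
  intros Hu Hu' Ha Hr HM.
  assert (P := Cmod_ge_0 (a - c)).
  assert (Hr0 : 0 <= r) by lra.
  set (q := fun z => if Ceq_dec z a then u' a else (u z - u a) / (z - a)).
  assert (Hq : forall z, Cmod (z - c) < R0 -> exists l, Cder q z l).
  { intros z Hz. destruct (Ceq_dec z a) as [-> | N].
    - apply Cder_quotient with (r := (R0 - Cmod (a - c))%R). lra.
      + intros w Hw. apply Hu. replace (w - c) with ((w - a) + (a - c)) by ring.
        eapply Rle_lt_trans. apply Cmod_triangle. lra.
      + apply Hu'; auto.
    - assert (Na : z - a <> 0) by (apply Cminus_eq_contra; auto).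
      eexists. apply (Cder_ext_loc (fun z => (u z - u a) / (z - a))).
      + exists (Cmod (z - a)). split. apply Cmod_gt_0; auto. intros h Hh. unfold q.
        destruct (Ceq_dec (z + h) a) as [E|_]; auto.
        exfalso. rewrite <- E, Cmod_minus_sym in Hh.
        replace (z + h - z) with h in Hh by ring. lra.
      + assert (Huz := Hu z Hz). cder. auto. }
  destruct (disc_primitive q c R0 Hq) as [Q HQ].
  assert (Pi := PI_RGT_0).
  set (g := circle c r). set (kap := fun t : C => (g t - c) / (g t - a)).
  assert (Hg : forall t : R, Cmod (g t - c) = r) by (intros; apply circle_mod; auto).
  assert (Hga : forall t : R, r - Cmod (a - c) <= Cmod (g t - a)).
  { intros t. replace (g t - a) with ((g t - c) - (a - c)) by ring.
    assert (Z := Cmod_triangle_inv (g t - c) (a - c)). rewrite Hg in Z. lra. }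
  assert (Hgn : forall t : R, g t - a <> 0).
  { intros t. apply Cmod_gt_0. specialize (Hga t). lra. }
  assert (Dg : forall t, Cder g t (Ci * (g t - c))) by (intros; apply Cder_circle).
  assert (Cg : forall t, Ccont g t) by (intros; eapply Cder_Ccont; apply Dg).
  assert (Dk : forall t : R, exists l, Cder kap t l).
  { intros t. assert (Dgt := Dg t). eexists. unfold kap. cder. auto. }
  assert (Du : forall t : R, exists l, Cder (fun t => u (g t)) t l).
  { intros t. eexists. apply (Cder_comp u g). apply Dg. apply Hu. rewrite Hg. auto. }
  assert (I0 : is_CRInt (fun t => Ci * ((u (g t) - u a) * kap t)) 0 (2 * PI) 0).
  { replace (RtoC 0) with (Q (g (2 * PI)%R) - Q (g 0%R)).
    2: { unfold g. rewrite circle_period. ring. }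
    apply (is_CRInt_FTC (fun t => Q (g t))).
    - intros x _. eapply Cder_eq. apply (Cder_comp Q g). apply Dg. apply HQ. rewrite Hg; auto.
      unfold q. destruct (Ceq_dec (g x) a) as [E|_].
      + exfalso. apply (Hgn x). rewrite E. ring.
      + unfold kap. field. auto.
    - intros x _. destruct (Dk x) as [l1 L1]. destruct (Du x) as [l2 L2].
      apply (Ccont_Rcont (fun t => Ci * ((u (g t) - u a) * kap t))).
      ccont. }
  assert (I1 : is_CRInt (fun t => (u (g t) - u a) * kap t) 0 (2 * PI) 0).
  { apply (is_CRInt_scal (- Ci)) in I0. rewrite Cmult_0_r in I0.
    eapply is_CRInt_ext; [|exact I0]. intros x _. cbv beta.
    rewrite Cmult_assoc. replace (- Ci * Ci) with (RtoC 1). ring.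
    unfold Ci, Copp, Cmult, RtoC; simpl. f_equal; ring. }
  destruct (ex_CRInt_cont (fun t => kap t) 0 (2 * PI)) as [S HS].
  { intros x _. destruct (Dk x) as [l L]. apply Ccont_Rcont. eapply Cder_Ccont; eauto. }
  destruct (ex_CRInt_cont (fun t => u (g t) * kap t) 0 (2 * PI)) as [V HV].
  { intros x _. destruct (Dk x) as [l L]. destruct (Du x) as [l2 L2].
    apply (Ccont_Rcont (fun t => u (g t) * kap t)). ccont. }
  assert (EV : V = u a * S).
  { assert (Z := is_CRInt_minus _ _ _ _ _ _ HV (is_CRInt_scal (u a) _ _ _ _ HS)).
    assert (Z2 : V - u a * S = 0).
    { eapply is_CRInt_uniq; [|exact I1]. eapply is_CRInt_ext; [|exact Z]. intros; cbv beta. ring. }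
    replace V with ((V - u a * S) + u a * S) by ring. rewrite Z2. ring. }
  assert (BV : Cmod V <= (2 * PI - 0) * (M * (r / (r - Cmod (a - c))))).
  { refine (is_CRInt_norm_const _ 0 (2 * PI) _ V _ _ HV); [lra|]. intros t Ht. rewrite Cmod_mult.
    apply Rmult_le_compat; try apply Cmod_ge_0. apply HM, Ht.
    unfold kap. rewrite Cmod_div, Hg by auto. unfold Rdiv. apply Rmult_le_compat_l; auto.
    apply Rinv_le_contravar. lra. apply Hga. }
  (* With [w = g - c] and [b = a - c], [Re (w/(w-b)) >= 1/2] says [|b| <= |w|]. *)
  assert (BS : PI <= Cmod S).
  { apply Rle_trans with (Re S). 2: { eapply Rle_trans. apply Rle_abs. apply re_le_Cmod. }
    apply is_CRInt_pair in HS. destruct HS as [HS _].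
    replace PI with ((2 * PI - 0) * / 2)%R by field.
    apply (is_RInt_le (fun _ => /2)%R (fun t => Re (kap t)) 0 (2 * PI)). lra.
    apply (@is_RInt_const R_NormedModule). exact HS.
    intros t _. unfold kap. specialize (Hg t). specialize (Hgn t). specialize (Hga t).
    replace (g t - a) with ((g t - c) - (a - c)) in * by ring.
    set (w := g t - c) in *. set (b := a - c) in *.
    assert (E1 := Cmod2_alt w). assert (E2 := Cmod2_alt b). rewrite Hg in E1.
    destruct w as [x y]. destruct b as [p s]. simpl in E1, E2.
    assert (N2 : 0 < (x - p) ^ 2 + (y - s) ^ 2).
    { assert (F := Cmod2_alt ((x, y) - (p, s))). simpl in F.
      assert (0 < Cmod ((x, y) - (p, s))) by (apply Cmod_gt_0; auto).
      replace ((x - p) ^ 2 + (y - s) ^ 2)%R with (Cmod ((x, y) - (p, s)) * (Cmod ((x, y) - (p, s)) * 1))%R.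
      nra. }
    replace (Re ((x, y) / ((x, y) - (p, s)))) with
      ((x * (x - p) + y * (y - s)) / ((x - p) ^ 2 + (y - s) ^ 2))%R.
    2: { simpl. field. replace ((x + - p) * ((x + - p) * 1) + (y + - s) * ((y + - s) * 1))%R
         with ((x - p) ^ 2 + (y - s) ^ 2)%R by ring. lra. }
    apply Rmult_le_reg_r with ((x - p) ^ 2 + (y - s) ^ 2)%R; auto.
    replace ((x * (x - p) + y * (y - s)) / ((x - p) ^ 2 + (y - s) ^ 2) * ((x - p) ^ 2 + (y - s) ^ 2))%R
      with (x * (x - p) + y * (y - s))%R by (field; lra).
    assert (Cmod (p, s) * (Cmod (p, s) * 1) <= r * (r * 1)) by nra.
    lra. }
  rewrite EV, Cmod_mult in BV.
  assert (Q0 := Cmod_ge_0 (u a)).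
  apply Rmult_le_reg_r with PI; auto.
  apply Rle_trans with (Cmod (u a) * Cmod S)%R. apply Rmult_le_compat_l; auto.
  lra.
Qed.

(** Twice differentiable functions vanishing near the centre. The class is stable under division
    by [z - c]; at [c] itself the quotient is 0 because division by 0 gives 0. *)
Definition flat_at (c : C) (R0 : R) (u : C -> C) : Prop :=
  (exists d, 0 < d /\ forall z, Cmod (z - c) < d -> u z = 0) /\
  exists u', forall z, Cmod (z - c) < R0 -> Cder u z (u' z) /\ exists l, Cder u' z l.

Lemma flat_at_div (c : C) (R0 : R) (u : C -> C) : 0 < R0 ->
  flat_at c R0 u -> flat_at c R0 (fun z => u z / (z - c)).
Proof.
  intros HR [[d0 [Hd0 H00]] [u' Hu]].
  set (d := Rmin d0 R0).
  assert (Hd : 0 < d) by (apply Rmin_glb_lt; auto).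
  assert (HdR : d <= R0) by apply Rmin_r.
  assert (H0 : forall z, Cmod (z - c) < d -> u z = 0).
  { intros z Hz. apply H00. eapply Rlt_le_trans. apply Hz. apply Rmin_l. }
  assert (Near : forall z, Cmod (z - c) < d -> exists e, 0 < e /\ forall h, Cmod h < e ->
      Cmod (z + h - c) < d).
  { intros z Hz. exists (d - Cmod (z - c))%R. split. lra. intros h Hh.
    replace (z + h - c) with ((z - c) + h) by ring.
    eapply Rle_lt_trans. apply Cmod_triangle. lra. }
  assert (H0' : forall z, Cmod (z - c) < d -> u' z = 0).
  { intros z Hz. eapply Cder_unique. apply Hu. lra.
    destruct (Near z Hz) as [e [He Hn]].
    apply (Cder_ext_loc (fun _ => 0)); [|apply Cder_const].
    exists e. split; auto. intros h Hh. rewrite H0; auto. }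
  split.
  { exists d. split; auto. intros z Hz. rewrite H0 by auto. unfold Cdiv. ring. }
  exists (fun z => u' z / (z - c) - u z / ((z - c) * (z - c))).
  intros z Hz. destruct (Rlt_dec (Cmod (z - c)) d) as [L | N].
  - destruct (Near z L) as [e [He Hn]]. split.
    + apply (Cder_ext_loc (fun _ => 0)).
      exists e. split; auto. intros h Hh. rewrite H0; auto. unfold Cdiv; ring.
      eapply Cder_eq. apply Cder_const. rewrite H0, H0' by auto. unfold Cdiv; ring.
    + exists 0. apply (Cder_ext_loc (fun _ => 0)); [|apply Cder_const].
      exists e. split; auto. intros h Hh. rewrite H0, H0' by auto. unfold Cdiv; ring.
  - assert (Hn : z - c <> 0). { apply Cmod_gt_0. lra. }
    destruct (Hu z Hz) as [H1 [l H2]]. split.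
    + cder_val. auto. field. auto.
    + eexists. cder; auto using Cmult_neq_0.
Qed.

(** All [u/(z-c)^n] are differentiable on the disc. The estimate on a circle of radius [r > |a -
    c|] therefore bounds [|u(a)|] by a constant times [(|a-c|/r)^n], for every [n]. *)
Lemma flat_at_zero (c : C) (R0 : R) (u : C -> C) : 0 < R0 -> flat_at c R0 u ->
  forall a, Cmod (a - c) < R0 -> u a = 0.
Proof.
  intros HR Hu a Ha.
  destruct (Ceq_dec a c) as [-> | Nac].
  { destruct Hu as [[d [Hd H]] _]. apply H. rewrite Cmod_diag; auto. }
  assert (Pac : 0 < Cmod (a - c)). { apply Cmod_gt_0, Cminus_eq_contra; auto. }
  set (r := ((Cmod (a - c) + R0) / 2)%R).
  assert (Hr1 : Cmod (a - c) < r) by (unfold r; lra).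
  assert (Hr2 : r < R0) by (unfold r; lra).
  assert (HB : exists M, 0 <= M /\ forall t : R, 0 <= t <= 2 * PI -> Cmod (u (circle c r t)) <= M).
  { destruct Hu as [_ [u' Hu]]. assert (Pi := PI_RGT_0).
    apply (Cmod_bounded (fun t => u (circle c r t))). lra. intros t _.
    eapply Cder_Ccont. apply (Cder_comp u). apply Cder_circle. apply Hu. rewrite circle_mod; lra. }
  destruct HB as [M [HM0 HM]].
  assert (Hn : forall n, flat_at c R0 (fun z => u z / (z - c) ^ n)).
  { induction n as [|n IH].
    - destruct Hu as [[d [Hd H]] [u' Hu]]. split.
      exists d. split; auto. intros z Hz. rewrite H by auto. unfold Cdiv; ring.
      exists u'. intros z Hz. destruct (Hu z Hz) as [A B]. split; auto.
      eapply Cder_ext; [|exact A]. intros w. simpl. field.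
    - apply flat_at_div in IH; auto.
      destruct IH as [[d [Hd H]] [v' Hv]].
      assert (Heq : forall z, u z / (z - c) ^ n / (z - c) = u z / (z - c) ^ S n).
      { intros z. destruct (Ceq_dec z c) as [-> | N].
        - assert (U0 : u c = 0).
          { destruct Hu as [[e [He Z]] _]. apply Z. rewrite Cmod_diag; auto. }
          rewrite U0. unfold Cdiv; ring.
        - assert (z - c <> 0) by (apply Cminus_eq_contra; auto). simpl. field.
          split; auto. apply Cpow_nz; auto. }
      split. exists d; split; auto. intros z Hz. rewrite <- Heq. auto.
      exists v'. intros z Hz. destruct (Hv z Hz) as [A B]. split; auto.
      eapply Cder_ext; [|exact A]. intros; apply Heq. }
  set (K := (2 * (M * (r / (r - Cmod (a - c)))))%R).
  assert (HK : 0 <= K).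
  { unfold K. apply Rmult_le_pos. lra. apply Rmult_le_pos; auto. apply Rdiv_le_0_compat; lra. }
  set (rho := (Cmod (a - c) / r)%R).
  assert (Hrho : 0 <= rho < 1).
  { unfold rho. split. apply Rdiv_le_0_compat; lra. apply Rmult_lt_reg_r with r. lra.
    replace (Cmod (a - c) / r * r)%R with (Cmod (a - c)) by (field; lra). lra. }
  assert (Hest : forall n, Cmod (u a) <= K * rho ^ n).
  { intros n. destruct (Hn n) as [_ [v' Hv]].
    assert (Z := Cauchy_estimate (fun z => u z / (z - c) ^ n) v' c a R0 r (M / r ^ n)
      (fun z Hz => proj1 (Hv z Hz)) (fun z Hz => proj2 (Hv z Hz)) Hr1 Hr2).
    assert (Pr : 0 < r ^ n) by (apply pow_lt; lra).
    assert (Pa : 0 < Cmod (a - c) ^ n) by (apply pow_lt; lra).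
    cbv beta in Z.
    assert (Hz : Cmod (u a / (a - c) ^ n) <= 2 * (M / r ^ n * (r / (r - Cmod (a - c))))).
    { apply Z. intros t Ht. assert (Hc := circle_mod c r t ltac:(lra)).
      rewrite Cmod_div, Cmod_pow, Hc by (apply Cpow_nz, Cmod_gt_0; lra).
      unfold Rdiv. apply Rmult_le_compat_r; auto. left; apply Rinv_0_lt_compat; auto. }
    rewrite Cmod_div, Cmod_pow in Hz by (apply Cpow_nz, Cmod_gt_0; auto).
    apply Rmult_le_compat_r with (r := (Cmod (a - c) ^ n)%R) in Hz; [|lra].
    replace (Cmod (u a) / Cmod (a - c) ^ n * Cmod (a - c) ^ n)%R with (Cmod (u a)) in Hz by (field; lra).
    eapply Rle_trans. apply Hz. right. unfold K, rho. unfold Rdiv at 4. rewrite Rpow_mult_distr, pow_inv.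
    field. lra. }
  apply Cmod_eq_0. apply Rle_antisym; [|apply Cmod_ge_0].
  apply le_epsilon. intros eps Heps. rewrite Rplus_0_l.
  destruct (pow_lt_1_zero rho ltac:(rewrite Rabs_pos_eq; lra) (eps / (K + 1)))%R as [n0 Hn0].
  apply Rdiv_lt_0_compat; lra.
  specialize (Hn0 n0 (le_n _)). rewrite Rabs_pos_eq in Hn0 by (apply pow_le; lra).
  eapply Rle_trans. apply (Hest n0).
  assert (0 <= rho ^ n0) by (apply pow_le; lra).
  apply Rle_trans with ((K + 1) * (eps / (K + 1)))%R. nra. right. field. lra.
Qed.

(** A primitive [F - F(c)] of [f] vanishes near [c] and is twice differentiable, so it vanishes,
    and [f] with it. *)
Lemma disc_identity (f : C -> C) (c : C) (R0 d : R) : 0 < d -> 0 < R0 ->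
  (forall z, Cmod (z - c) < R0 -> exists l, Cder f z l) ->
  (forall z, Cmod (z - c) < d -> f z = 0) ->
  forall z, Cmod (z - c) < R0 -> f z = 0.
Proof.
  intros Hd HR Hf H0 a Ha.
  destruct (disc_primitive f c R0 Hf) as [F HF].
  assert (Hcc := Cmod_diag c).
  assert (Z : forall z, Cmod (z - c) < R0 -> F z - F c = 0).
  { intros z Hz.
    apply (flat_at_zero c R0 (fun w => F w - F c) HR); auto. split.
    - exists (Rmin d R0). split. apply Rmin_glb_lt; auto. intros w Hw.
      rewrite (Cder_zero_const F c w). ring. intros t Ht.
      assert (Hin : Cmod (c + t * (w - c) - c) <= Cmod (w - c)) by (apply ball_convex; auto; rewrite ?Hcc; auto using Rle_refl, Cmod_ge_0).
      assert (I1 := Rmin_l d R0). assert (I2 := Rmin_r d R0).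
      eapply Cder_eq. apply HF. lra. apply H0. lra.
    - exists f. intros w Hw. split; auto. eapply Cder_eq. apply Cder_minus. apply HF; auto.
      apply Cder_const. ring. }
  eapply Cder_unique. apply HF; auto.
  apply (Cder_ext_loc (fun _ => F c)); [|apply Cder_const].
  exists (R0 - Cmod (a - c))%R. split. lra. intros h Hh.
  assert (Hin : Cmod (a + h - c) < R0).
  { replace (a + h - c) with ((a - c) + h) by ring. eapply Rle_lt_trans. apply Cmod_triangle. lra. }
  apply Z in Hin. replace (F (a + h)) with (F (a + h) - F c + F c) by ring. rewrite Hin. ring.
Qed.

(** Let [s] be the supremum of the parameters near which [f] vanishes. A disc contained in [D]
    around the point of parameter [s] meets the interior of the zero set, hence [f] vanishes on
    that disc; so [s] is attained, and equals 1. *)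
Lemma segment_identity (D : C -> Prop) (f : C -> C) (a b : C) :
  (forall z, D z -> exists r, 0 < r /\ forall w, Cmod (w - z) < r -> D w) ->
  (forall z, D z -> exists l, Cder f z l) ->
  (forall t : R, 0 <= t <= 1 -> D (a + t * (b - a))) ->
  (exists d, 0 < d /\ forall z, Cmod (z - a) < d -> f z = 0) ->
  exists d, 0 < d /\ forall z, Cmod (z - b) < d -> f z = 0.
Proof.
  intros Hopen Hf Hseg Ha.
  set (p := fun t : R => a + t * (b - a)).
  set (E := fun t : R => 0 <= t <= 1 /\ exists d, 0 < d /\ forall z, Cmod (z - p t) < d -> f z = 0).
  assert (E0 : E 0%R).
  { split. lra. unfold p. replace (a + 0 * (b - a)) with a by ring. auto. }
  assert (HE1 : bound E). { exists 1%R. intros t [Ht _]. lra. }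
  destruct (completeness E HE1 (ex_intro _ _ E0)) as [s [Hs1 Hs2]].
  assert (Hs01 : 0 <= s <= 1).
  { split. apply Hs1, E0. apply Hs2. intros t [Ht _]. lra. }
  destruct (Hopen (p s)) as [r [Hr HD]]. apply Hseg; auto.
  set (L := (Cmod (b - a) + 1)%R).
  assert (HL : 0 < L). { unfold L. assert (Q := Cmod_ge_0 (b - a)). lra. }
  assert (Hp : forall t u, Cmod (p t - p u) <= Rabs (t - u) * L).
  { intros t u. unfold p. replace (a + t * (b - a) - (a + u * (b - a))) with (RtoC (t - u) * (b - a))
      by (rewrite RtoC_minus; ring).
    rewrite Cmod_mult, Cmod_R. apply Rmult_le_compat_l. apply Rabs_pos. unfold L; lra. }
  set (e := (r / (2 * L))%R).
  assert (He : 0 < e) by (unfold e; apply Rdiv_lt_0_compat; lra).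
  assert (HeL : (e * L = r / 2)%R) by (unfold e; field; lra).
  assert (Ht : exists t, E t /\ s - e < t <= s).
  { destruct (classic (exists t, E t /\ s - e < t)) as [[t [H1 H2]] | N].
    - exists t. split; [exact H1|]. split; [exact H2|]. exact (Hs1 t H1).
    - exfalso. assert (s <= s - e).
      { apply Hs2. intros t Et. destruct (Rle_dec t (s - e)); auto. exfalso. apply N. exists t. split; auto. lra. }
      lra. }
  destruct Ht as [t [[Ht01 [d [Hd H0]]] Hts]].
  assert (Hdisc : forall z, Cmod (z - p s) < r -> f z = 0 \/ r / 2 <= Cmod (z - p t)).
  { intros z Hz. destruct (Rlt_dec (Cmod (z - p t)) (r / 2)) as [Lt|N]; [left|right; lra].
    apply (disc_identity f (p t) (r / 2) d); auto. lra.
    intros w Hw. apply Hf, HD. replace (w - p s) with ((w - p t) + (p t - p s)) by ring.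
    eapply Rle_lt_trans. apply Cmod_triangle. specialize (Hp t s).
    assert (Rabs (t - s) * L <= r / 2).
    { rewrite <- HeL. apply Rmult_le_compat_r. lra. apply Rabs_le. lra. }
    lra. }
  (* A point of parameter [t] close to [s] is the centre of a disc of radius [r/2] on which [f]
     vanishes and which contains the point of parameter [s]. *)
  assert (Hst : Cmod (p s - p t) < r / 2).
  { eapply Rle_lt_trans. apply Hp. rewrite <- HeL. apply Rmult_lt_compat_r; auto.
    apply Rabs_lt_between. lra. }
  set (d2 := (r / 2 - Cmod (p s - p t))%R).
  assert (Hd2 : 0 < d2) by (unfold d2; lra).
  assert (Hns : forall z, Cmod (z - p s) < d2 -> f z = 0).
  { intros z Hz. unfold d2 in Hz. assert (Q := Cmod_ge_0 (p s - p t)).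
    destruct (Hdisc z) as [H | H]; auto. lra. exfalso.
    replace (z - p t) with ((z - p s) + (p s - p t)) in H by ring.
    assert (Q2 := Cmod_triangle (z - p s) (p s - p t)). lra. }
  assert (Hall : forall z, Cmod (z - p s) < r -> f z = 0).
  { apply (disc_identity f (p s) r d2); auto. }
  assert (Es : E s). { split; auto. exists r. auto. }
  assert (s = 1%R).
  { destruct (Rle_lt_or_eq_dec s 1) as [Lt | Eq]; auto; try lra. exfalso.
    set (s' := Rmin 1 (s + e / 2)).
    assert (Hs' : s < s') by (apply Rmin_glb_lt; lra).
    assert (Hs'1 : s' <= 1) by apply Rmin_l.
    assert (Hs'2 : s' <= s + e / 2) by apply Rmin_r.
    assert (E s').
    { split. lra. exists (r / 2)%R. split. lra. intros z Hz. apply Hall.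
      replace (z - p s) with ((z - p s') + (p s' - p s)) by ring.
      eapply Rle_lt_trans. apply Cmod_triangle.
      assert (Cmod (p s' - p s) <= r / 2).
      { eapply Rle_trans. apply Hp. rewrite <- HeL. apply Rmult_le_compat_r. lra.
        apply Rabs_le. lra. }
      lra. }
    assert (s' <= s) by (apply Hs1; auto). lra. }
  subst s. exists r. split; auto. intros z Hz. apply Hall. unfold p.
  replace (z - (a + 1 * (b - a))) with (z - b) by ring. auto.
Qed.

(** * The principal logarithm on the cut plane *)

(** The plane cut along the nonpositive real axis, in a form free of the argument. *)
Definition slit (z : C) : Prop := Im z <> 0%R \/ 0 < Re z.

Lemma slit_neq_0 (z : C) : slit z -> z <> 0.
Proof. intros [H|H] ->; simpl in H; lra. Qed.

Lemma acos_m1 : acos (-1) = PI.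
Proof. rewrite <- cos_PI. apply acos_cos. assert (H := PI_RGT_0). lra. Qed.

Lemma Re_div_Cmod (z : C) : z <> 0 -> -1 <= Re z / Cmod z <= 1.
Proof.
  intros Hz. apply Cmod_gt_0 in Hz. assert (H := re_le_Cmod z). apply Rabs_le_between in H.
  split; apply Rmult_le_reg_r with (Cmod z); auto;
  replace (Re z / Cmod z * Cmod z)%R with (Re z) by (field; lra); lra.
Qed.

Lemma Rabs_Carg (z : C) : Rabs (Carg z) = acos (Re z / Cmod z).
Proof.
  unfold Carg. assert (H := acos_bound (Re z / Cmod z)).
  destruct (Rle_dec 0 (Im z)). apply Rabs_pos_eq; lra.
  rewrite Rabs_Ropp. apply Rabs_pos_eq; lra.
Qed.

Lemma sector_PI (z : C) : sector PI z <-> slit z.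
Proof.
  unfold sector. rewrite Rabs_Carg. split.
  - intros [Hz H]. destruct (Req_dec (Im z) 0) as [E|N]; [|left; auto].
    right. destruct (Rlt_dec 0 (Re z)) as [L|N]; auto. exfalso.
    assert (Re z <> 0%R). { intros E'. apply Hz. apply Ceq_ReIm; simpl; auto. }
    assert (Hm : Cmod z = (- Re z)%R).
    { replace z with (RtoC (Re z)) at 1. rewrite Cmod_R, Rabs_left; lra.
      apply Ceq_ReIm; simpl; auto. }
    rewrite Hm in H. replace (Re z / - Re z)%R with (-1)%R in H by (field; lra).
    rewrite acos_m1 in H. lra.
  - intros Hs. assert (Hz := slit_neq_0 z Hs). split; auto.
    assert (B := acos_bound (Re z / Cmod z)). destruct (Req_dec (acos (Re z / Cmod z)) PI) as [E|N]; [|lra].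
    exfalso. assert (C1 := cos_acos _ (Re_div_Cmod z Hz)). rewrite E, cos_PI in C1.
    apply Cmod_gt_0 in Hz. assert (Cmod z = - Re z)%R.
    { replace (Re z) with (Re z / Cmod z * Cmod z)%R by (field; lra). rewrite <- C1. ring. }
    assert (E2 := Cmod2_alt z). destruct Hs as [Hs|Hs]; [|lra].
    assert (0 < Im z * Im z). { destruct (Rdichotomy _ _ Hs); nra. }
    rewrite H in E2. nra.
Qed.

Lemma sector_PI2 (z : C) : sector (PI / 2) z <-> 0 < Re z.
Proof.
  unfold sector. rewrite Rabs_Carg. assert (Pi := PI_RGT_0). split.
  - intros [Hz H]. assert (C1 := cos_acos _ (Re_div_Cmod z Hz)).
    assert (B := acos_bound (Re z / Cmod z)).
    assert (0 < cos (acos (Re z / Cmod z))) by (apply cos_gt_0; lra).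
    rewrite C1 in H0. apply Cmod_gt_0 in Hz.
    replace (Re z) with (Re z / Cmod z * Cmod z)%R by (field; lra). nra.
  - intros H. assert (Hz : z <> 0) by (intros ->; simpl in H; lra). split; auto.
    assert (C1 := cos_acos _ (Re_div_Cmod z Hz)).
    assert (B := acos_bound (Re z / Cmod z)).
    destruct (Rlt_dec (acos (Re z / Cmod z)) (PI / 2)); auto. exfalso.
    assert (cos (acos (Re z / Cmod z)) <= 0) by (apply cos_le_0; lra).
    apply Cmod_gt_0 in Hz. assert (0 < Re z / Cmod z) by (apply Rdiv_lt_0_compat; auto). lra.
Qed.

Lemma Im_Clog (z : C) : Im (Clog z) = Carg z.
Proof. unfold Clog; simpl; ring. Qed.

Lemma Cexp_Clog (z : C) : z <> 0 -> Cexp (Clog z) = z.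
Proof.
  intros Hz. assert (P := proj1 (Cmod_gt_0 z) Hz).
  assert (R1 : Re (Clog z) = ln (Cmod z)) by (unfold Clog; simpl; ring).
  assert (I1 := Im_Clog z).
  assert (B := Re_div_Cmod z Hz).
  assert (C1 := cos_acos _ B). assert (S1 := sin_acos _ B).
  assert (S2 : sqrt (1 - (Re z / Cmod z)²) = Rabs (Im z / Cmod z)).
  { rewrite <- sqrt_Rsqr_abs. f_equal. unfold Rsqr. assert (E := Cmod2_alt z).
    replace (1 - Re z / Cmod z * (Re z / Cmod z))%R with ((Cmod z ^ 2 - Re z ^ 2) / (Cmod z ^ 2))%R by (field; lra).
    rewrite E. replace (Re z ^ 2 + Im z ^ 2 - Re z ^ 2)%R with (Im z ^ 2)%R by ring.
    rewrite <- E. field. lra. }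
  assert (S3 : Rabs (Im z / Cmod z) = (Rabs (Im z) / Cmod z)%R).
  { unfold Rdiv. rewrite Rabs_mult, (Rabs_pos_eq (/ Cmod z)); auto. left. apply Rinv_0_lt_compat; auto. }
  apply Ceq_ReIm; rewrite ?Re_Cexp, ?Im_Cexp, R1, I1, exp_ln by auto; unfold Carg;
    destruct (Rle_dec 0 (Im z)) as [L|N].
  - rewrite C1. field. lra.
  - rewrite cos_neg, C1. field. lra.
  - rewrite S1, S2, S3, Rabs_pos_eq by auto. field. lra.
  - rewrite sin_neg, S1, S2, S3, Rabs_left by lra. field. lra.
Qed.

Lemma Cexp_eq_1 (w : C) : Cexp w = 1 -> Rabs (Im w) < 2 * PI -> w = 0.
Proof.
  intros H Hi.
  assert (HR : Re w = 0%R).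
  { assert (E := Cmod_Cexp w). rewrite H, Cmod_1 in E. rewrite <- (ln_exp (Re w)), <- E. apply ln_1. }
  assert (HC : cos (Im w) = 1%R).
  { assert (E := Re_Cexp w). rewrite H, HR, exp_0 in E. simpl in E. lra. }
  apply Ceq_ReIm; auto. simpl.
  assert (S0 : sin (Im w / 2) = 0%R).
  { assert (D := cos_2a_sin (Im w / 2)). replace (2 * (Im w / 2))%R with (Im w) in D by field.
    rewrite HC in D. nra. }
  apply Rabs_lt_between in Hi.
  destruct (Rtotal_order (Im w) 0) as [L | [E | G]]; auto.
  - assert (0 < sin (- (Im w / 2))) by (apply sin_gt_0; lra). rewrite sin_neg in H0. lra.
  - assert (0 < sin (Im w / 2)) by (apply sin_gt_0; lra). lra.
Qed.

(** Two logarithms whose imaginary parts are less than [pi] in modulus differ by less than one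
    period. *)
Lemma Clog_unique (w z : C) : Cexp w = z -> Rabs (Im w) < PI -> slit z -> w = Clog z.
Proof.
  intros H Hi Hs. assert (Hz := slit_neq_0 z Hs).
  apply sector_PI in Hs. destruct Hs as [_ Hs].
  assert (E : w - Clog z = 0).
  { apply Cexp_eq_1. rewrite Cexp_minus, Cexp_Clog, H by auto. field. auto.
    rewrite Im_minus, Im_Clog. eapply Rle_lt_trans. apply Rabs_triang. rewrite Rabs_Ropp. lra. }
  replace w with (w - Clog z + Clog z) by ring. rewrite E. ring.
Qed.

Lemma slit_open (z : C) : slit z -> exists r, 0 < r /\ forall w, Cmod (w - z) < r -> slit w.
Proof.
  intros [H|H].
  - exists (Rabs (Im z)). split. apply Rabs_pos_lt; auto. intros w Hw. left. intros E.
    assert (Q := Im_le_Cmod (w - z)). rewrite Im_minus, E in Q.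
    replace (0 - Im z)%R with (- Im z)%R in Q by ring. rewrite Rabs_Ropp in Q. lra.
  - exists (Re z). split; auto. intros w Hw. right.
    assert (Q := re_le_Cmod (w - z)). rewrite Re_minus in Q.
    apply Rabs_le_between in Q. lra.
Qed.

Lemma slit_segment (z : C) (t : R) : slit z -> 0 <= t <= 1 -> slit (1 + t * (z - 1)).
Proof.
  intros Hs Ht. unfold slit.
  replace (Im (1 + t * (z - 1))) with (t * Im z)%R by (unfold Im, Re; simpl; ring).
  replace (Re (1 + t * (z - 1))) with (1 - t + t * Re z)%R by (unfold Im, Re; simpl; ring).
  destruct (Req_dec t 0) as [-> | N]. right; lra.
  destruct Hs as [H|H]. left. apply Rmult_integral_contrapositive; auto. right. nra.
Qed.

Lemma slit_shift (z : C) (u : R) : slit z -> 0 <= u -> slit (z + u).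
Proof.
  intros [H|H] Hu; [left|right]; simpl; unfold Im, Re in *. rewrite Rplus_0_r; auto. lra.
Qed.

Lemma slit_shift_l (z : C) (u : R) : slit z -> 0 <= u -> slit (u + z).
Proof. intros H Hu. rewrite Cplus_comm. apply slit_shift; auto. Qed.

Lemma slit_scal (z : C) (r : R) : slit z -> 0 < r -> slit (r * z).
Proof.
  intros [H|H] Hr; [left|right].
  rewrite im_scal_l. apply Rmult_integral_contrapositive; split; auto; lra.
  rewrite re_scal_l. nra.
Qed.

(** Near [z] a primitive [L] of [1/w], normalised by [L z = Clog z], satisfies [exp (L w) = w]
    since [exp (L w)/w] has derivative 0; for [w] close to [z] the imaginary part of [L w] stays
    less than [pi] in modulus, so [L w] is [Clog w]. *)
Lemma Cder_Clog (z : C) : slit z -> Cder Clog z (/ z).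
Proof.
  intros Hs. assert (Hz := slit_neq_0 z Hs). assert (Pz := proj1 (Cmod_gt_0 z) Hz).
  destruct (slit_open z Hs) as [r0 [Hr0 Hop]].
  set (r := Rmin r0 (Cmod z)).
  assert (Hr : 0 < r) by (apply Rmin_glb_lt; auto).
  assert (Hnz : forall w, Cmod (w - z) < r -> w <> 0).
  { intros w Hw ->. replace (0 - z) with (- z) in Hw by ring. rewrite Cmod_opp in Hw.
    assert (r <= Cmod z) by apply Rmin_r. lra. }
  destruct (disc_primitive (fun w => / w) z r) as [P HP].
  { intros w Hw. eexists. apply Cder_inv_id; auto. }
  set (L := fun w => P w - P z + Clog z).
  assert (HL : forall w, Cmod (w - z) < r -> Cder L w (/ w)).
  { intros w Hw. assert (HPw := HP w Hw). unfold L. cder_val. ring. }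
  assert (Hzz := Cmod_diag z).
  assert (EL : forall w, Cmod (w - z) < r -> Cexp (L w) = w).
  { intros w Hw.
    assert (E : Cexp (L w) / w = Cexp (L z) / z).
    { apply (Cder_zero_const (fun v => Cexp (L v) / v) z w). intros t Ht.
      assert (Hin : Cmod (z + t * (w - z) - z) < r).
      { eapply Rle_lt_trans; [|apply Hw]. apply ball_convex; auto. rewrite Hzz. apply Cmod_ge_0. lra. }
      eapply Cder_eq. apply Cder_div. auto. apply Cder_Cexp_comp. apply HL; auto. apply Cder_id.
      cbv beta; field. auto. }
    assert (EZ : Cexp (L z) = z).
    { replace (L z) with (Clog z) by (unfold L; ring). apply Cexp_Clog; auto. }
    rewrite EZ in E. replace (z / z) with (RtoC 1) in E by (field; auto).
    replace (Cexp (L w)) with (Cexp (L w) / w * w) by (field; auto). rewrite E. ring. }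
  assert (Cg : Rabs (Carg z) < PI). { apply sector_PI in Hs. apply Hs. }
  destruct (Cder_Ccont L z _ (HL z ltac:(lra)) ((PI - Rabs (Carg z)) / 2)%R) as [d [Hd HD]]. lra.
  apply (Cder_ext_loc L).
  - exists (Rmin d r). split. apply Rmin_glb_lt; auto. intros h Hh.
    min_split Hh Hh1 Hh2.
    assert (Hin : Cmod (z + h - z) < r) by (replace (z + h - z) with h by ring; auto).
    apply Clog_unique. apply EL; auto.
    + specialize (HD h Hh1). assert (Q := Im_le_Cmod (L (z + h) - L z)).
      rewrite Im_minus in Q. replace (L z) with (Clog z) in Q at 1 by (unfold L; ring).
      rewrite Im_Clog in Q.
      replace (Im (L (z + h))) with ((Im (L (z + h)%C) - Carg z) + Carg z)%R by ring.
      eapply Rle_lt_trans. apply Rabs_triang. lra.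
    + apply Hop. eapply Rlt_le_trans. apply Hin. apply Rmin_l.
  - apply HL. lra.
Qed.

Lemma Cder_Clog_comp (f : C -> C) (z l : C) :
  slit (f z) -> Cder f z l -> Cder (fun w => Clog (f w)) z (/ f z * l).
Proof. intros Hs H. apply (Cder_comp Clog f); auto. apply Cder_Clog; auto. Qed.

Ltac cder_ext ::=
  lazymatch goal with
  | |- Cder (fun w => Cexp (@?f w)) _ _ => apply (Cder_Cexp_comp f); cder
  | |- Cder (fun w => Clog (@?f w)) _ _ => apply (Cder_Clog_comp f); [|cder]
  end.

Lemma Clog_R (x : R) : 0 < x -> Clog x = RtoC (ln x).
Proof.
  intros Hx. symmetry. apply Clog_unique. rewrite Cexp_R, exp_ln; auto.
  simpl. rewrite Rabs_R0. apply PI_RGT_0. right. auto.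
Qed.

Lemma Clog_scal (r : R) (z : C) : 0 < r -> slit z -> Clog (r * z) = ln r + Clog z.
Proof.
  intros Hr Hs. symmetry. apply Clog_unique.
  - rewrite Cexp_plus, Cexp_R, exp_ln, Cexp_Clog; auto. apply slit_neq_0; auto.
  - rewrite im_plus, Im_Clog. simpl. rewrite Rplus_0_l. apply sector_PI in Hs. apply Hs.
  - apply slit_scal; auto.
Qed.

(** * Uniqueness of branches and of continuations *)

(** The difference [D] of two branches satisfies [exp D = 1]; hence [D' = 0], and [D] is
    constant on the cut plane, which is star-shaped about 1. There [D] is real, hence 0. *)
Lemma log_branch_eq (f L0 : C -> C) :
  (forall z, slit z -> exists l, Cder L0 z l) ->
  (forall z, slit z -> Cexp (L0 z) = f z) ->
  (forall x : R, 0 < x -> Im (L0 x) = 0%R) ->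
  forall z, slit z -> log_branch f z = L0 z.
Proof.
  intros Hd He Hi.
  assert (HE : exists L, holomorphic_on (sector PI) L
              /\ (forall z : C, sector PI z -> Cexp (L z) = f z)
              /\ (forall x : R, (0 < x)%R -> Im (L (RtoC x)) = 0%R)).
  { exists L0. split; [|split].
    - intros z Hz. apply sector_PI in Hz. destruct (Hd z Hz) as [l Hl]. exists l.
      apply Cder_is_derive; auto.
    - intros z Hz. apply He, sector_PI, Hz.
    - auto. }
  assert (H := epsilon_spec (inhabits (fun _ : C => RtoC 0)) _ HE).
  fold (log_branch f) in H. destruct H as [H1 [H2 H3]].
  set (L := log_branch f) in *.
  assert (DD : forall z, slit z -> Cder (fun w => L w - L0 w) z 0).
  { intros z Hs. destruct (Hd z Hs) as [l Hl].
    destruct (H1 z) as [m Hm]. apply sector_PI; auto.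
    apply Cder_is_derive in Hm.
    assert (D := Cder_minus L L0 z m l Hm Hl).
    assert (fourier_rem2 := Cder_Cexp_comp _ _ _ D). cbv beta in fourier_rem2.
    assert (fourier_rem3 : Cder (fun w => Cexp (L w - L0 w)) z 0).
    { apply (Cder_ext_loc (fun _ => 1)); [|apply Cder_const].
      destruct (slit_open z Hs) as [r [Hr Hop]]. exists r. split; auto. intros h Hh.
      assert (Hin : slit (z + h)). { apply Hop. replace (z + h - z) with h by ring. auto. }
      rewrite Cexp_minus, He, H2 by (auto; apply sector_PI; auto).
      assert (f (z + h) <> 0). { rewrite <- He by auto. apply Cexp_neq_0. }
      field. auto. }
    assert (E := Cder_unique _ _ _ _ fourier_rem2 fourier_rem3).
    eapply Cder_eq. exact D.
    replace (m - l) with (Cexp (L z - L0 z) * (m - l) / Cexp (L z - L0 z)).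
    rewrite E. field. apply Cexp_neq_0. field. apply Cexp_neq_0. }
  intros z Hs.
  assert (E1 : L 1 - L0 1 = 0).
  { assert (S1 : slit 1) by (right; simpl; lra).
    apply Cexp_eq_1.
    - rewrite Cexp_minus, He, H2 by (auto; apply sector_PI; auto).
      assert (f 1 <> 0). { rewrite <- He by auto. apply Cexp_neq_0. } field. auto.
    - rewrite Im_minus, H3, Hi by lra. rewrite Rminus_0_r, Rabs_R0. assert (Pi := PI_RGT_0). lra. }
  assert (E2 : L z - L0 z = L 1 - L0 1).
  { apply (Cder_zero_const (fun w => L w - L0 w)). intros t Ht. apply DD, slit_segment; auto. }
  rewrite E1 in E2. replace (L z) with (L z - L0 z + L0 z) by ring. rewrite E2. ring.
Qed.

(** The conclusion is local equality near [b], which also determines derivatives there; this is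
    used for [zeta'(-1)]. *)
Lemma analytic_continuation_eq (U D : C -> Prop) (f g : C -> C) :
  (forall z, D z -> exists l, Cder g z l) ->
  (forall z, U z -> g z = f z) ->
  (forall z, D z -> exists r, 0 < r /\ forall w, Cmod (w - z) < r -> D w) ->
  forall a b, (exists d, 0 < d /\ forall z, Cmod (z - a) < d -> U z) ->
  (forall t : R, 0 <= t <= 1 -> D (a + t * (b - a))) ->
  exists d, 0 < d /\ forall z, Cmod (z - b) < d -> analytic_continuation U D f z = g z.
Proof.
  intros Hg HU Hop a b Ha Hseg.
  assert (HE : exists g, holomorphic_on D g /\ forall z : C, U z -> g z = f z).
  { exists g. split; auto. intros z Hz. destruct (Hg z Hz) as [l Hl]. exists l. apply Cder_is_derive; auto. }
  assert (H := epsilon_spec (inhabits (fun _ : C => RtoC 0)) _ HE).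
  fold (analytic_continuation U D f) in H. set (F := analytic_continuation U D f) in *.
  destruct H as [H1 H2].
  destruct (segment_identity D (fun z => F z - g z) a b) as [d [Hd HD]]; auto.
  - intros z Hz. destruct (Hg z Hz) as [l Hl]. destruct (H1 z Hz) as [m Hm].
    apply Cder_is_derive in Hm. eexists. apply Cder_minus; eauto.
  - destruct Ha as [d [Hd HD]]. exists d. split; auto. intros z Hz.
    rewrite H2, HU by auto. ring.
  - exists d. split; auto. intros z Hz. specialize (HD z Hz). cbv beta in HD.
    replace (F z) with (F z - g z + g z) by ring. rewrite HD. ring.
Qed.

(** * Improper integrals *)

(** Locally uniform lower bound behind all the dominations below. For [Im z <> 0] the bounds
    [|Im z|] for small [u] and [u - |z|] for large [u] are combined. *)
Lemma slit_lower (z : C) : slit z -> exists k, 0 < k /\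
  forall w, Cmod (w - z) <= k -> forall u : R, 0 <= u -> k * (1 + u) <= Cmod (u + w).
Proof.
  intros Hs.
  assert (H : exists k, 0 < k /\ forall u : R, 0 <= u -> k * (1 + u) <= Cmod (u + z)).
  { destruct Hs as [H|H].
    - assert (Pb := Rabs_pos_lt _ H). assert (Pz := Cmod_ge_0 z).
      set (k1 := (Rabs (Im z) / (2 * Cmod z + 2))%R).
      assert (Hk1 : 0 < k1) by (apply Rdiv_lt_0_compat; lra).
      exists (Rmin (1/2) k1). split. apply Rmin_glb_lt; lra. intros u Hu.
      destruct (Rle_dec u (2 * Cmod z + 1)) as [L|N].
      + apply Rle_trans with (k1 * (2 * Cmod z + 2))%R.
        apply Rmult_le_compat; try lra. apply Rmin_glb; lra. apply Rmin_r.
        replace (k1 * (2 * Cmod z + 2))%R with (Rabs (Im z)) by (unfold k1; field; lra).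
        replace (Im z) with (Im (u + z)) by (simpl; apply Rplus_0_l). apply Im_le_Cmod.
      + apply Rle_trans with (1/2 * (1 + u))%R. apply Rmult_le_compat_r. lra. apply Rmin_l.
        assert (Q := Cmod_triangle_inv' u z). rewrite Cmod_R, Rabs_pos_eq in Q by auto. lra.
    - exists (Rmin 1 (Re z)). split. apply Rmin_glb_lt; lra. intros u Hu.
      apply Rle_trans with (Re (u + z)). 2: { eapply Rle_trans. apply Rle_abs. apply re_le_Cmod. }
      replace (Re (u + z)) with (u + Re z)%R by reflexivity.
      assert (M1 := Rmin_l 1 (Re z)). assert (M2 := Rmin_r 1 (Re z)). nra. }
  destruct H as [k [Hk H]]. exists (k / 2)%R. split. lra. intros w Hw u Hu.
  specialize (H u Hu). replace (u + w) with ((u + z) + (w - z)) by ring.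
  assert (Q := Cmod_triangle_inv' (u + z) (w - z)). nra.
Qed.

Definition is_Cint_inf (f : R -> C) (a : R) (l : C) : Prop :=
  (forall b, a <= b -> ex_CRInt f a b) /\
  forall eps, 0 < eps -> exists B, forall b, a <= b -> B <= b ->
    Cmod (CRInt f a b - l) <= eps.

Lemma is_Cint_inf_unique (f : R -> C) (a : R) (l m : C) : is_Cint_inf f a l -> is_Cint_inf f a m -> l = m.
Proof.
  intros [_ H1] [_ H2].
  assert (E : Cmod (l - m) <= 0).
  { apply le_epsilon. intros eps Heps.
    destruct (H1 (eps / 2)%R) as [B1 HB1]. lra. destruct (H2 (eps / 2)%R) as [B2 HB2]. lra.
    set (b := Rmax a (Rmax B1 B2)).
    assert (Ha : a <= b) by apply Rmax_l.
    assert (Hb : Rmax B1 B2 <= b) by apply Rmax_r.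
    assert (Q1 := Rmax_l B1 B2). assert (Q2 := Rmax_r B1 B2).
    specialize (HB1 b Ha ltac:(lra)). specialize (HB2 b Ha ltac:(lra)).
    replace (l - m) with ((CRInt f a b - m) - (CRInt f a b - l)) by ring.
    eapply Rle_trans. apply Cmod_minus_le. lra. }
  assert (P := Cmod_ge_0 (l - m)).
  assert (Z : l - m = 0) by (apply Cmod_eq_0; lra).
  replace l with (l - m + m) by ring. rewrite Z. ring.
Qed.

Lemma is_Cint_inf_plus (f g : R -> C) (a : R) (l m : C) :
  is_Cint_inf f a l -> is_Cint_inf g a m -> is_Cint_inf (fun u => f u + g u) a (l + m).
Proof.
  intros [E1 H1] [E2 H2].
  assert (E : forall b, a <= b -> is_CRInt (fun u => f u + g u) a b (CRInt f a b + CRInt g a b)).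
  { intros b Hb. apply is_CRInt_plus; apply CRInt_correct; auto. }
  split. { intros b Hb. eexists. apply E; auto. }
  intros eps Heps.
  destruct (H1 (eps / 2)%R) as [B1 HB1]. lra. destruct (H2 (eps / 2)%R) as [B2 HB2]. lra.
  exists (Rmax B1 B2). intros b Ha Hb.
  assert (Q1 := Rmax_l B1 B2). assert (Q2 := Rmax_r B1 B2).
  specialize (HB1 b Ha ltac:(lra)). specialize (HB2 b Ha ltac:(lra)).
  rewrite (CRInt_unique _ _ _ _ (E b Ha)).
  replace (CRInt f a b + CRInt g a b - (l + m)) with ((CRInt f a b - l) + (CRInt g a b - m)) by ring.
  eapply Rle_trans. apply Cmod_triangle. lra.
Qed.

Lemma is_Cint_inf_scal (c : C) (f : R -> C) (a : R) (l : C) :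
  is_Cint_inf f a l -> is_Cint_inf (fun u => c * f u) a (c * l).
Proof.
  intros [E1 H1].
  assert (E : forall b, a <= b -> is_CRInt (fun u => c * f u) a b (c * CRInt f a b)).
  { intros b Hb. apply is_CRInt_scal; apply CRInt_correct; auto. }
  split. { intros b Hb. eexists. apply E; auto. }
  intros eps Heps. assert (Pc := Cmod_ge_0 c).
  destruct (H1 (eps / (Cmod c + 1))%R) as [B1 HB1]. apply Rdiv_lt_0_compat; lra.
  exists B1. intros b Ha Hb. specialize (HB1 b Ha Hb).
  rewrite (CRInt_unique _ _ _ _ (E b Ha)).
  replace (c * CRInt f a b - c * l) with (c * (CRInt f a b - l)) by ring.
  rewrite Cmod_mult.
  apply Rle_trans with ((Cmod c + 1) * (eps / (Cmod c + 1)))%R.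
  apply Rmult_le_compat; try lra. apply Cmod_ge_0. right. field. lra.
Qed.

Lemma is_Cint_inf_ext (f g : R -> C) (a : R) (l : C) :
  (forall u, a < u -> f u = g u) -> is_Cint_inf f a l -> is_Cint_inf g a l.
Proof.
  intros Efg [E1 H1].
  assert (E : forall b, a <= b -> is_CRInt g a b (CRInt f a b)).
  { intros b Hb. eapply is_CRInt_ext; [|apply CRInt_correct; auto].
    intros x Hx. rewrite Rmin_left in Hx by auto. apply Efg. lra. }
  split. { intros b Hb. eexists. apply E; auto. }
  intros eps Heps. destruct (H1 eps Heps) as [B HB]. exists B. intros b Ha Hb.
  rewrite (CRInt_unique _ _ _ _ (E b Ha)). auto.
Qed.

Lemma is_Cint_inf_minus (f g : R -> C) (a : R) (l m : C) :
  is_Cint_inf f a l -> is_Cint_inf g a m -> is_Cint_inf (fun u => f u - g u) a (l - m).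
Proof.
  intros H1 H2. apply (is_Cint_inf_scal (- (1))) in H2.
  replace (l - m) with (l + - (1) * m) by ring.
  eapply is_Cint_inf_ext; [|apply (is_Cint_inf_plus _ _ _ _ _ H1 H2)]. intros; cbv beta. ring.
Qed.

Lemma is_Cint_inf_FTC (F : C -> C) (f : R -> C) (a : R) (L : C) :
  (forall u : R, a <= u -> Cder F u (f u)) -> (forall u, a <= u -> Rcont f u) ->
  (forall eps, 0 < eps -> exists B, forall b : R, a <= b -> B <= b -> Cmod (F b - L) <= eps) ->
  is_Cint_inf f a (L - F a).
Proof.
  intros HF Hf HL.
  assert (E : forall b : R, a <= b -> is_CRInt f a b (F b - F a)).
  { intros b Hb. apply is_CRInt_FTC; intros x Hx; rewrite Rmin_left in Hx by auto. apply HF; lra. apply Hf; lra. }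
  split. { intros b Hb. eexists. apply E; auto. }
  intros eps Heps. destruct (HL eps Heps) as [B HB]. exists B. intros b Ha Hb.
  rewrite (CRInt_unique _ _ _ _ (E b Ha)).
  replace (F b - F a - (L - F a)) with (F b - L) by ring. auto.
Qed.

(** An integrable majorant [g], given together with its primitive [G] and the limit [L] of [G]
    at infinity, so that the tails of the integral are bounded by [L - G]. *)
Definition dominating (g G : R -> R) (a L : R) : Prop :=
  (forall x y, a <= x <= y -> is_RInt g x y (G y - G x)%R) /\
  (forall u, a <= u -> 0 <= g u) /\
  (forall eps, 0 < eps -> exists B, forall b, a <= b -> B <= b -> Rabs (G b - L) <= eps).

Lemma dominating_le (g G : R -> R) (a L x : R) : dominating g G a L -> a <= x -> G x <= L.
Proof.
  intros [H1 [H2 H3]] Hx. apply le_epsilon. intros eps Heps.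
  destruct (H3 eps Heps) as [B HB]. set (y := Rmax x B).
  assert (Y1 : x <= y) by apply Rmax_l. assert (Y2 : B <= y) by apply Rmax_r.
  specialize (HB y ltac:(lra) Y2). apply Rabs_le_between in HB.
  assert (0 <= G y - G x).
  { assert (HI := H1 x y ltac:(lra)).
    assert (HZ : is_RInt (fun _ => 0%R) x y ((y - x) * 0)%R) by apply (@is_RInt_const R_NormedModule).
    rewrite Rmult_0_r in HZ. eapply (is_RInt_le _ _ x y _ _ Y1 HZ HI). intros u Hu. apply H2. lra. }
  lra.
Qed.

Lemma CRInt_dominated (f : R -> C) (g G : R -> R) (a L x y : R) : dominating g G a L ->
  (forall u, a <= u -> Cmod (f u) <= g u) -> a <= x <= y ->
  forall l, is_CRInt f x y l -> Cmod l <= G y - G x.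
Proof.
  intros [H1 _] Hf Hxy l Hl. eapply is_CRInt_norm; [| |exact Hl|apply H1; auto]. lra.
  intros u Hu. apply Hf. lra.
Qed.

Lemma is_Cint_inf_bound (f : R -> C) (g G : R -> R) (a L : R) (l : C) : dominating g G a L ->
  (forall u, a <= u -> Cmod (f u) <= g u) -> is_Cint_inf f a l -> Cmod l <= L - G a.
Proof.
  intros HD Hf [E1 H1]. apply le_epsilon. intros eps Heps.
  destruct (H1 eps Heps) as [B HB]. set (b := Rmax a B).
  assert (Ha : a <= b) by apply Rmax_l. assert (Hb : B <= b) by apply Rmax_r.
  specialize (HB b Ha Hb).
  assert (Q := CRInt_dominated f g G a L a b HD Hf ltac:(lra) _ (CRInt_correct _ _ _ (E1 b Ha))).
  assert (Q2 := dominating_le g G a L b HD Ha).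
  assert (Q3 := Cmod_triangle_inv l (CRInt f a b)). rewrite Cmod_minus_sym in Q3. lra.
Qed.

(** Cauchy's criterion, with the increments bounded by those of [G]. *)
Lemma is_Cint_inf_ex (f : R -> C) (g G : R -> R) (a L : R) : dominating g G a L ->
  (forall u, a <= u -> Cmod (f u) <= g u) -> (forall b, a <= b -> ex_CRInt f a b) ->
  exists l, is_Cint_inf f a l.
Proof.
  intros HD Hf HE.
  assert (HC : exists l, filterlim (fun b => CRInt f a b) (Rbar_locally p_infty) (@locally C_UniformSpace l)).
  { apply (filterlim_locally_cauchy (U := C_R_CompleteNormedModule)).
    intros eps. destruct HD as [fourier_rem1 [fourier_rem2 fourier_rem3]] eqn:ED.
    assert (He : 0 < eps / 4) by (destruct eps; simpl; lra).
    destruct (fourier_rem3 _ He) as [B HB].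
    exists (fun b => Rmax a B < b). split. { exists (Rmax a B). auto. }
    assert (M1 := Rmax_l a B). assert (M2 := Rmax_r a B).
    assert (W : forall u v, Rmax a B < u -> u <= v -> Cmod (CRInt f a v - CRInt f a u) < eps).
    { intros u v Hu Hv.
      assert (Eu := HE u ltac:(lra)). assert (Ev := HE v ltac:(lra)).
      assert (Euv : ex_CRInt f u v).
      { destruct (ex_RInt_Chasles_2 (V := C_R_CompleteNormedModule) f a u v ltac:(lra) Ev) as [l Hl].
        exists l. exact Hl. }
      assert (Z := is_CRInt_Chasles _ _ _ _ _ _ (CRInt_correct _ _ _ Eu) (CRInt_correct _ _ _ Euv)).
      rewrite (CRInt_unique _ _ _ _ Z).
      replace (CRInt f a u + CRInt f u v - CRInt f a u) with (CRInt f u v) by ring.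
      assert (Q := CRInt_dominated f g G a L u v HD Hf ltac:(lra) _ (CRInt_correct _ _ _ Euv)).
      assert (B1 := HB u ltac:(lra) ltac:(lra)). assert (B2 := HB v ltac:(lra) ltac:(lra)).
      apply Rabs_le_between in B1. apply Rabs_le_between in B2.
      destruct eps as [e He']; simpl in *; lra. }
    intros u v Hu Hv. apply ball_C_R.
    destruct (Rle_dec u v). apply W; auto. rewrite Cmod_minus_sym. apply W; auto; lra. }
  destruct HC as [l Hl]. exists l. split; auto. intros eps Heps.
  assert (He : 0 < eps / 2) by lra.
  destruct (proj1 (filterlim_locally (U := C_UniformSpace) _ _) Hl (mkposreal _ He)) as [B HB].
  exists (B + 1)%R. intros b Ha Hb. specialize (HB b ltac:(lra)). apply ball_C_R_inv in HB.
  simpl in HB. lra.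
Qed.

(** Differentiation under the integral sign, with a majorant for the second order remainder
    instead of one for the derivative. *)
Lemma is_Cint_inf_der (K : C -> R -> C) (K' : R -> C) (I : C -> C) (I' z : C) (a d L : R) (g G : R -> R) :
  0 < d -> dominating g G a L ->
  (forall h, Cmod h < d -> is_Cint_inf (K (z + h)) a (I (z + h))) ->
  is_Cint_inf K' a I' ->
  (forall h, Cmod h < d -> forall u, a <= u ->
     Cmod (K (z + h) u - K z u - h * K' u) <= Cmod h * Cmod h * g u) ->
  Cder I z I'.
Proof.
  intros Hd HD HI HI' HK eps Heps.
  assert (HG := dominating_le g G a L a HD (Rle_refl a)).
  set (m := (L - G a + 1)%R).
  assert (Hm : 0 < m) by (unfold m; lra).
  exists (Rmin d (eps / m)). split. apply Rmin_glb_lt; auto. apply Rdiv_lt_0_compat; auto.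
  intros h Hh. assert (Hh0 := Cmod_ge_0 h).
  assert (Hh1 := Rlt_le_trans _ _ _ Hh (Rmin_l _ _)).
  assert (Hh2 := Rlt_le_trans _ _ _ Hh (Rmin_r _ _)).
  assert (I0 : is_Cint_inf (K z) a (I z)).
  { replace z with (z + 0) by ring. apply HI. rewrite Cmod_0. auto. }
  assert (Z := is_Cint_inf_minus _ _ _ _ _ (is_Cint_inf_minus _ _ _ _ _ (HI h Hh1) I0) (is_Cint_inf_scal h _ _ _ HI')).
  assert (HD2 : dominating (fun u => Cmod h * Cmod h * g u)%R (fun u => Cmod h * Cmod h * G u)%R a (Cmod h * Cmod h * L)).
  { destruct HD as [fourier_rem1 [fourier_rem2 fourier_rem3]]. split; [|split].
    - intros x y Hxy. rewrite <- Rmult_minus_distr_l.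
      apply (@is_RInt_scal R_NormedModule). auto.
    - intros u Hu. specialize (fourier_rem2 u Hu). nra.
    - intros e He. set (q := (Cmod h * Cmod h + 1)%R). assert (Hq : 0 < q) by (unfold q; nra).
      destruct (fourier_rem3 (e / q)%R) as [B HB]. apply Rdiv_lt_0_compat; auto.
      exists B. intros b Ha Hb. specialize (HB b Ha Hb).
      rewrite <- Rmult_minus_distr_l, Rabs_mult, (Rabs_pos_eq (Cmod h * Cmod h)) by nra.
      apply Rle_trans with (q * (e / q))%R.
      apply Rmult_le_compat; auto. nra. apply Rabs_pos. unfold q; lra. right; field; lra. }
  assert (Q := is_Cint_inf_bound _ _ _ _ _ _ HD2 (HK h Hh1) Z).
  rewrite (Cmult_comm I' h). eapply Rle_trans. apply Q.
  rewrite <- Rmult_minus_distr_l.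
  apply Rle_trans with (Cmod h * (eps / m) * m)%R.
  - apply Rmult_le_compat; try lra. nra. apply Rmult_le_compat_l; lra. unfold m; lra.
  - right. field. lra.
Qed.

(** * Stieltjes transforms *)

Lemma dominating_shift (y K : R) : 0 < y -> 0 <= K ->
  dominating (fun u => K / (y + u) ^ 2)%R (fun u => - (K / (y + u)))%R 0 0.
Proof.
  intros Hy HK. split; [|split].
  - intros x1 x2 Hxy. apply (is_RInt_derive (V := R_CompleteNormedModule) (fun u => - (K / (y + u)))%R);
      intros u Hu; rewrite Rmin_left in Hu by lra.
    + auto_derive. lra. field. lra.
    + apply (ex_derive_continuous (V := R_NormedModule)). auto_derive.
      apply Rgt_not_eq, Rmult_lt_0_compat; lra.
  - intros u Hu. apply Rdiv_le_0_compat; auto. apply pow_lt. lra.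
  - intros eps Heps. exists (K / eps)%R. intros b Hb Hb2. rewrite Rminus_0_r, Rabs_Ropp.
    rewrite Rabs_pos_eq by (apply Rdiv_le_0_compat; lra).
    apply Rmult_le_reg_r with (y + b)%R. lra.
    replace (K / (y + b) * (y + b))%R with K by (field; lra).
    apply Rmult_le_compat_l with (r := eps) in Hb2; [|lra].
    replace (eps * (K / eps))%R with K in Hb2 by (field; lra). nra.
Qed.

(** Continuous on each [[n, n+1]] after changing the values at the end points; this is the
    regularity of periodic extensions. *)
Definition pw_cont (phi : R -> C) : Prop :=
  forall n : nat, exists psi : C -> C, (forall x : R, INR n <= x <= INR n + 1 -> Ccont psi x) /\
    forall u, INR n < u < INR n + 1 -> phi u = psi u.

Lemma pw_cont_int (phi K : R -> C) : pw_cont phi -> (forall u, 0 <= u -> Rcont K u) ->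
  forall b, 0 <= b -> ex_CRInt (fun u => phi u * K u) 0 b.
Proof.
  intros Hp HK.
  assert (Hn : forall n : nat, ex_CRInt (fun u => phi u * K u) 0 (INR n)).
  { induction n as [|n IH].
    - exists 0. apply (@is_RInt_point C_R_NormedModule).
    - destruct IH as [l Hl]. destruct (Hp n) as [psi [Hc He]].
      destruct (ex_CRInt_cont (fun u => psi u * K u) (INR n) (INR (S n))) as [m Hm].
      { intros x Hx. rewrite S_INR, Rmin_left, Rmax_right in Hx by lra. apply Rcont_mult.
        apply Ccont_Rcont, Hc. lra. apply HK. assert (P := pos_INR n). lra. }
      exists (l + m). eapply is_CRInt_Chasles. exact Hl.
      eapply is_CRInt_ext; [|exact Hm]. intros x Hx.
      rewrite S_INR, Rmin_left, Rmax_right in Hx by lra. rewrite He by lra. reflexivity. }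
  intros b Hb.
  destruct (INR_unbounded b) as [n Hn2].
  destruct (ex_RInt_Chasles_1 (V := C_R_CompleteNormedModule) (fun u => phi u * K u) 0 b (INR n)) as [l Hl].
  lra. apply Hn. exists l. exact Hl.
Qed.

Lemma pw_cont_cont (f : C -> C) : (forall z, Ccont f z) -> pw_cont (fun u => f u).
Proof. intros H n. exists f. auto. Qed.

Definition Cint_inf (f : R -> C) (a : R) : C := epsilon (inhabits (RtoC 0)) (is_Cint_inf f a).

Lemma Cint_inf_spec (f : R -> C) (a : R) (l : C) : is_Cint_inf f a l -> is_Cint_inf f a (Cint_inf f a).
Proof. intros H. unfold Cint_inf; apply (epsilon_spec (inhabits (RtoC 0)) (is_Cint_inf f a)). exists l; auto. Qed.

Definition bounded_on_pos (phi : R -> C) : Prop := exists M, 0 <= M /\ forall u, 0 <= u -> Cmod (phi u) <= M.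

Lemma Rcont_inv_pow (z : C) (n : nat) (u : R) : slit z -> 0 <= u ->
  Rcont (fun t => / (t + z) ^ n) u.
Proof.
  intros Hs Hu. apply (Ccont_Rcont (fun t => / (t + z) ^ n)).
  ccont. apply Cpow_nz, slit_neq_0, slit_shift_l; auto.
Qed.

Lemma Stieltjes_bound (z : C) : slit z -> exists k, 0 < k /\ forall w, Cmod (w - z) <= k ->
  forall (phi : R -> C) (n : nat) (M : R), (2 <= n)%nat -> 0 <= M ->
    forall u, 0 <= u -> Cmod (phi u) <= M ->
    Cmod (phi u * / (u + w) ^ n) <= M / k ^ n / (1 + u) ^ 2.
Proof.
  intros Hs. destruct (slit_lower z Hs) as [k [Hk H]]. exists k. split; auto.
  intros w Hw phi n M Hn HM u Hu Hphi.
  specialize (H w Hw u Hu).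
  assert (P : 0 < k * (1 + u)) by (apply Rmult_lt_0_compat; lra).
  assert (N : u + w <> 0) by (apply Cmod_gt_0; lra).
  rewrite Cmod_mult, Cmod_inv, Cmod_pow by (apply Cpow_nz; auto).
  unfold Rdiv. rewrite Rmult_assoc. apply Rmult_le_compat; auto. apply Cmod_ge_0.
  left. apply Rinv_0_lt_compat, pow_lt. lra.
  rewrite <- Rinv_mult. apply Rinv_le_contravar.
  apply Rmult_lt_0_compat; apply pow_lt; lra.
  apply Rle_trans with ((k * (1 + u)) ^ n)%R.
  - rewrite Rpow_mult_distr. apply Rmult_le_compat_l. left; apply pow_lt; auto.
    apply Rle_pow; auto. lra.
  - apply pow_incr. lra.
Qed.

Lemma Stieltjes_ex (phi : R -> C) (n : nat) (z : C) : pw_cont phi -> bounded_on_pos phi -> slit z -> (2 <= n)%nat ->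
  exists l, is_Cint_inf (fun u => phi u * / (u + z) ^ n) 0 l.
Proof.
  intros Hp [M [HM0 HM]] Hs Hn. destruct (Stieltjes_bound z Hs) as [k [Hk H]].
  eapply is_Cint_inf_ex. apply (dominating_shift 1 (M / k ^ n) Rlt_0_1).
  apply Rdiv_le_0_compat; auto. apply pow_lt; auto.
  - intros u Hu. apply H; auto. rewrite Cmod_diag. lra.
  - apply pw_cont_int; auto. intros u Hu. apply Rcont_inv_pow; auto.
Qed.

Definition Stieltjes (phi : R -> C) (n : nat) (z : C) : C := Cint_inf (fun u => phi u * / (u + z) ^ n) 0.

Lemma Stieltjes_spec (phi : R -> C) (n : nat) (z : C) : pw_cont phi -> bounded_on_pos phi -> slit z -> (2 <= n)%nat ->
  is_Cint_inf (fun u => phi u * / (u + z) ^ n) 0 (Stieltjes phi n z).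
Proof. intros. destruct (Stieltjes_ex phi n z) as [l Hl]; auto. eapply Cint_inf_spec; eauto. Qed.

Lemma Stieltjes_der (phi : R -> C) (z : C) : pw_cont phi -> bounded_on_pos phi -> slit z ->
  Cder (Stieltjes phi 2) z (- 2 * Stieltjes phi 3 z).
Proof.
  intros Hp Hb Hs. destruct (slit_lower z Hs) as [k [Hk H]].
  destruct (slit_open z Hs) as [r [Hr Hop]].
  destruct Hb as [M [HM0 HM]]. assert (Hb : bounded_on_pos phi) by (exists M; auto).
  assert (Pk : 0 < k ^ 4) by (apply pow_lt; auto).
  apply (is_Cint_inf_der (fun w u => phi u * / (u + w) ^ 2) (fun u => -2 * (phi u * / (u + z) ^ 3))
     (Stieltjes phi 2) _ z 0 (Rmin k r) 0 (fun u => (M * 3 / k ^ 4) / (1 + u) ^ 2)%R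
     (fun u => - ((M * 3 / k ^ 4) / (1 + u)))%R).
  - apply Rmin_glb_lt; auto.
  - apply (dominating_shift 1). lra. apply Rdiv_le_0_compat; auto. lra.
  - intros h Hh. apply Stieltjes_spec; auto. apply Hop. replace (z + h - z) with h by ring.
    eapply Rlt_le_trans. apply Hh. apply Rmin_r.
  - apply is_Cint_inf_scal. apply Stieltjes_spec; auto.
  - intros h Hh u Hu. assert (Hh0 := Cmod_ge_0 h).
    assert (Hhk : Cmod h < k) by (eapply Rlt_le_trans; [apply Hh|apply Rmin_l]).
    assert (A1 := H z ltac:(rewrite Cmod_diag; lra) u Hu).
    assert (A2 := H (z + h) ltac:(replace (z + h - z) with h by ring; lra) u Hu).
    assert (P : 0 < k * (1 + u)) by (apply Rmult_lt_0_compat; lra).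
    set (a := u + z) in *. replace (u + (z + h)) with (a + h) in * by (unfold a; ring).
    assert (N1 : a <> 0) by (apply Cmod_gt_0; lra).
    assert (N2 : a + h <> 0) by (apply Cmod_gt_0; lra).
    replace (phi u * / (a + h) ^ 2 - phi u * / a ^ 2 - h * (-2 * (phi u * / a ^ 3)))
      with (h * h * (phi u * (2 * / (a ^ 3 * (a + h)) + / (a ^ 2 * (a + h) ^ 2)))).
    2: { change (RtoC (-2)) with (RtoC (Ropp 2)). rewrite RtoC_opp. field. auto. }
    rewrite !Cmod_mult. apply Rmult_le_compat_l. nra.
    replace (M * 3 / k ^ 4 / (1 + u) ^ 2)%R with (M * (3 / k ^ 4 / (1 + u) ^ 2))%R by (unfold Rdiv; ring).
    apply Rmult_le_compat; auto using Cmod_ge_0.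
    eapply Rle_trans. apply Cmod_triangle.
    assert (B : / (k * (1 + u)) ^ 4 <= / (k ^ 4 * (1 + u) ^ 2)).
    { apply Rinv_le_contravar. apply Rmult_lt_0_compat; auto. apply pow_lt; lra.
      rewrite Rpow_mult_distr. apply Rmult_le_compat_l. lra. apply Rle_pow. lra. lia. }
    assert (C1 : Cmod (/ (a ^ 3 * (a + h))) <= / (k * (1 + u)) ^ 4).
    { rewrite Cmod_inv, Cmod_mult, Cmod_pow by (apply Cmult_neq_0; auto; apply Cpow_nz; auto).
      apply Rinv_le_contravar. apply pow_lt; auto.
      replace ((k * (1 + u)) ^ 4)%R with ((k * (1 + u)) ^ 3 * (k * (1 + u)))%R by ring.
      apply Rmult_le_compat; try lra. apply pow_le; lra. apply pow_incr; lra. }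
    assert (C2 : Cmod (/ (a ^ 2 * (a + h) ^ 2)) <= / (k * (1 + u)) ^ 4).
    { rewrite Cmod_inv, Cmod_mult, !Cmod_pow by (apply Cmult_neq_0; apply Cpow_nz; auto).
      apply Rinv_le_contravar. apply pow_lt; auto.
      replace ((k * (1 + u)) ^ 4)%R with ((k * (1 + u)) ^ 2 * (k * (1 + u)) ^ 2)%R by ring.
      apply Rmult_le_compat; try (apply pow_le; lra); apply pow_incr; lra. }
    rewrite Cmod_mult, Cmod_R, Rabs_pos_eq by lra.
    replace (3 / k ^ 4 / (1 + u) ^ 2)%R with (3 * / (k ^ 4 * (1 + u) ^ 2))%R by (field; lra).
    lra.
Qed.

(** * Periodic extensions of polynomials *)

(** The floor of [u], meaningful for [u >= 0] only. *)
Definition nat_floor (u : R) : R := INR (Z.to_nat (Int_part u)).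
Definition periodize (p : C -> C) (u : R) : C := p (RtoC (u - nat_floor u)).

Lemma nat_floor_eq (n : nat) (u : R) : INR n <= u < INR n + 1 -> nat_floor u = INR n.
Proof.
  intros H. unfold nat_floor. f_equal.
  rewrite <- (Int_part_spec u (Z.of_nat n)). apply Nat2Z.id.
  rewrite <- INR_IZR_INZ. lra.
Qed.

Lemma nat_floor_bounds (u : R) : 0 <= u -> 0 <= u - nat_floor u < 1.
Proof.
  intros Hu. unfold nat_floor. assert (H := base_Int_part u).
  assert (P : (0 <= Int_part u)%Z).
  { apply Z.lt_succ_r. apply lt_IZR. rewrite succ_IZR. lra. }
  rewrite INR_IZR_INZ, Z2Nat.id by auto. lra.
Qed.

Lemma periodize_pw_cont (p : C -> C) : (forall x : R, 0 <= x <= 1 -> Ccont p x) -> pw_cont (periodize p).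
Proof.
  intros Hp n. exists (fun z => p (z - INR n)). split.
  - intros x Hx eps Heps. destruct (Hp (x - INR n)%R ltac:(lra) eps Heps) as [d [Hd H]]. exists d. split; auto.
    intros h Hh. specialize (H h Hh). rewrite RtoC_minus in H.
    replace (x + h - INR n) with (x - INR n + h) by ring. auto.
  - intros u Hu. unfold periodize. rewrite (nat_floor_eq n) by lra. rewrite RtoC_minus. reflexivity.
Qed.

Lemma periodize_bounded_on_pos (p : C -> C) (M : R) : (forall x : R, 0 <= x <= 1 -> Cmod (p x) <= M) -> bounded_on_pos (periodize p).
Proof.
  intros H. exists M. split.
  - eapply Rle_trans; [apply Cmod_ge_0|]. apply (H 0%R). lra.
  - intros u Hu. apply H. assert (Q := nat_floor_bounds u Hu). lra.
Qed.

Lemma periodize_int (p : C -> C) (K : R -> C) (n : nat) (l : C) :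
  is_CRInt (fun u => p (u - INR n) * K u) (INR n) (INR n + 1)%R l ->
  is_CRInt (fun u => periodize p u * K u) (INR n) (INR n + 1)%R l.
Proof.
  apply is_CRInt_ext. intros x Hx. rewrite Rmin_left, Rmax_right in Hx by lra.
  unfold periodize. rewrite (nat_floor_eq n) by lra. rewrite RtoC_minus. reflexivity.
Qed.

Lemma is_Cint_inf_Clim (f : R -> C) (l : C) : is_Cint_inf f 0 l -> Clim (fun m => CRInt f 0 (INR m)) l.
Proof.
  intros [_ H] eps Heps. destruct (H eps Heps) as [B HB].
  destruct (INR_unbounded B) as [n0 Hn]. exists n0. intros n Hle.
  apply HB. apply pos_INR. apply le_INR in Hle. lra.
Qed.

Lemma CRInt_sum (f : R -> C) (J : nat -> C) :
  (forall n, is_CRInt f (INR n) (INR n + 1)%R (J n)) ->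
  forall m, is_CRInt f 0 (INR m) (Csum 0 m J).
Proof.
  intros H. induction m as [|m IH].
  - apply (@is_RInt_point C_R_NormedModule).
  - rewrite Csum_S, S_INR. eapply is_CRInt_Chasles. exact IH. apply H.
Qed.

Lemma Stieltjes_sum (p : C -> C) (J : nat -> C) (z : C) : pw_cont (periodize p) -> bounded_on_pos (periodize p) -> slit z ->
  (forall n, is_CRInt (fun u => p (u - INR n) * / (u + z) ^ 2) (INR n) (INR n + 1)%R (J n)) ->
  Clim (fun m => Csum 0 m J) (Stieltjes (periodize p) 2 z).
Proof.
  intros Hp Hb Hs HJ.
  assert (S0 := Stieltjes_spec (periodize p) 2 z Hp Hb Hs (le_n _)).
  apply is_Cint_inf_Clim in S0. eapply Clim_ext; [|exact S0]. exists 0%nat. intros m _.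
  apply CRInt_unique. apply CRInt_sum. intros n. apply periodize_int. apply HJ.
Qed.

Definition Bern2 (x : C) : C := x * x - x + / 6.
Definition Bern3 (x : C) : C := x * x * x - 3 / 2 * (x * x) + / 2 * x.

Lemma Cder_Bern2 (z : C) : Cder Bern2 z (2 * z - 1).
Proof.
  unfold Bern2. cder_val. ring.
Qed.

Lemma Cder_Bern3 (z : C) : Cder Bern3 z (3 * Bern2 z).
Proof.
  unfold Bern3, Bern2. cder_val. field.
Qed.

Lemma Cmod_Bern2 (x : R) : 0 <= x <= 1 -> Cmod (Bern2 x) <= 2.
Proof.
  intros Hx. unfold Bern2. rewrite <- RtoC_mult, <- RtoC_minus, <- RtoC_inv, <- RtoC_plus, Cmod_R by lra.
  apply Rabs_le. nra.
Qed.

Lemma Cmod_Bern3 (x : R) : 0 <= x <= 1 -> Cmod (Bern3 x) <= 4.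
Proof.
  intros Hx. unfold Bern3.
  rewrite <- !RtoC_mult, <- RtoC_div, <- RtoC_mult, <- RtoC_minus, <- RtoC_inv, <- RtoC_mult, <- RtoC_plus, Cmod_R by lra.
  assert (0 <= x * x <= 1) by nra. assert (0 <= x * x * x <= 1) by nra.
  apply Rabs_le. lra.
Qed.

Lemma pw_cont_B2 : pw_cont (periodize Bern2).
Proof. apply periodize_pw_cont. intros z _. eapply Cder_Ccont, Cder_Bern2. Qed.
Lemma pw_cont_B3 : pw_cont (periodize Bern3).
Proof. apply periodize_pw_cont. intros z _. eapply Cder_Ccont, Cder_Bern3. Qed.
Lemma bounded_on_pos_B2 : bounded_on_pos (periodize Bern2).
Proof. apply (periodize_bounded_on_pos _ 2). apply Cmod_Bern2. Qed.
Lemma bounded_on_pos_B3 : bounded_on_pos (periodize Bern3).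
Proof. apply (periodize_bounded_on_pos _ 4). apply Cmod_Bern3. Qed.

(** * Integrals of the Bernoulli functions over one period *)

Definition dlog (a : C) : C := Clog (a + 1) - Clog a.

Lemma Cder_shift (z u : C) : Cder (fun t => t + z) u 1.
Proof. cder_val. ring. Qed.

Lemma B2_period (z : C) (n : nat) : slit z ->
  is_CRInt (fun u => Bern2 (u - INR n) * / (u + z) ^ 2) (INR n) (INR n + 1)%R
    (let a := z + INR n in 2 + / 6 * (/ a - / (a + 1)) - (2 * a + 1) * dlog a).
Proof.
  intros Hs. assert (Pn := pos_INR n). set (a := z + INR n). cbv zeta.
  assert (Na : a <> 0) by (apply slit_neq_0, slit_shift; auto).
  assert (Na1 : a + 1 <> 0) by (apply slit_neq_0, slit_shift; [apply slit_shift; auto|lra]).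
  set (F := fun u : C => (u + z) - (2 * a + 1) * Clog (u + z) - (a * a + a + / 6) * / (u + z)).
  replace (2 + / 6 * (/ a - / (a + 1)) - (2 * a + 1) * dlog a) with (F (INR n + 1)%R - F (INR n)).
  2: { unfold F, dlog. rewrite RtoC_plus.
       replace (INR n + 1 + z) with (a + 1) by (unfold a; ring).
       replace (INR n + z) with a by (unfold a; ring). field. auto. }
  apply is_CRInt_FTC; intros x Hx; rewrite Rmin_left, Rmax_right in Hx by lra.
  - assert (Sx : slit (x + z)) by (apply slit_shift_l; auto; lra).
    assert (Nx := slit_neq_0 _ Sx).
    unfold F. cder_val; auto. unfold Bern2, a. field. auto.
  - apply Rcont_mult. apply (Ccont_Rcont (fun u => Bern2 (u - INR n))). unfold Bern2. ccont.
    apply Rcont_inv_pow; auto. lra.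
Qed.

Lemma B3_period (z : C) (n : nat) : slit z ->
  is_CRInt (fun u => Bern3 (u - INR n) * / (u + z) ^ 2) (INR n) (INR n + 1)%R
    (let a := z + INR n in - (3 * a) - 3 / 2 + (3 * (a * a) + 3 * a + / 2) * dlog a).
Proof.
  intros Hs. assert (Pn := pos_INR n). set (a := z + INR n). cbv zeta.
  assert (Na : a <> 0) by (apply slit_neq_0, slit_shift; auto).
  assert (Na1 : a + 1 <> 0) by (apply slit_neq_0, slit_shift; [apply slit_shift; auto|lra]).
  set (F := fun u : C => / 2 * ((u + z) * (u + z)) - (3 * a + 3 / 2) * (u + z) +
     (3 * (a * a) + 3 * a + / 2) * Clog (u + z) + (a * a * a + 3 / 2 * (a * a) + / 2 * a) * / (u + z)).
  replace (- (3 * a) - 3 / 2 + (3 * (a * a) + 3 * a + / 2) * dlog a) with (F (INR n + 1)%R - F (INR n)).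
  2: { unfold F, dlog. rewrite RtoC_plus.
       replace (INR n + 1 + z) with (a + 1) by (unfold a; ring).
       replace (INR n + z) with a by (unfold a; ring). field. auto. }
  apply is_CRInt_FTC; intros x Hx; rewrite Rmin_left, Rmax_right in Hx by lra.
  - assert (Sx : slit (x + z)) by (apply slit_shift_l; auto; lra).
    assert (Nx := slit_neq_0 _ Sx).
    unfold F. cder_val; auto. unfold Bern3, a. field. auto.
  - apply Rcont_mult. apply (Ccont_Rcont (fun u => Bern3 (u - INR n))). unfold Bern3. ccont.
    apply Rcont_inv_pow; auto. lra.
Qed.

(** * The transforms as limits of logarithmic sums *)

Definition log_sum (z : C) (m : nat) : C := Csum 1 m (fun n => Clog (z + INR n)).
Definition nlog_sum (z : C) (m : nat) : C := Csum 1 m (fun n => INR n * Clog (z + INR n)).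

Definition qpol (a : C) : C := a * a / 2 + a / 2 + / 12.

Lemma Stieltjes_B2_lim (z : C) : slit z ->
  Clim (fun m => 2 * (INR m + 1) + / 6 * (/ z - / (z + INR m + 1))
     - (2 * (z + INR m + 1) - 1) * Clog (z + INR m + 1) + (2 * z + 1) * Clog z + 2 * log_sum z m)
   (Stieltjes (periodize Bern2) 2 z).
Proof.
  intros Hs. assert (H := Stieltjes_sum Bern2 _ z pw_cont_B2 bounded_on_pos_B2 Hs (fun n => B2_period z n Hs)).
  apply (Clim_incr _ _ 1) in H. eapply Clim_ext; [|exact H]. exists 0%nat. intros m _. cbv zeta.
  induction m as [|m IH].
  - unfold Csum, log_sum, Csum, dlog. simpl. replace (z + 0) with z by ring. ring.
  - replace (S m + 1)%nat with (S (m + 1)) by lia. rewrite Csum_S, IH.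
    unfold log_sum at 2. rewrite Csum_S. fold (log_sum z m). unfold dlog.
    replace (0 + (m + 1))%nat with (S m) by lia. replace (1 + m)%nat with (S m) by lia.
    rewrite S_INR, RtoC_plus. rewrite !Cplus_assoc. ring.
Qed.

(** The sum of the integrals over the first [m + 1] periods, rearranged by summation by parts,
    using [q(a) - q(a-1) = a]. *)
Lemma Stieltjes_B3_lim (z : C) : slit z ->
  Clim (fun m => - ((INR m + 1) * z / 2) - (INR m + 1) * (INR m + 1) / 4
     + qpol (z + INR m) * Clog (z + INR m + 1) - qpol z * Clog z - nlog_sum z m - z * log_sum z m)
   (/ 6 * Stieltjes (periodize Bern3) 2 z).
Proof.
  intros Hs. assert (H := Stieltjes_sum Bern3 _ z pw_cont_B3 bounded_on_pos_B3 Hs (fun n => B3_period z n Hs)).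
  apply (Clim_incr _ _ 1) in H. apply (Clim_scal (/ 6)) in H.
  eapply Clim_ext; [|exact H]. exists 0%nat. intros m _. cbv zeta.
  induction m as [|m IH].
  - unfold Csum, log_sum, nlog_sum, Csum, dlog, qpol. simpl. replace (z + 0) with z by ring. field.
  - replace (S m + 1)%nat with (S (m + 1)) by lia. rewrite Csum_S, Cmult_plus_distr_l, IH.
    unfold log_sum at 2. unfold nlog_sum at 2. rewrite !Csum_S. fold (log_sum z m). fold (nlog_sum z m). unfold dlog, qpol.
    replace (0 + (m + 1))%nat with (S m) by lia. replace (1 + m)%nat with (S m) by lia.
    rewrite S_INR, RtoC_plus. rewrite !Cplus_assoc. field.
Qed.

(** * Expansion of the logarithm at infinity *)

(** The derivative of the left side is [v^2/(1+v)]. *)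
Lemma Clog_1p (w : C) : Cmod w <= 1 / 2 ->
  Cmod (Clog (1 + w) - w + w * w / 2) <= 4 * Cmod w ^ 3.
Proof.
  intros Hw. assert (W0 := Cmod_ge_0 w).
  set (f := fun v => Clog (1 + v) - v + v * v / 2).
  assert (f0 : f 0 = 0).
  { unfold f. replace (1 + 0) with (RtoC 1) by ring. rewrite Clog_R, ln_1 by lra. field. }
  assert (Hv : forall t : R, 0 <= t <= 1 -> Cmod (0 + t * (w - 0)) <= Cmod w).
  { intros t Ht. replace (0 + t * (w - 0)) with (t * w) by ring.
    rewrite Cmod_mult, Cmod_R, Rabs_pos_eq by lra. nra. }
  assert (H1 : forall v, Cmod v <= Cmod w -> / 2 <= Cmod (1 + v)).
  { intros v Hv1. assert (Q := Cmod_triangle_inv' 1 v). rewrite Cmod_1 in Q. lra. }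
  assert (Q : Cmod (f w - f 0) <= 2 * (2 * Cmod w ^ 2 * Cmod (w - 0))).
  { apply (Cder_mvt_seg f (fun v => v * v / (1 + v))).
    - intros t Ht. set (v := 0 + t * (w - 0)) in *. specialize (Hv t Ht). fold v in Hv.
      assert (Sv : slit (1 + v)).
      { right. assert (Z := re_le_Cmod v). apply Rabs_le_between in Z. rewrite re_plus, re_RtoC. lra. }
      assert (Nv := slit_neq_0 _ Sv).
      unfold f. cder_val; auto using C2_neq_0. field. auto.
    - intros t Ht. set (v := 0 + t * (w - 0)) in *. specialize (Hv t Ht). fold v in Hv.
      specialize (H1 v Hv). assert (Nv : 1 + v <> 0) by (apply Cmod_gt_0; lra).
      rewrite Cmod_div, Cmod_mult by auto. assert (V0 := Cmod_ge_0 v).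
      apply Rmult_le_reg_r with (Cmod (1 + v)). lra.
      unfold Rdiv. rewrite Rmult_assoc, Rinv_l by lra.
      apply Rle_trans with (2 * Cmod w ^ 2 * / 2)%R. simpl. nra.
      apply Rmult_le_compat_l; auto. simpl. nra. }
  rewrite f0 in Q. replace (f w - 0) with (f w) in Q by ring. replace (w - 0) with w in Q by ring.
  unfold f in Q. simpl in *. lra.
Qed.

Lemma RtoC_INR_neq_0 (n : nat) : (0 < n)%nat -> RtoC (INR n) <> 0.
Proof. intros Hn. apply RtoC_neq. assert (Q := lt_0_INR n Hn). lra. Qed.

(** [log (1 + zt/m)], to be multiplied by quadratic polynomials in [m]. *)
Definition log_gap (zt : C) (m : nat) : C := Clog (zt + INR m) - ln (INR m).

Lemma lim_inv_INR (a : R) : is_lim_seq (fun n => a / INR n)%R 0.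
Proof.
  replace (Finite 0) with (Rbar_mult a 0) by (simpl; f_equal; ring).
  apply (is_lim_seq_scal_l (fun n => / INR n)%R). apply (is_lim_seq_inv INR p_infty).
  apply is_lim_seq_INR. discriminate.
Qed.

Lemma Clim_inv (a : C) : Clim (fun m => a / INR m) 0.
Proof.
  apply (Clim_squeeze0 _ (fun n => Cmod a / INR n)%R); [|apply lim_inv_INR].
  exists 1%nat. intros n Hn. assert (P : 0 < INR n) by (apply lt_0_INR; lia).
  replace (a / INR n - 0) with (a / INR n) by ring.
  rewrite Cmod_div, Cmod_R, Rabs_pos_eq by (try apply RtoC_neq; lra). lra.
Qed.

Lemma log_gap_lim2 (zt : C) : slit zt -> Clim (fun m => INR m * INR m * log_gap zt m - INR m * zt) (- (zt * zt / 2)).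
Proof.
  intros Hs.
  apply (Clim_squeeze0 _ (fun n => (4 * Cmod zt ^ 3) / INR n)%R); [|apply lim_inv_INR].
  destruct (INR_unbounded (2 * Cmod zt + 1)) as [n0 Hn0].
  exists n0. intros n Hn. assert (Z0 := Cmod_ge_0 zt).
  assert (P : 2 * Cmod zt + 1 < INR n) by (apply le_INR in Hn; lra).
  assert (NP : RtoC (INR n) <> 0) by (apply RtoC_neq; lra).
  set (w := zt / INR n).
  assert (Hw : Cmod w = (Cmod zt / INR n)%R).
  { unfold w. rewrite Cmod_div, Cmod_R, Rabs_pos_eq by (auto; lra). reflexivity. }
  assert (Hw2 : Cmod w <= 1 / 2).
  { rewrite Hw. apply Rmult_le_reg_r with (INR n). lra.
    replace (Cmod zt / INR n * INR n)%R with (Cmod zt) by (field; lra). lra. }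
  assert (E : log_gap zt n = Clog (1 + w)).
  { unfold log_gap. replace (zt + INR n) with (INR n * (1 + w)) by (unfold w; field; auto).
    rewrite Clog_scal. ring. lra.
    right. assert (Z := re_le_Cmod w). apply Rabs_le_between in Z. rewrite re_plus, re_RtoC. lra. }
  rewrite E.
  replace (INR n * INR n * Clog (1 + w) - INR n * zt - - (zt * zt / 2))
    with (INR n * INR n * (Clog (1 + w) - w + w * w / 2)) by (unfold w; field; auto).
  assert (Q := Clog_1p w Hw2).
  rewrite !Cmod_mult, Cmod_R, Rabs_pos_eq by lra.
  apply Rle_trans with (INR n * INR n * (4 * Cmod w ^ 3))%R.
  apply Rmult_le_compat_l; auto. nra.
  rewrite Hw. right. field. lra.
Qed.

Lemma log_gap_lim1 (zt : C) : slit zt -> Clim (fun m => INR m * log_gap zt m) zt.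
Proof.
  intros Hs.
  assert (H := Clim_mult _ _ _ _ (Clim_inv 1) (log_gap_lim2 zt Hs)).
  assert (H2 := Clim_plus _ _ _ _ H (Clim_const zt)).
  replace (0 * - (zt * zt / 2) + zt) with zt in H2 by ring.
  eapply Clim_ext; [|exact H2]. exists 1%nat. intros n Hn. cbv beta.
  assert (NP := RtoC_INR_neq_0 n ltac:(lia)).
  field. auto.
Qed.

Lemma log_gap_lim0 (zt : C) : slit zt -> Clim (log_gap zt) 0.
Proof.
  intros Hs.
  assert (H := Clim_mult _ _ _ _ (Clim_inv 1) (log_gap_lim1 zt Hs)).
  replace (0 * zt) with (RtoC 0) in H by ring.
  eapply Clim_ext; [|exact H]. exists 1%nat. intros n Hn. cbv beta.
  assert (NP := RtoC_INR_neq_0 n ltac:(lia)).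
  field. auto.
Qed.

(** * The logarithm of the Gamma function *)

Definition C_ln_2PI : C := RtoC (ln (2 * PI)%R).

(** Stirling's formula with the remainder as a transform of [B_2]. *)
Definition LogGamma (z : C) : C :=
  (z + / 2) * Clog z - z + C_ln_2PI / 2 + / (12 * z) - / 2 * Stieltjes (periodize Bern2) 2 z.

Lemma C12_neq_0 : RtoC 12 <> 0.
Proof. apply RtoC_neq. lra. Qed.

Lemma stirling_Clim : Clim (fun m => RtoC (ln (INR (fact m)) - (INR m + / 2) * ln (INR m) + INR m)%R - C_ln_2PI / 2) 0.
Proof.
  replace (RtoC 0) with (RtoC (ln (2 * PI) / 2) - C_ln_2PI / 2).
  apply Clim_minus; [|apply Clim_const]. apply Clim_R. apply stirling_lim.
  unfold C_ln_2PI. rewrite RtoC_div by lra. ring.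
Qed.

(** Gauss' product formula for [Gamma(z+1)] in logarithmic form. The difference between the
    finite expressions for the two sides tends to 0 by Stirling's formula for [m!] and the
    expansion of [log (1 + (z+1)/m)]. *)
Lemma Gauss_lim (z : C) : slit z ->
  Clim (fun m => z * ln (INR m) + ln (INR (fact m)) - log_sum z m) (LogGamma z).
Proof.
  intros Hs. assert (Nz := slit_neq_0 z Hs).
  assert (S1 : slit (z + 1)) by (apply slit_shift; auto; lra).
  assert (H2 := Stieltjes_B2_lim z Hs).
  assert (L0 := log_gap_lim0 _ S1). assert (L1 := log_gap_lim1 _ S1). assert (ST := stirling_Clim).
  assert (NS : forall m : nat, z + INR m + 1 <> 0).
  { intros m. apply slit_neq_0. replace (z + INR m + 1) with (z + 1 + INR m) by ring.
    apply slit_shift; auto. apply pos_INR. }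
  assert (Hinv : Clim (fun m => / (12 * (z + INR m + 1))) 0).
  (* In terms of [w = 1/m] the expression is [w / (12 (1 + w (z+1)))], which is continuous at 0. *)
  { assert (CK : Ccont (fun w => w / (12 * (1 + w * (z + 1)))) 0).
    { ccont. replace (12 * (1 + 0 * (z + 1))) with (RtoC 12) by ring. apply C12_neq_0. }
    assert (K := Clim_comp _ _ _ CK (Clim_inv 1)).
    cbv beta in K. replace (0 / (12 * (1 + 0 * (z + 1)))) with (RtoC 0) in K.
    2: { replace (12 * (1 + 0 * (z + 1))) with (RtoC 12) by ring. field. }
    eapply Clim_ext; [|exact K]. exists 1%nat. intros n Hn. cbv beta.
    assert (NP := RtoC_INR_neq_0 n ltac:(lia)).
    field. repeat split; auto; intros E; apply (NS n); rewrite <- E; ring. }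
  assert (T : Clim (fun m => (z * ln (INR m) + ln (INR (fact m)) - log_sum z m) -
     ((z + / 2) * Clog z - z + C_ln_2PI / 2 + / (12 * z) - / 2 * (2 * (INR m + 1) + / 6 * (/ z - / (z + INR m + 1))
     - (2 * (z + INR m + 1) - 1) * Clog (z + INR m + 1) + (2 * z + 1) * Clog z + 2 * log_sum z m))) 0).
  { assert (G := Clim_minus _ _ _ _ (Clim_minus _ _ _ _ (Clim_minus _ _ _ _ (Clim_plus _ _ _ _ ST (Clim_const (z + 1)))
       (Clim_scal (z + / 2) _ _ L0)) L1) Hinv).
    replace (0 + (z + 1) - (z + / 2) * 0 - (z + 1) - 0) with (RtoC 0) in G by ring.
    eapply Clim_ext; [|exact G]. exists 0%nat. intros m _. cbv beta. unfold log_gap.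
    replace (z + 1 + INR m) with (z + INR m + 1) by ring.
    rewrite RtoC_plus, RtoC_minus, RtoC_mult, RtoC_plus, RtoC_inv by lra.
    field. repeat split; auto. }
  assert (R := Clim_plus _ _ _ _ T (Clim_minus _ _ _ _ (Clim_const ((z + / 2) * Clog z - z + C_ln_2PI / 2 + / (12 * z))) (Clim_scal (/ 2) _ _ H2))).
  rewrite Cplus_0_l in R. unfold LogGamma.
  eapply Clim_ext; [|exact R]. exists 0%nat. intros m _. cbv beta. ring.
Qed.

Lemma gamma_Clim : Clim (fun m => RtoC (harmonic m) - ln (INR m)) euler_gamma.
Proof.
  assert (H := Clim_R _ _ euler_gamma_lim). eapply Clim_ext; [|exact H].
  exists 0%nat. intros m _. apply RtoC_minus.
Qed.

Lemma Csum_harmonic (a : C) (m : nat) : Csum 1 m (fun n => a / INR n) = a * harmonic m.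
Proof.
  induction m as [|m IH].
  - unfold Csum, harmonic. rewrite sum_n_m_zero by lia. simpl. unfold zero; simpl. ring.
  - rewrite Csum_S, IH. rewrite harmonic_S, RtoC_plus, RtoC_inv.
    unfold Cdiv. change (1 + m)%nat with (S m). ring.
    apply not_0_INR. lia.
Qed.

Lemma Csum_plus (f g : nat -> C) (k m : nat) :
  Csum k m (fun n => f n + g n) = Csum k m f + Csum k m g.
Proof.
  induction m as [|m IH]. unfold Csum; simpl. ring. rewrite !Csum_S, IH. ring.
Qed.

Lemma Csum_ext (f g : nat -> C) (k m : nat) :
  (forall n, (k <= n < k + m)%nat -> f n = g n) -> Csum k m f = Csum k m g.
Proof.
  intros H. induction m as [|m IH]. reflexivity.
  rewrite !Csum_S, IH, H; auto. lia. intros n Hn. apply H. lia.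
Qed.

Lemma Csum_scal (c : C) (f : nat -> C) (k m : nat) : Csum k m (fun n => c * f n) = c * Csum k m f.
Proof.
  induction m as [|m IH]. unfold Csum; simpl. ring. rewrite !Csum_S, IH. ring.
Qed.

Lemma Cprod_S (k m : nat) (f : nat -> C) : Cprod k (S m) f = Cprod k m f * f (k + m)%nat.
Proof.
  revert k. induction m as [|m IH]; intros k.
  - unfold Cprod; simpl. rewrite Nat.add_0_r. ring.
  - assert (E : forall m l, Cprod m (S l) f = f m * Cprod (S m) l f) by reflexivity.
    rewrite E, IH, E. replace (S k + m)%nat with (k + S m)%nat by lia. ring.
Qed.

Lemma Cprod_Cexp (f g : nat -> C) (k m : nat) :
  (forall n, (k <= n < k + m)%nat -> f n = Cexp (g n)) -> Cprod k m f = Cexp (Csum k m g).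
Proof.
  intros H. induction m as [|m IH].
  - unfold Cprod, Csum; simpl. symmetry. apply Cexp_0.
  - rewrite Cprod_S, Csum_S, Cexp_plus, IH, <- H; auto. lia. intros n Hn. apply H. lia.
Qed.

Lemma Csum_ln (m : nat) : Csum 1 m (fun n => RtoC (ln (INR n))) = ln (INR (fact m)).
Proof.
  induction m as [|m IH].
  - unfold Csum; simpl. rewrite ln_1. reflexivity.
  - rewrite Csum_S, IH, fact_simpl, mult_INR, ln_mult, RtoC_plus.
    change (1 + m)%nat with (S m). ring. apply lt_0_INR; lia. apply INR_fact_lt_0.
Qed.

Lemma Csum_shift (f : nat -> C) (k m : nat) : Csum (S k) m f = Csum k m (fun n => f (S n)).
Proof.
  induction m as [|m IH]. reflexivity. rewrite !Csum_S, IH. reflexivity.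
Qed.

Lemma Clog_1p_div (z : C) (n : nat) : (0 < n)%nat -> slit (z + INR n) ->
  slit (1 + z / INR n) /\ Clog (1 + z / INR n) = Clog (z + INR n) - ln (INR n).
Proof.
  intros Hn Hs. assert (N := RtoC_INR_neq_0 n Hn). assert (P := lt_0_INR n Hn).
  assert (Hi : slit (1 + z / INR n)).
  { replace (1 + z / INR n) with (RtoC (/ INR n) * (z + INR n)).
    apply slit_scal; auto. apply Rinv_0_lt_compat; auto.
    rewrite RtoC_inv by lra. field. auto. }
  split; auto.
  replace (z + INR n) with (INR n * (1 + z / INR n)) by (field; auto).
  rewrite Clog_scal by auto. ring.
Qed.

Lemma Cexp_LogGamma (z : C) : slit z -> Cexp (LogGamma z) = Gamma (z + 1).
Proof.
  intros Hs. assert (S1 : slit (z + 1)) by (apply slit_shift; auto; lra).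
  assert (N1 := slit_neq_0 _ S1).
  set (e := fun m => Csum 1 m (fun n => - (Clog (z + 1 + INR n) - ln (INR n)) + (z + 1) / INR n)).
  assert (He : Clim e (LogGamma z + euler_gamma * (z + 1) + Clog (z + 1))).
  { assert (H := Clim_minus _ _ _ _ (Clim_plus _ _ _ _ (Gauss_lim z Hs) (Clim_scal (z + 1) _ _ gamma_Clim)) (log_gap_lim0 _ S1)).
    assert (H2 := Clim_plus _ _ _ _ H (Clim_const (Clog (z + 1)))).
    replace (LogGamma z + euler_gamma * (z + 1) + Clog (z + 1)) with (LogGamma z + (z + 1) * euler_gamma - 0 + Clog (z + 1)) by ring.
    eapply Clim_ext; [|exact H2]. exists 0%nat. intros m _. cbv beta. unfold e.
    rewrite (Csum_plus (fun n => - (Clog (z + 1 + INR n) - ln (INR n)))).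
    rewrite (Csum_ext (fun n => - (Clog (z + 1 + INR n) - ln (INR n)))
       (fun n => - (1) * Clog (z + 1 + INR n) + ln (INR n))) by (intros; ring).
    rewrite Csum_plus, Csum_scal, Csum_ln, Csum_harmonic.
    assert (EA : Csum 1 m (fun n => Clog (z + 1 + INR n)) = log_sum z m + Clog (z + 1 + INR m) - Clog (z + 1)).
    { unfold log_sum. clear. induction m as [|m IH].
      - unfold Csum; simpl. replace (z + 1 + 0) with (z + 1) by ring. ring.
      - rewrite !Csum_S, IH. change (1 + m)%nat with (S m). rewrite !S_INR, !RtoC_plus.
        replace (z + 1 + INR m) with (z + (INR m + 1)) by ring. ring. }
    rewrite EA. unfold log_gap. ring. }
  unfold Gamma.
  rewrite (Clim_Clim_seq _ (Cexp (LogGamma z + euler_gamma * (z + 1) + Clog (z + 1)))).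
  - rewrite !Cexp_plus, Cexp_opp, Cexp_Clog by auto. field. repeat split; auto using Cexp_neq_0.
  - eapply Clim_ext; [|apply (Clim_comp Cexp); [eapply Cder_Ccont, Cder_Cexp | exact He]].
    exists 0%nat. intros m _. cbv beta. unfold e. symmetry. apply Cprod_Cexp. intros n Hn.
    destruct (Clog_1p_div (z + 1) n) as [A B]. lia. apply slit_shift; auto. apply pos_INR.
    rewrite <- B, Cexp_plus, Cexp_opp, Cexp_Clog. reflexivity. apply slit_neq_0; auto.
Qed.

Lemma Cder_LogGamma (z : C) : slit z -> exists l, Cder LogGamma z l.
Proof.
  intros Hs. assert (Nz := slit_neq_0 z Hs). assert (D := Stieltjes_der _ z pw_cont_B2 bounded_on_pos_B2 Hs).
  eexists. unfold LogGamma. cder; auto using C12_neq_0, Cmult_neq_0.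
Qed.

Lemma Clim_Im_0 (u : nat -> C) (l : C) : Clim u l -> (forall n, Im (u n) = 0%R) -> Im l = 0%R.
Proof.
  intros H E. apply Clim_Im in H. apply (is_lim_seq_ext _ (fun _ => 0%R)) in H; auto.
  apply is_lim_seq_unique in H. rewrite Lim_seq_const in H. injection H as H. auto.
Qed.

Lemma Im_log_sum (x : R) (m : nat) : 0 < x -> Im (log_sum x m) = 0%R.
Proof.
  intros Hx. unfold log_sum. induction m as [|m IH]. reflexivity.
  rewrite Csum_S, im_plus, IH, <- RtoC_plus, Clog_R. simpl; ring.
  assert (Q := pos_INR (1 + m)). lra.
Qed.

Lemma Im_nlog_sum (x : R) (m : nat) : 0 < x -> Im (nlog_sum x m) = 0%R.
Proof.
  intros Hx. unfold nlog_sum. induction m as [|m IH]. reflexivity.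
  rewrite Csum_S, im_plus, IH, <- RtoC_plus, Clog_R, im_scal_l. simpl; ring.
  assert (Q := pos_INR (1 + m)). lra.
Qed.

Lemma Im_LogGamma (x : R) : 0 < x -> Im (LogGamma x) = 0%R.
Proof.
  intros Hx. eapply Clim_Im_0. apply Gauss_lim. right; auto.
  intros m. cbv beta. rewrite Im_minus, Im_log_sum, im_plus, im_scal_l by auto. simpl. ring.
Qed.

Theorem logGamma1p_eq (z : C) : slit z -> logGamma1p z = LogGamma z.
Proof.
  apply (log_branch_eq (fun z => Gamma (z + 1)) LogGamma).
  apply Cder_LogGamma. apply Cexp_LogGamma. apply Im_LogGamma.
Qed.

(** * The logarithm of the Barnes function *)

(** The function [S] through which both sides of the expansion are computed. *)
Definition barnes_rem (z : C) : C := / 6 * Stieltjes (periodize Bern3) 2 z.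
(** The constant for which [LogBarnes] is the logarithm of the Barnes function; it is identified
    with the Glaisher-Kinkelin constant at the end. *)
Definition glaisher_const : C := / 4 - barnes_rem 1.

Definition LogBarnes (z : C) : C :=
  z * z / 4 + z * LogGamma z - qpol z * Clog z - glaisher_const - barnes_rem z.

Definition nlogn_sum (m : nat) : C := Csum 1 m (fun n => RtoC (INR n * ln (INR n))).

Lemma slit_1 : slit 1.
Proof. right; simpl; lra. Qed.

Lemma qpol_log_gap_lim (z : C) (zt : C) : slit zt ->
  Clim (fun m => qpol (z + INR m) * log_gap zt m - INR m * zt / 2) ((z + / 2) * zt - zt * zt / 4).
Proof.
  intros Hs.
  assert (H := Clim_plus _ _ _ _ (Clim_plus _ _ _ _ (Clim_scal (/ 2) _ _ (log_gap_lim2 zt Hs))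
     (Clim_scal (z + / 2) _ _ (log_gap_lim1 zt Hs))) (Clim_scal (qpol z) _ _ (log_gap_lim0 zt Hs))).
  replace ((z + / 2) * zt - zt * zt / 4) with (/ 2 * - (zt * zt / 2) + (z + / 2) * zt + qpol z * 0) by field.
  eapply Clim_ext; [|exact H]. exists 0%nat. intros m _. cbv beta. unfold qpol. field.
Qed.

(** The classical definition of the Glaisher-Kinkelin constant by the hyperfactorial, obtained
    from [Stieltjes_B3_lim] at [z = 1]; there the two logarithmic sums combine into the sum of
    [n log n] over [n <= m + 1]. *)
Lemma glaisher_const_lim : Clim (fun m => nlogn_sum m - qpol (INR m) * ln (INR m) + INR m * INR m / 4) glaisher_const.
Proof.
  assert (H := Stieltjes_B3_lim 1 slit_1). fold (barnes_rem 1) in H.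
  assert (Q := qpol_log_gap_lim 0 1 slit_1).
  assert (Q2 : Clim (fun m => qpol (0 + INR (m + 1)) * log_gap 1 (m + 1) - INR (m + 1) * 1 / 2) ((0 + / 2) * 1 - 1 * 1 / 4)).
  { apply (Clim_incr (fun m => qpol (0 + INR m) * log_gap 1 m - INR m * 1 / 2)). exact Q. }
  assert (G := Clim_minus _ _ _ _ Q2 H).
  replace ((0 + / 2) * 1 - 1 * 1 / 4 - barnes_rem 1) with glaisher_const in G by (unfold glaisher_const; field).
  assert (Sh : Clim (fun m => nlogn_sum (m + 1) - qpol (INR (m + 1)) * ln (INR (m + 1)) + INR (m + 1) * INR (m + 1) / 4) glaisher_const).
  { eapply Clim_ext; [|exact G]. exists 0%nat. intros m _. cbv beta.
    assert (EN : nlog_sum 1 m + 1 * log_sum 1 m = nlogn_sum (m + 1)).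
    { unfold nlog_sum, log_sum, nlogn_sum. clear. rewrite Nat.add_1_r. induction m as [|m IH].
      - unfold Csum; simpl. rewrite ln_1, RtoC_mult. ring.
      - rewrite (Csum_S 1 (S m)), <- IH, !Csum_S. change (1 + m)%nat with (S m). change (1 + S m)%nat with (S (S m)).
        rewrite RtoC_mult, (S_INR (S m)), <- (RtoC_plus 1), Clog_R, (Rplus_comm 1).
        rewrite RtoC_plus. ring. assert (P := pos_INR (S m)). lra. }
    rewrite <- EN. unfold log_gap. rewrite Nat.add_1_r, S_INR.
    replace (1 + INR m + 1) with (1 + (INR m + 1)%R) by (rewrite RtoC_plus; ring).
    rewrite (Clog_R 1), ln_1 by lra. rewrite RtoC_plus. unfold qpol. field. }
  apply Clim_decr. eapply Clim_ext; [|exact Sh]. exists 0%nat. intros m _. rewrite Nat.add_1_r. reflexivity.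
Qed.

(** The partial logarithm [e m] of the Weierstrass product is a combination of the finite
    expressions that converge to log Gamma, to [S], to [glaisher_const], to [euler_gamma] and to
    Stirling's constant. The rest of the proof is the identity between these finite expressions,
    polynomial in the logarithms. *)
Lemma Cexp_LogBarnes (z : C) : slit z -> Cexp (LogBarnes z) = BarnesG (z + 1).
Proof.
  intros Hs. assert (S1 : slit (z + 1)) by (apply slit_shift; auto; lra).
  unfold BarnesG. replace (z + 1 - 1) with z by ring. cbv zeta.
  set (e := fun m => Csum 1 m (fun n => INR n * (Clog (z + INR n) - ln (INR n)) + (- z + z ^ 2 / (2 * INR n)))).
  set (base := z / 2 * C_ln_2PI - (z * (z + 1) + euler_gamma * z ^ 2) / 2).
  assert (He : Clim e (LogBarnes z - base)).
  { assert (EE : forall m, e m = nlog_sum z m - nlogn_sum m - INR m * z + z * z / 2 * harmonic m).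
    { intros m. unfold e. rewrite (Csum_ext _ (fun n => (INR n * Clog (z + INR n) + - (1) * (RtoC (INR n * ln (INR n)))) + (- z + (z * z / 2) / INR n))).
      2: { intros n Hn. rewrite RtoC_mult. simpl. field. apply RtoC_INR_neq_0. lia. }
      rewrite !Csum_plus, Csum_scal, Csum_harmonic. fold (nlog_sum z m). fold (nlogn_sum m).
      replace (Csum 1 m (fun _ => - z)) with (- (INR m * z)). ring.
      clear. induction m as [|m IH]. unfold Csum; simpl. ring.
      rewrite Csum_S, <- IH, S_INR, RtoC_plus. ring. }
    assert (HG := Gauss_lim z Hs). assert (H3 := Stieltjes_B3_lim z Hs). fold (barnes_rem z) in H3.
    assert (HA := glaisher_const_lim). assert (HE := gamma_Clim). assert (HQ := qpol_log_gap_lim z (z + 1) S1).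
    assert (HST := stirling_Clim).
    assert (HL := Clim_minus _ _ _ _ (Clim_plus _ _ _ _ (Clim_const (z * z / 4 - qpol z * Clog z)) (Clim_scal z _ _ HG)) H3).
    assert (HD := Clim_plus _ _ _ _ (Clim_minus _ _ _ _ (Clim_plus _ _ _ _ (Clim_minus _ _ _ _ (Clim_scal (z * z / 2) _ _ HE)
        (Clim_scal z _ _ HST)) HQ) HA) HL).
    (* The constant by which the sum of the limits differs from [LogBarnes z - base]. *)
    set (K := z * (z + 1) / 2 - z / 2 * C_ln_2PI - 3 * (z * z) / 4 - z - / 4).
    assert (HF := Clim_plus _ _ _ _ HD (Clim_const K)).
    match type of HF with Clim _ ?l => replace (LogBarnes z - base) with l end.
    2: { unfold LogBarnes, base, K. simpl. field. }
    unfold K in HF.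
    eapply Clim_ext; [|exact HF]. exists 0%nat. intros m _. cbv beta. rewrite EE. unfold log_gap, qpol.
    replace (z + 1 + INR m) with (z + INR m + 1) by ring.
    rewrite RtoC_plus, RtoC_minus, RtoC_mult, RtoC_plus, RtoC_inv by lra.
    field. }
  rewrite (Clim_Clim_seq _ (Cexp (LogBarnes z - base))).
  - rewrite <- !Cexp_plus. f_equal. unfold base. fold C_ln_2PI. field.
  - eapply Clim_ext; [|apply (Clim_comp Cexp); [eapply Cder_Ccont, Cder_Cexp | exact He]].
    exists 0%nat. intros m _. cbv beta. unfold e. symmetry. apply Cprod_Cexp. intros n Hn.
    destruct (Clog_1p_div z n) as [A B]. lia. apply slit_shift; auto. apply pos_INR.
    rewrite <- B, (Cexp_plus (INR n * _)), Cexp_pow, Cexp_Clog. reflexivity. apply slit_neq_0; auto.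
Qed.

Lemma Cder_barnes_rem (z : C) : slit z -> exists l, Cder barnes_rem z l.
Proof.
  intros Hs. eexists. unfold barnes_rem. apply Cder_scal. apply Stieltjes_der; auto using pw_cont_B3, bounded_on_pos_B3.
Qed.

Lemma Cder_LogBarnes (z : C) : slit z -> exists l, Cder LogBarnes z l.
Proof.
  intros Hs. destruct (Cder_LogGamma z Hs) as [l1 H1]. destruct (Cder_barnes_rem z Hs) as [l2 H2].
  eexists. unfold LogBarnes, qpol, Cdiv. cder; auto.
Qed.

Lemma Im_barnes_rem (x : R) : 0 < x -> Im (barnes_rem x) = 0%R.
Proof.
  intros Hx. eapply Clim_Im_0. apply Stieltjes_B3_lim. right; auto.
  intros m. cbv beta. unfold qpol.
  rewrite <- !RtoC_plus, !Clog_R by (assert (Q := pos_INR m); lra).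
  rewrite !Im_minus, im_plus, Im_minus, Im_nlog_sum, im_scal_l, Im_log_sum by auto.
  rewrite <- !RtoC_mult, <- !RtoC_div, <- !RtoC_inv, <- !RtoC_plus, <- !RtoC_mult, <- ?RtoC_opp by lra.
  rewrite ?im_opp, ?im_RtoC. ring.
Qed.

Lemma Im_LogBarnes (x : R) : 0 < x -> Im (LogBarnes x) = 0%R.
Proof.
  intros Hx. unfold LogBarnes, glaisher_const. rewrite !Im_minus, im_plus, im_scal_l, Im_LogGamma, Im_barnes_rem, Im_barnes_rem by lra.
  unfold qpol. rewrite Clog_R by auto.
  rewrite <- !RtoC_mult, <- !RtoC_div, <- !RtoC_inv, <- !RtoC_plus, <- !RtoC_mult by lra.
  rewrite !im_RtoC. ring.
Qed.

Theorem logBarnesG1p_eq (z : C) : slit z -> logBarnesG1p z = LogBarnes z.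
Proof.
  apply (log_branch_eq (fun z => BarnesG (z + 1)) LogBarnes).
  apply Cder_LogBarnes. apply Cexp_LogBarnes. apply Im_LogBarnes.
Qed.

(** * The exponential integral *)

Lemma exp_mono (x y : R) : x <= y -> exp x <= exp y.
Proof. intros [H| ->]. left. apply exp_increasing; auto. apply Rle_refl. Qed.

Definition exp_decay (c : C) (u : R) : C := Cexp (- (c * u)).
(** The integral of [e^(-cu)/(u+z)] over [u > 0], integrated by parts once: this form converges
    absolutely, and is analytic on the whole cut plane, also for imaginary [c]. *)
Definition expint (c z : C) : C := / c * (/ z - Stieltjes (exp_decay c) 2 z).

Lemma pw_cont_exp_decay (c : C) : pw_cont (exp_decay c).
Proof.
  apply (pw_cont_cont (fun v => Cexp (- (c * v)))). intros z. ccont.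
Qed.

Lemma Cmod_exp_decay (c : C) (u : R) : 0 <= Re c -> 0 <= u -> Cmod (exp_decay c u) <= 1.
Proof.
  intros Hc Hu. unfold exp_decay. rewrite Cmod_Cexp, re_opp, re_scal_r.
  rewrite <- exp_0. apply exp_mono. nra.
Qed.

Lemma bounded_on_pos_exp_decay (c : C) : 0 <= Re c -> bounded_on_pos (exp_decay c).
Proof. intros Hc. exists 1%R. split. lra. intros u Hu. apply Cmod_exp_decay; auto. Qed.

Lemma exp_decay_decay (c z : C) (n : nat) : 0 <= Re c -> slit z -> (0 < n)%nat ->
  forall eps, 0 < eps -> exists B, forall b : R, 0 <= b -> B <= b ->
    Cmod (exp_decay c b * / (b + z) ^ n) <= eps.
Proof.
  intros Hc Hs Hn eps Heps. destruct (slit_lower z Hs) as [k [Hk H]].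
  assert (Hzz : Cmod (z - z) <= k) by (rewrite Cmod_diag; lra).
  set (e := Rmin 1 eps). assert (He : 0 < e) by (apply Rmin_glb_lt; lra).
  exists (/ (k * e))%R. intros b Hb Hb2. specialize (H z Hzz b Hb).
  assert (Q : 0 < k * (1 + b)) by (apply Rmult_lt_0_compat; lra).
  assert (Nb : b + z <> 0) by (apply Cmod_gt_0; lra).
  assert (Hm : / e <= Cmod (b + z)).
  { eapply Rle_trans; [|apply H]. apply Rmult_le_compat_l with (r := k) in Hb2; [|lra].
    replace (k * / (k * e))%R with (/ e)%R in Hb2 by (field; lra). nra. }
  assert (He1 : 1 <= / e). { rewrite <- Rinv_1. apply Rinv_le_contravar; auto. apply Rmin_l. }
  rewrite Cmod_mult, Cmod_inv, Cmod_pow by (apply Cpow_nz; auto).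
  apply Rle_trans with (1 * / (/ e))%R.
  - apply Rmult_le_compat. apply Cmod_ge_0. left. apply Rinv_0_lt_compat, pow_lt. lra.
    apply Cmod_exp_decay; auto. apply Rinv_le_contravar. lra.
    destruct n as [|n]. lia. simpl. assert (1 <= Cmod (b + z) ^ n) by (apply pow_R1_Rle; lra). nra.
  - rewrite Rinv_inv, Rmult_1_l. apply Rmin_r.
Qed.

Lemma Cpow_2 (z : C) : z ^ 2 = z * z.
Proof. simpl. ring. Qed.

Lemma exp_decay_parts (c z : C) (n : nat) : 0 <= Re c -> c <> 0 -> slit z -> (0 < n)%nat ->
  is_Cint_inf (fun u => exp_decay c u * / (u + z) ^ n + INR n / c * (exp_decay c u * / (u + z) ^ (S n))) 0 (/ (c * z ^ n)).
Proof.
  intros Hc Hc0 Hs Hn.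
  assert (Nz := slit_neq_0 z Hs).
  replace (/ (c * z ^ n)) with (0 - (fun u : C => - (/ c) * (Cexp (- (c * u)) * / (u + z) ^ n)) 0%R).
  2: { rewrite Cmult_0_r, Copp_0, Cexp_0, Cplus_0_l. field. split; auto. apply Cpow_nz; auto. }
  apply (is_Cint_inf_FTC (fun u : C => - (/ c) * (Cexp (- (c * u)) * / (u + z) ^ n))).
  - intros u Hu. assert (N := slit_neq_0 _ (slit_shift_l z u Hs Hu)).
    assert (Np := Cpow_nz _ n N). cder_val; auto.
    unfold exp_decay. destruct n as [|n]. lia. cbn [pred]. rewrite (Cpow_S _ (S n)), (Cpow_S _ n). field.
    repeat split; auto using Cpow_nz.
  - intros u Hu. assert (N := slit_neq_0 _ (slit_shift_l z u Hs Hu)).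
    apply (Ccont_Rcont (fun u => Cexp (- (c * u)) * / (u + z) ^ n + INR n / c * (Cexp (- (c * u)) * / (u + z) ^ S n))).
    ccont; apply Cpow_nz; auto.
  - intros eps Heps. assert (Pc := proj1 (Cmod_gt_0 c) Hc0).
    destruct (exp_decay_decay c z n Hc Hs Hn (eps * Cmod c)%R) as [B HB]. apply Rmult_lt_0_compat; auto.
    exists B. intros b Hb Hb2. specialize (HB b Hb Hb2).
    rewrite Cminus_0_r.
    rewrite Cmod_mult, Cmod_opp, Cmod_inv by auto. unfold exp_decay in HB.
    apply Rmult_le_reg_l with (Cmod c); auto.
    rewrite <- Rmult_assoc, Rinv_r by lra. lra.
Qed.

Lemma expint_der (c z : C) : 0 <= Re c -> c <> 0 -> slit z ->
  Cder (expint c) z (c * expint c z - / z).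
Proof.
  intros Hc Hc0 Hs. assert (Nz := slit_neq_0 z Hs).
  assert (B := bounded_on_pos_exp_decay c Hc). assert (P := pw_cont_exp_decay c).
  assert (S2 := Stieltjes_spec _ 2 z P B Hs (le_n _)).
  assert (S3 := Stieltjes_spec _ 3 z P B Hs ltac:(lia)).
  assert (U := is_Cint_inf_plus _ _ _ _ _ S2 (is_Cint_inf_scal (INR 2 / c) _ _ _ S3)).
  assert (E := is_Cint_inf_unique _ _ _ _ U (exp_decay_parts c z 2 Hc Hc0 Hs ltac:(lia))).
  assert (DS := Stieltjes_der _ z P B Hs). unfold expint. cder_val; auto.
  replace (Stieltjes (exp_decay c) 2 z) with (/ (c * z ^ 2) - INR 2 / c * Stieltjes (exp_decay c) 3 z) by (rewrite <- E; ring).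
  replace (RtoC (INR 2)) with (RtoC 2) by (f_equal; simpl; ring).
  change (RtoC (-2)) with (RtoC (Ropp 2)). rewrite ?RtoC_opp. simpl. field. auto.
Qed.

Lemma expint_1 (w : C) : slit w -> is_Cint_inf (fun t => exp_decay 1 t * / (t + w) ^ 1) 0 (expint 1 w).
Proof.
  intros Hs. assert (H1 : 0 <= Re 1) by (simpl; lra).
  assert (N1 : RtoC 1 <> 0) by (apply C1_nz).
  assert (S2 := Stieltjes_spec _ 2 w (pw_cont_exp_decay 1) (bounded_on_pos_exp_decay 1 H1) Hs (le_n _)).
  assert (U := is_Cint_inf_minus _ _ _ _ _ (exp_decay_parts 1 w 1 H1 N1 Hs (le_n _)) S2).
  assert (Nw := slit_neq_0 w Hs).
  replace (expint 1 w) with (/ (1 * w ^ 1) - Stieltjes (exp_decay 1) 2 w) by (unfold expint; simpl; field; auto).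
  eapply is_Cint_inf_ext; [|exact U]. intros u _. cbv beta. change (INR 1) with 1%R.
  replace (RtoC 1 / RtoC 1) with (RtoC 1) by field. ring.
Qed.

Lemma Stieltjes_exp_decay_bound (c z : C) (K y : R) : 0 <= Re c -> slit z -> 0 <= K -> 0 < y ->
  (forall u : R, 0 <= u -> (y + u) ^ 2 <= K * Cmod (u + z) ^ 2)%R -> Cmod (Stieltjes (exp_decay c) 2 z) <= K / y.
Proof.
  intros Hc Hs HK Hy H.
  assert (S2 := Stieltjes_spec _ 2 z (pw_cont_exp_decay c) (bounded_on_pos_exp_decay c Hc) Hs (le_n _)).
  assert (Q := is_Cint_inf_bound (fun u => exp_decay c u * / (u + z) ^ 2) _ _ _ _ (Stieltjes (exp_decay c) 2 z) (dominating_shift y K Hy HK)).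
  replace (K / y)%R with (0 - - (K / (y + 0)))%R by (field; lra). apply Q; auto.
  intros u Hu. assert (N := slit_neq_0 _ (slit_shift_l z u Hs Hu)).
  assert (P := proj1 (Cmod_gt_0 _) N). assert (P2 : 0 < Cmod (u + z) ^ 2) by (apply pow_lt; auto).
  assert (P3 : 0 < (y + u) ^ 2) by (apply pow_lt; lra).
  rewrite Cmod_mult, Cmod_inv, Cmod_pow by (apply Cpow_nz; auto).
  apply Rle_trans with (1 * / Cmod (u + z) ^ 2)%R.
  apply Rmult_le_compat_r. left; apply Rinv_0_lt_compat; auto. apply Cmod_exp_decay; auto.
  apply Rmult_le_reg_r with (Cmod (u + z) ^ 2 * (y + u) ^ 2)%R. apply Rmult_lt_0_compat; auto.
  replace (1 * / Cmod (u + z) ^ 2 * (Cmod (u + z) ^ 2 * (y + u) ^ 2))%R with ((y + u) ^ 2)%R by (field; lra).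
  replace (K / (y + u) ^ 2 * (Cmod (u + z) ^ 2 * (y + u) ^ 2))%R with (K * Cmod (u + z) ^ 2)%R by (field; lra).
  auto.
Qed.

Lemma slit_Ci_mult (om : R) (z : C) : om <> 0%R -> 0 < Re z -> slit (Ci * om * z).
Proof.
  intros Ho Hz. left. replace (Im (Ci * om * z)) with (om * Re z)%R by (unfold Im, Re; simpl; ring).
  apply Rmult_integral_contrapositive; split; auto; lra.
Qed.

(** The rotation of the contour. Both sides solve [y' = c y - 1/z] on the right half plane, so
    their difference is a multiple of [e^(cz)], of constant modulus along the positive axis.
    Both are [O(1/x)] there, so it is 0. *)
Lemma expint_rotate (om : R) (z : C) : om <> 0%R -> 0 < Re z ->
  expint (Ci * om) z = expint 1 (Ci * om * z).
Proof.
  intros Ho Hz. set (c := Ci * om).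
  assert (Nom := RtoC_neq om Ho).
  assert (Nc : c <> 0) by (apply Cmult_neq_0; auto; apply Ci_nz).
  assert (Rc : 0 <= Re c) by (unfold c; simpl; lra).
  assert (R1 : 0 <= Re 1) by (simpl; lra).
  assert (Mc : Cmod c = Rabs om) by (unfold c; rewrite Cmod_mult, Cmod_Ci, Cmod_R; ring).
  assert (Pom := Rabs_pos_lt om Ho).
  set (d := fun v => (expint c v - expint 1 (c * v)) * Cexp (- (c * v))).
  assert (Dd : forall v, 0 < Re v -> Cder d v 0).
  { intros v Hv. assert (Sv : slit v) by (right; auto). assert (Scv := slit_Ci_mult om v Ho Hv). fold c in Scv.
    assert (Nv := slit_neq_0 v Sv).
    assert (fourier_rem1 := expint_der c v Rc Nc Sv).
    assert (fourier_rem2 := Cder_comp (expint 1) (fun v => c * v) v _ _ ltac:(cder) (expint_der 1 (c * v) R1 C1_nz Scv)).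
    unfold d. cder_val. field. auto. }
  assert (Hx : forall x : R, 0 < x -> Cmod (d z) <= 5 / Rabs om / x).
  { intros x Hx. assert (Sx : slit x) by (right; auto).
    assert (Scx := slit_Ci_mult om x Ho Hx). fold c in Scx.
    assert (Nx := slit_neq_0 x Sx). assert (Ncx := slit_neq_0 _ Scx).
    rewrite (Cder_zero_const d x z).
    2: { intros t Ht. apply Dd. rewrite re_plus, re_scal_l, Re_minus, re_RtoC. nra. }
    unfold d. rewrite Cmod_mult, Cmod_Cexp.
    replace (Re (- (c * x))) with 0%R by (unfold c; simpl; ring). rewrite exp_0, Rmult_1_r.
    eapply Rle_trans. apply Cmod_minus_le.
    assert (B1 : Cmod (expint c x) <= 2 / Rabs om / x).
    { unfold expint. rewrite Cmod_mult, Cmod_inv, Mc by auto.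
      assert (Q : Cmod (Stieltjes (exp_decay c) 2 x) <= 1 / x).
      { apply Stieltjes_exp_decay_bound; auto; try lra. intros u Hu. rewrite <- RtoC_plus, Cmod_R, Rabs_pos_eq; lra. }
      assert (Q2 : Cmod (/ x - Stieltjes (exp_decay c) 2 x) <= 2 / x).
      { eapply Rle_trans. apply Cmod_minus_le. rewrite Cmod_inv, Cmod_R, Rabs_pos_eq by (auto; lra).
        replace (2 / x)%R with (/ x + 1 / x)%R by (field; lra). lra. }
      replace (2 / Rabs om / x)%R with (/ Rabs om * (2 / x))%R by (field; lra).
      apply Rmult_le_compat_l; auto. left; apply Rinv_0_lt_compat; auto. }
    assert (B2 : Cmod (expint 1 (c * x)) <= 3 / Rabs om / x).
    { unfold expint. replace (/ 1) with (RtoC 1) by field. rewrite Cmult_1_l.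
      assert (Py : 0 < Rabs om * x) by (apply Rmult_lt_0_compat; auto).
      assert (Q : Cmod (Stieltjes (exp_decay 1) 2 (c * x)) <= 2 / (Rabs om * x)).
      { apply Stieltjes_exp_decay_bound; auto; try lra. intros u Hu.
        rewrite Cmod2_alt.
        replace (Re (u + c * x)) with u by (unfold c; simpl; ring).
        replace (Im (u + c * x)) with (om * x)%R by (unfold c; simpl; ring).
        assert (E : ((om * x) ^ 2 = (Rabs om * x) ^ 2)%R) by (rewrite !Rpow_mult_distr, pow2_abs; reflexivity).
        rewrite E. assert (Q0 := pow2_ge_0 (u - Rabs om * x)). simpl in Q0 |- *. nra. }
      eapply Rle_trans. apply Cmod_minus_le. rewrite Cmod_inv, Cmod_mult, Mc, Cmod_R, (Rabs_pos_eq x) by (auto; lra).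
      replace (3 / Rabs om / x)%R with (/ (Rabs om * x) + 2 / (Rabs om * x))%R by (field; lra). lra. }
    replace (5 / Rabs om / x)%R with (2 / Rabs om / x + 3 / Rabs om / x)%R by (field; lra). lra. }
  assert (Dz : d z = 0).
  { apply Cmod_eq_0. apply Rle_antisym; [|apply Cmod_ge_0]. apply le_epsilon. intros eps Heps.
    rewrite Rplus_0_l. eapply Rle_trans. apply (Hx (5 / Rabs om / eps)%R).
    apply Rdiv_lt_0_compat; auto. apply Rdiv_lt_0_compat; lra. right. field. lra. }
  unfold d in Dz. assert (Ne := Cexp_neq_0 (- (c * z))).
  replace (expint c z) with ((expint c z - expint 1 (c * z)) * Cexp (- (c * z)) / Cexp (- (c * z)) + expint 1 (c * z)) by (field; auto).
  rewrite Dz. field. auto.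
Qed.

(** * The terminant and its continuation *)

Lemma exp_pow_le (n : nat) (t : R) : 0 <= t -> (t ^ n <= INR (fact n) * exp t)%R.
Proof.
  revert t. induction n as [|n IH]; intros t Ht.
  - simpl. assert (Q := exp_ineq1_le t). lra.
  - assert (Q := monotone_der (fun s => INR (fact (S n)) * exp s - s ^ S n)%R
       (fun s => INR (fact (S n)) * exp s - INR (S n) * s ^ n)%R 0 t Ht). cbv beta in Q.
    assert (F := INR_fact_lt_0 (S n)).
    assert (0 <= INR (fact (S n)) * exp 0 - 0 ^ S n)%R.
    { rewrite exp_0, pow_i by lia. lra. }
    assert (INR (fact (S n)) * exp 0 - 0 ^ S n <= INR (fact (S n)) * exp t - t ^ S n)%R.
    { apply Q.
      - intros x Hx. auto_derive; auto. rewrite S_INR. simpl. destruct n; simpl; ring.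
      - intros x Hx. rewrite fact_simpl, mult_INR, Rmult_assoc, <- Rmult_minus_distr_l.
        apply Rmult_le_pos. apply pos_INR. specialize (IH x ltac:(lra)). lra. }
    lra.
Qed.

Lemma Gamma_int (n : nat) : is_Cint_inf (fun t => RtoC t ^ n * exp_decay 1 t) 0 (INR (fact n)).
Proof.
  assert (Dt : forall (k : nat) (u : C), Cder (fun t => t ^ k * Cexp (- (1 * t))) u
     (INR k * u ^ (pred k) * 1 * Cexp (- (1 * u)) + u ^ k * (- (1) * Cexp (- (1 * u))))).
  { intros k u. cder_val. ring. }
  assert (Hlim : forall (k : nat) eps, 0 < eps -> exists B, forall b : R, 0 <= b -> B <= b ->
     Cmod (- (b ^ k * Cexp (- (1 * b))) - 0) <= eps).
  { intros k eps Heps. exists (INR (fact (S k)) / eps)%R. intros b Hb Hb2.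
    assert (F := INR_fact_lt_0 (S k)).
    assert (Pb : 0 < b). { eapply Rlt_le_trans; [|exact Hb2]. apply Rdiv_lt_0_compat; auto. }
    replace (- (b ^ k * Cexp (- (1 * b))) - 0) with (- (b ^ k * Cexp (- (1 * b)))) by ring.
    replace (- (1 * b)) with (RtoC (- b)) by (rewrite RtoC_opp; ring).
    rewrite Cmod_opp, Cmod_mult, Cmod_pow, Cmod_R, Cexp_R, Cmod_R, !Rabs_pos_eq by (auto; left; apply exp_pos).
    rewrite exp_Ropp. assert (Q := exp_pow_le (S k) b Hb). assert (Pe := exp_pos b).
    apply Rmult_le_compat_l with (r := eps) in Hb2; [|lra].
    replace (eps * (INR (fact (S k)) / eps))%R with (INR (fact (S k))) in Hb2 by (field; lra).
    apply Rmult_le_reg_r with (b * exp b)%R. apply Rmult_lt_0_compat; auto.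
    replace (b ^ k * / exp b * (b * exp b))%R with (b ^ S k)%R by (simpl; field; lra). nra. }
  induction n as [|n IH].
  - replace (RtoC (INR (fact 0))) with (0 - (fun t : C => - (t ^ 0 * Cexp (- (1 * t)))) 0%R).
    2: { cbv beta. rewrite Cmult_0_r, Copp_0, Cexp_0. simpl. ring. }
    apply (is_Cint_inf_FTC (fun t : C => - (t ^ 0 * Cexp (- (1 * t))))).
    + intros u Hu. eapply Cder_eq. apply Cder_opp. apply Dt. unfold exp_decay. simpl. ring.
    + intros u Hu. apply (Ccont_Rcont (fun t => t ^ 0 * Cexp (- (1 * t)))). eapply Cder_Ccont, Dt.
    + apply (Hlim 0%nat).
  - assert (H : is_Cint_inf (fun t => RtoC t ^ S n * exp_decay 1 t - INR (S n) * (RtoC t ^ n * exp_decay 1 t)) 0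
       (0 - (fun t : C => - (t ^ S n * Cexp (- (1 * t)))) 0%R)).
    { apply (is_Cint_inf_FTC (fun t : C => - (t ^ S n * Cexp (- (1 * t))))).
      + intros u Hu. eapply Cder_eq. apply Cder_opp. apply Dt. unfold exp_decay. cbn [pred]. ring.
      + intros u Hu. apply (Ccont_Rcont (fun t => t ^ S n * Cexp (- (1 * t)) - INR (S n) * (t ^ n * Cexp (- (1 * t))))).
        eapply Cder_Ccont. apply Cder_minus. apply Dt. apply Cder_scal. apply Dt.
      + apply (Hlim (S n)). }
    assert (H2 := is_Cint_inf_plus _ _ _ _ _ H (is_Cint_inf_scal (INR (S n)) _ _ _ IH)).
    rewrite fact_simpl, mult_INR, RtoC_mult.
    match type of H2 with is_Cint_inf _ _ ?l => replace (INR (S n) * INR (fact n)) with l end.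
    2: { simpl. ring. }
    eapply is_Cint_inf_ext; [|exact H2]. intros u _. cbv beta. ring.
Qed.

(** The polynomial part of the terminant: what the division of [t^(2N)] by [t + w] leaves beside
    the exponential integral. *)
Definition terminant_tail (N : nat) (w : C) : C :=
  Csum 0 N (fun n => (INR (fact (2 * n + 1)) - w * INR (fact (2 * n))) / w ^ (2 * n + 2)).

Lemma terminant_int (N : nat) (w : C) : slit w ->
  is_Cint_inf (fun t => RtoC t ^ (2 * N) * exp_decay 1 t * / (t + w)) 0 (w ^ (2 * N) * (expint 1 w + terminant_tail N w)).
Proof.
  intros Hs. assert (Nw := slit_neq_0 w Hs). induction N as [|N IH].
  - replace (w ^ (2 * 0) * (expint 1 w + terminant_tail 0 w)) with (expint 1 w) by (unfold terminant_tail, Csum; simpl; ring).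
    eapply is_Cint_inf_ext; [|apply (expint_1 w Hs)]. intros u Hu. cbv beta. simpl.
    rewrite Cmult_1_r. ring.
  (* [t^(2N+2)/(t+w) = w^2 t^(2N)/(t+w) + t^(2N) (t - w)]. *)
  - assert (H := is_Cint_inf_plus _ _ _ _ _ (is_Cint_inf_scal (w * w) _ _ _ IH)
       (is_Cint_inf_minus _ _ _ _ _ (Gamma_int (2 * N + 1)) (is_Cint_inf_scal w _ _ _ (Gamma_int (2 * N))))).
    match type of H with is_Cint_inf _ _ ?l => replace (w ^ (2 * S N) * (expint 1 w + terminant_tail (S N) w)) with l end.
    2: { unfold terminant_tail. rewrite Csum_S. replace (2 * S N)%nat with (2 * N + 2)%nat by lia.
         replace (2 * (0 + N) + 1)%nat with (2 * N + 1)%nat by lia.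
         replace (2 * (0 + N) + 2)%nat with (2 * N + 2)%nat by lia.
         replace (2 * (0 + N))%nat with (2 * N)%nat by lia.
         rewrite !Cpow_add_r, !Cpow_2. field. split; auto. apply Cpow_nz; auto. }
    eapply is_Cint_inf_ext; [|exact H]. intros u Hu. cbv beta.
    assert (Nu := slit_neq_0 _ (slit_shift_l w u Hs ltac:(lra))).
    replace (2 * S N)%nat with (2 * N + 2)%nat by lia.
    rewrite !Cpow_add_r, !Cpow_2, Cpow_1_r. field. auto.
Qed.

Lemma is_Cint_inf_RInt_gen (f g : R -> C) (l : C) (M : R) :
  (forall t, 0 < t -> f t = g t) -> is_Cint_inf g 0 l -> (forall t, 0 <= t <= 1 -> Cmod (g t) <= M) ->
  @RInt_gen C_R_CompleteNormedModule f (at_right 0) (Rbar_locally p_infty) = l.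
Proof.
  intros Hfg [HE HL] HM.
  apply (@is_RInt_gen_unique C_R_CompleteNormedModule); try apply Proper_StrongProper;
    try apply at_right_proper_filter; try apply Rbar_locally_filter.
  unfold is_RInt_gen, filterlimi, filter_le, filtermapi. intros P [eps HP].
  assert (He4 : 0 < eps / 4) by (destruct eps; simpl; lra).
  destruct (HL _ He4) as [B HB].
  assert (HM0 : 0 <= M) by (eapply Rle_trans; [apply Cmod_ge_0|apply (HM 0%R); lra]).
  set (d := Rmin 1 (eps / 4 / (M + 1))).
  assert (Hd : 0 < d). { apply Rmin_glb_lt. lra. apply Rdiv_lt_0_compat; lra. }
  apply (Filter_prod _ _ _ (fun a => 0 < a < d) (fun b => Rmax 1 B < b)).
  - exists (mkposreal d Hd). intros y Hy Hy0. simpl in Hy.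
    unfold ball in Hy; simpl in Hy. unfold AbsRing_ball, abs, minus, plus, opp in Hy; simpl in Hy.
    apply Rabs_lt_between in Hy. lra.
  - exists (Rmax 1 B). auto.
  - intros a b Ha Hb. simpl.
    assert (M1 := Rmax_l 1 B). assert (M2 := Rmax_r 1 B).
    assert (fourier_rem1 : d <= 1) by apply Rmin_l. assert (fourier_rem2 : d <= eps / 4 / (M + 1)) by apply Rmin_r.
    assert (Ea := CRInt_correct _ _ _ (HE a ltac:(lra))). assert (Eb := CRInt_correct _ _ _ (HE b ltac:(lra))).
    exists (- CRInt g 0 a + CRInt g 0 b). split.
    + apply (is_CRInt_ext g). intros x Hx. rewrite Rmin_left in Hx by lra. symmetry. apply Hfg. lra.
      eapply is_CRInt_Chasles. apply is_CRInt_swap. exact Ea. exact Eb.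
    + apply HP. apply ball_C_R. specialize (HB b ltac:(lra) ltac:(lra)).
      assert (Q := is_CRInt_norm_const g 0 a M _ ltac:(lra) (fun x Hx => HM x ltac:(lra)) Ea).
      replace (- CRInt g 0 a + CRInt g 0 b - l) with ((CRInt g 0 b - l) - CRInt g 0 a) by ring.
      eapply Rle_lt_trans. apply Cmod_minus_le.
      assert ((a - 0) * M <= eps / 4).
      { apply Rle_trans with (eps / 4 / (M + 1) * (M + 1))%R. apply Rmult_le_compat; lra. right; field; lra. }
      destruct eps as [e He]; simpl in *; lra.
Qed.

Lemma Cexp_PI_odd (N : nat) : Cexp (RtoC PI * Ci * RtoC (INR (2 * N + 1))) = - (1).
Proof.
  assert (E1 : Cexp (RtoC PI * Ci) = - (1)).
  { apply Ceq_ReIm; rewrite ?Re_Cexp, ?Im_Cexp;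
    replace (Re (RtoC PI * Ci)) with 0%R by (simpl; ring);
    replace (Im (RtoC PI * Ci)) with PI by (simpl; ring);
    rewrite exp_0, ?cos_PI, ?sin_PI; simpl; ring. }
  rewrite Cmult_comm, Cexp_pow, E1. rewrite Cpow_add_r, Cpow_mult_r, Cpow_1_r.
  replace ((- (1)) ^ 2) with (RtoC 1) by (simpl; ring). rewrite Cpow_1_l. ring.
Qed.

Lemma C_2PIi_neq_0 : 2 * RtoC PI * Ci <> 0.
Proof.
  assert (Pi := PI_RGT_0). repeat apply Cmult_neq_0.
  apply C2_neq_0. apply RtoC_neq; lra. apply Ci_nz.
Qed.

(** For [p = 2N+1] the factor [w^(1-p)] is [w^(-2N)], and [e^(i pi p) = -1]. *)
Lemma terminant_eq (N : nat) (w : C) : slit w ->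
  terminant (INR (2 * N + 1)) w = - Cexp (- w) / (2 * RtoC PI * Ci) * (expint 1 w + terminant_tail N w).
Proof.
  intros Hs. assert (Nw := slit_neq_0 w Hs). unfold terminant.
  destruct (slit_lower w Hs) as [k [Hk Hlow]].
  assert (Hww : Cmod (w - w) <= k) by (rewrite Cmod_diag; lra).
  rewrite (fun H1 H2 => is_Cint_inf_RInt_gen (fun t : R => RtoC (Rpower t (INR (2 * N + 1) - 1) * exp (- t)) / (w + RtoC t))
     (fun t => RtoC t ^ (2 * N) * exp_decay 1 t * / (t + w)) _ (/ k) H1 (terminant_int N w Hs) H2).
  - rewrite Cexp_PI_odd.
    replace ((1 - RtoC (INR (2 * N + 1))) * Clog w) with (- (INR (2 * N) * Clog w)).
    2: { rewrite (plus_INR (2 * N) 1), RtoC_plus. change (INR 1) with 1%R. ring. }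
    rewrite Cexp_opp, Cexp_pow, Cexp_Clog by auto.
    assert (Pi := RtoC_neq PI PI_neq0).
    assert (Ni := Ci_nz). assert (Np := Cpow_nz w (2 * N) Nw).
    field. repeat split; auto.
  - intros t Ht. rewrite (plus_INR (2 * N) 1). change (INR 1) with 1%R.
    replace (INR (2 * N) + 1 - 1)%R with (INR (2 * N)) by ring.
    rewrite Rpower_pow by auto. rewrite RtoC_mult, RtoC_pow. unfold exp_decay.
    replace (- (1 * t)) with (RtoC (- t)) by (rewrite RtoC_opp; ring). rewrite Cexp_R.
    rewrite (Cplus_comm w). reflexivity.
  - intros t Ht. specialize (Hlow w Hww t ltac:(lra)).
    assert (Nt : t + w <> 0) by (apply slit_neq_0, slit_shift_l; auto; lra).
    rewrite !Cmod_mult, Cmod_pow, Cmod_inv, Cmod_R, Rabs_pos_eq by (auto; lra).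
    assert (A1 : 0 <= t ^ (2 * N) <= 1).
    { split. apply pow_le; lra. rewrite <- (pow1 (2 * N)). apply pow_incr; lra. }
    assert (A2 := Cmod_exp_decay 1 t ltac:(simpl; lra) ltac:(lra)). assert (A3 := Cmod_ge_0 (exp_decay 1 t)).
    apply Rle_trans with (1 * / k)%R; [|lra]. apply Rmult_le_compat.
    nra. left; apply Rinv_0_lt_compat; nra. nra. apply Rinv_le_contravar; nra.
Qed.

Lemma Cder_terminant_tail (N : nat) (w : C) : w <> 0 -> exists l, Cder (terminant_tail N) w l.
Proof.
  intros Hw. unfold terminant_tail. induction N as [|N [l IH]].
  - exists 0. apply (Cder_ext (fun _ => 0)). reflexivity. apply Cder_const.
  - eexists. eapply Cder_ext. intros v. symmetry. apply Csum_S. apply Cder_plus. exact IH.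
    cder. apply Cpow_nz; auto.
Qed.

(** The right side is analytic on the cut plane and agrees with the terminant for [Re z > 0] by
    [expint_rotate]; where the argument of [c z] leaves the principal range, the continuation
    differs from the terminant at [c z]. *)
Lemma terminant_at_eq (N : nat) (om : R) (z : C) : om <> 0%R -> slit z ->
  terminant_at (INR (2 * N + 1)) (Ci * om) z =
   - Cexp (- (Ci * om * z)) / (2 * RtoC PI * Ci) * (expint (Ci * om) z + terminant_tail N (Ci * om * z)).
Proof.
  intros Ho Hs. set (c := Ci * om).
  assert (Nom := RtoC_neq om Ho).
  assert (Nc : c <> 0) by (apply Cmult_neq_0; auto; apply Ci_nz).
  assert (Rc : 0 <= Re c) by (unfold c; simpl; lra).
  unfold terminant_at.
  destruct (analytic_continuation_eq (sector (PI / 2)) (sector PI) (fun z => terminant (INR (2 * N + 1)) (c * z))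
     (fun z => - Cexp (- (c * z)) / (2 * RtoC PI * Ci) * (expint c z + terminant_tail N (c * z)))) with (a := RtoC 1) (b := z)
     as [d [Hd HD]].
  - intros v Hv. apply sector_PI in Hv. assert (Nv := slit_neq_0 v Hv).
    destruct (Cder_terminant_tail N (c * v)) as [l Hl]. apply Cmult_neq_0; auto.
    assert (fourier_rem1 := expint_der c v Rc Nc Hv).
    assert (fourier_rem2 := Cder_comp (terminant_tail N) (fun z => c * z) v _ _ ltac:(cder) Hl).
    eexists. cder. apply C_2PIi_neq_0.
  - intros v Hv. apply sector_PI2 in Hv. rewrite terminant_eq by (apply slit_Ci_mult; auto).
    unfold c. rewrite expint_rotate by auto. reflexivity.
  - intros v Hv. apply sector_PI in Hv. destruct (slit_open v Hv) as [r [Hr H]].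
    exists r. split; auto. intros w Hw. apply sector_PI. auto.
  - exists 1%R. split. lra. intros v Hv. apply sector_PI2.
    assert (Q := re_le_Cmod (v - 1)). rewrite Re_minus in Q. apply Rabs_le_between in Q. simpl in *. lra.
  - intros t Ht. apply sector_PI, slit_segment; auto.
  - apply HD. rewrite Cmod_diag. auto.
Qed.

(** * The terms of the expansion *)

(** The [k]-th Fourier mode of [B_3({u})/6]. *)
Definition sin_mode (k : nat) (u : R) : C :=
  RtoC (2 * sin (2 * PI * INR k * u) / (2 * PI * INR k) ^ 3).

Lemma Csin_exp_decay (om u : R) : exp_decay (Ci * RtoC (- om)) u - exp_decay (Ci * om) u = 2 * Ci * sin (om * u).
Proof.
  unfold exp_decay. apply Ceq_ReIm; rewrite ?Re_minus, ?Im_minus, ?Re_Cexp, ?Im_Cexp.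
  - replace (Re (- (Ci * RtoC (- om) * u))) with 0%R by (simpl; ring).
    replace (Re (- (Ci * om * u))) with 0%R by (simpl; ring).
    replace (Im (- (Ci * RtoC (- om) * u))) with (om * u)%R by (simpl; ring).
    replace (Im (- (Ci * om * u))) with (- (om * u))%R by (simpl; ring).
    rewrite cos_neg. simpl. ring.
  - replace (Re (- (Ci * RtoC (- om) * u))) with 0%R by (simpl; ring).
    replace (Re (- (Ci * om * u))) with 0%R by (simpl; ring).
    replace (Im (- (Ci * RtoC (- om) * u))) with (om * u)%R by (simpl; ring).
    replace (Im (- (Ci * om * u))) with (- (om * u))%R by (simpl; ring).
    rewrite sin_neg, exp_0. simpl. ring.
Qed.

(** The sine is the difference of the two exponentials, whose transforms of order 2 are [1/z - c
    E_c(z)]; the terms [1/z] cancel. *)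
Lemma sin_mode_is_Cint_inf (k : nat) (z : C) : (0 < k)%nat -> slit z ->
  let om := (2 * PI * INR k)%R in
  is_Cint_inf (fun u => sin_mode k u * / (u + z) ^ 2) 0
    (/ (om * om) * (expint (Ci * om) z + expint (Ci * RtoC (- om)) z)).
Proof.
  intros Hk Hs om. assert (Pk := lt_0_INR k Hk). assert (Pi := PI_RGT_0).
  assert (Pom : 0 < om) by (unfold om; apply Rmult_lt_0_compat; lra).
  assert (Nom : RtoC om <> 0) by (apply RtoC_neq; lra).
  assert (S1 := Stieltjes_spec _ 2 z (pw_cont_exp_decay (Ci * om)) (bounded_on_pos_exp_decay (Ci * om) ltac:(simpl; lra)) Hs (le_n _)).
  assert (S2 := Stieltjes_spec _ 2 z (pw_cont_exp_decay (Ci * RtoC (- om))) (bounded_on_pos_exp_decay (Ci * RtoC (- om)) ltac:(simpl; lra)) Hs (le_n _)).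
  assert (H := is_Cint_inf_scal (/ (om * om * (Ci * om))) _ _ _ (is_Cint_inf_minus _ _ _ _ _ S2 S1)).
  assert (Nz := slit_neq_0 z Hs). assert (Ni := Ci_nz).
  match type of H with is_Cint_inf _ _ ?l => replace (/ (om * om) * (expint (Ci * om) z + expint (Ci * RtoC (- om)) z)) with l end.
  2: { unfold expint. rewrite RtoC_opp. field. repeat split; auto. }
  eapply is_Cint_inf_ext; [|exact H]. intros u Hu. cbv beta.
  assert (Nu := slit_neq_0 _ (slit_shift_l z u Hs ltac:(lra))).
  replace (exp_decay (Ci * RtoC (- om)) u * / (u + z) ^ 2 - exp_decay (Ci * om) u * / (u + z) ^ 2)
    with ((exp_decay (Ci * RtoC (- om)) u - exp_decay (Ci * om) u) * / (u + z) ^ 2) by ring.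
  rewrite Csin_exp_decay. unfold sin_mode. fold om.
  rewrite RtoC_div, RtoC_mult, RtoC_pow by (apply pow_nonzero; lra). simpl. field. repeat split; auto.
Qed.

(** The transform of [sin_mode k], which is the value of [a_k + b_k] for every [N_k]. *)
Definition expansion_term (z : C) (k : nat) : C :=
  let om := (2 * PI * INR k)%R in
  / (om * om) * (expint (Ci * om) z + expint (Ci * RtoC (- om)) z).

Lemma periodize_Bern3_eq (u : R) :
  periodize Bern3 u = RtoC ((u - nat_floor u) ^ 3 - 3 / 2 * (u - nat_floor u) ^ 2 + (u - nat_floor u) / 2)%R.
Proof.
  unfold periodize, Bern3. rewrite <- !RtoC_mult, <- RtoC_div, <- RtoC_mult, <- RtoC_minus, <- RtoC_inv, <- RtoC_mult, <- RtoC_plus by lra.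
  f_equal. field.
Qed.

Lemma Csum_sin_mode (K : nat) (u : R) :
  Csum 1 K (fun k => sin_mode k u) = RtoC (rsum (fun k => 2 * sin (2 * PI * INR k * (u - nat_floor u)) / (2 * PI * INR k) ^ 3)%R K).
Proof.
  induction K as [|K IH]. reflexivity.
  rewrite Csum_S, IH. cbn [rsum]. rewrite RtoC_plus. f_equal. change (1 + K)%nat with (S K).
  unfold sin_mode. f_equal. f_equal. f_equal. unfold nat_floor. set (j := Z.to_nat (Int_part u)).
  replace (2 * PI * INR (S K) * u)%R with (2 * PI * INR (S K) * (u - INR j) + 2 * INR (S K * j) * PI)%R.
  apply sin_period. rewrite mult_INR. ring.
Qed.

Lemma expansion_term_sum_is_Cint_inf (z : C) (K : nat) : slit z ->
  is_Cint_inf (fun u => Csum 1 K (fun k => sin_mode k u) * / (u + z) ^ 2) 0 (Csum 1 K (expansion_term z)).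
Proof.
  intros Hs. induction K as [|K IH].
  - assert (H := sin_mode_is_Cint_inf 1 z (le_n _) Hs). apply (is_Cint_inf_scal 0) in H.
    rewrite Cmult_0_l in H. eapply is_Cint_inf_ext; [|exact H]. intros u _. unfold Csum; simpl. ring.
  - rewrite Csum_S. assert (H := sin_mode_is_Cint_inf (1 + K) z ltac:(lia) Hs). cbv zeta in H.
    fold (expansion_term z (1 + K)) in H.
    eapply is_Cint_inf_ext; [|apply (is_Cint_inf_plus _ _ _ _ _ IH H)]. intros u _. cbv beta. rewrite Csum_S. ring.
Qed.

Lemma expansion_term_sum (z : C) : slit z -> Clim (fun K => Csum 1 K (expansion_term z)) (barnes_rem z).
Proof.
  intros Hs. destruct (Stieltjes_bound z Hs) as [k [Hk H]].
  assert (Hzz : Cmod (z - z) <= k) by (rewrite Cmod_diag; lra).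
  assert (Pk : 0 < k ^ 2) by (apply pow_lt; auto).
  apply (Clim_squeeze0 _ (fun K => 4 / k ^ 2 / INR K)%R); [|apply lim_inv_INR].
  exists 1%nat. intros K HK. assert (PK := lt_0_INR K ltac:(lia)).
  assert (S0 := is_Cint_inf_scal (/ 6) _ _ _ (Stieltjes_spec (periodize Bern3) 2 z pw_cont_B3 bounded_on_pos_B3 Hs (le_n _))).
  assert (I := is_Cint_inf_minus _ _ _ _ _ (expansion_term_sum_is_Cint_inf z K Hs) S0). fold (barnes_rem z) in I.
  set (M := (4 / INR (S K))%R).
  assert (PSK := lt_0_INR (S K) ltac:(lia)).
  assert (HM : 0 <= M) by (unfold M; apply Rdiv_le_0_compat; lra).
  apply Rle_trans with (M / k ^ 2)%R.
  - replace (M / k ^ 2)%R with (0 - - (M / k ^ 2 / (1 + 0)))%R by (field; lra).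
    assert (HMk : 0 <= M / k ^ 2) by (apply Rdiv_le_0_compat; auto).
    apply (is_Cint_inf_bound _ _ _ _ _ _ (dominating_shift 1 (M / k ^ 2) Rlt_0_1 HMk)) with (2 := I).
    intros u Hu. cbv beta.
    replace (Csum 1 K (fun k => sin_mode k u) * / (u + z) ^ 2 - / 6 * (periodize Bern3 u * / (u + z) ^ 2))
      with ((fun v : R => Csum 1 K (fun k => sin_mode k v) - / 6 * periodize Bern3 v) u * / (u + z) ^ 2) by (cbv beta; ring).
    apply (H z Hzz (fun v : R => Csum 1 K (fun k => sin_mode k v) - / 6 * periodize Bern3 v) 2%nat); auto.
    rewrite Csum_sin_mode, periodize_Bern3_eq, <- RtoC_inv, <- RtoC_mult, <- RtoC_minus, Cmod_R by lra.
    assert (F := nat_floor_bounds u Hu).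
    assert (B := Bern3_Fourier K (u - nat_floor u) ltac:(lra)).
    eapply Rle_trans; [|apply B]. right. f_equal. field.
  - unfold M. replace (4 / INR (S K) / k ^ 2)%R with (4 / k ^ 2 * / INR (S K))%R by (field; lra).
    unfold Rdiv at 2. apply Rmult_le_compat_l. apply Rdiv_le_0_compat; lra.
    apply Rinv_le_contravar; auto. rewrite S_INR. lra.
Qed.

(** For [w] and [-w] the terms with [(2n)!] have opposite signs and cancel; the ones with
    [(2n+1)!] double. *)
Lemma terminant_tail_sum (N : nat) (om : R) (z : C) : om <> 0%R -> z <> 0 ->
  terminant_tail N (Ci * om * z) + terminant_tail N (Ci * RtoC (- om) * z)
  + Csum 0 N (fun n => (- (1)) ^ n * (2 * RtoC (INR (fact (2 * n + 1)))) / (om * z) ^ (2 * n + 2)) = 0.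
Proof.
  intros Ho Hz. assert (Nom := RtoC_neq om Ho).
  unfold terminant_tail. induction N as [|N IH]. unfold Csum; simpl; ring.
  rewrite !Csum_S. rewrite !Nat.add_0_l.
  set (v := om * z) in *. assert (Nv : v <> 0) by (apply Cmult_neq_0; auto).
  assert (P1 : (Ci * om * z) ^ (2 * N + 2) = - ((- (1)) ^ N * v ^ (2 * N + 2))).
  { replace (2 * N + 2)%nat with (2 * (N + 1))%nat by lia. rewrite !Cpow_mult_r.
    replace ((Ci * om * z) ^ 2) with (- (1) * v ^ 2).
    rewrite Cpow_mult_l. rewrite Cpow_add_r, Cpow_1_r. ring.
    unfold v. replace ((Ci * om * z) ^ 2) with (Ci * Ci * (om * z) ^ 2) by (simpl; ring).
    replace (Ci * Ci) with (- (1)). reflexivity. unfold Ci, Copp, Cmult, RtoC; simpl. f_equal; ring. }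
  assert (P2 : (Ci * RtoC (- om) * z) ^ (2 * N + 2) = (Ci * om * z) ^ (2 * N + 2)).
  { replace (2 * N + 2)%nat with (2 * (N + 1))%nat by lia. rewrite !Cpow_mult_r.
    f_equal. rewrite RtoC_opp. simpl. ring. }
  rewrite P2, P1.
  assert (E1 : ((- (1)) ^ N) * ((- (1)) ^ N) = 1).
  { rewrite <- Cpow_mult_l. replace (- (1) * - (1)) with (RtoC 1) by ring. apply Cpow_1_l. }
  set (sg := (- (1)) ^ N) in *.
  assert (Nsg : sg <> 0). { intros E. rewrite E, Cmult_0_l in E1. apply C1_nz. auto. }
  assert (Nvp := Cpow_nz v (2 * N + 2) Nv). set (vp := v ^ (2 * N + 2)) in *.
  set (F1 := RtoC (INR (fact (2 * N + 1)))). set (F0 := RtoC (INR (fact (2 * N)))).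
  match type of IH with ?A + ?B + ?D = _ => set (A0 := A) in *; set (B0 := B) in *; set (fourier_rem0 := D) in * end.
  match goal with |- ?L = _ => replace L with ((A0 + B0 + fourier_rem0) +
     ((F1 - Ci * om * z * F0) / - (sg * vp) + (F1 - Ci * RtoC (- om) * z * F0) / - (sg * vp) + sg * (2 * F1) / vp)) by ring end.
  rewrite IH, RtoC_opp.
  replace (sg * (2 * F1) / vp) with ((sg * sg) * (2 * F1) / (sg * vp)) by (field; auto).
  rewrite E1. field. auto.
Qed.

Lemma term_eq_expansion_term (N k : nat) (z : C) : (0 < k)%nat -> slit z ->
  1 / (2 * RtoC PI * RtoC (INR k)) ^ 2
    * Csum 0 N (fun n : nat =>
        (- (1)) ^ n * (2 * RtoC (INR (fact (2 * n + 1))))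
        / (2 * RtoC PI * RtoC (INR k) * z) ^ (2 * n + 2))
  + (terminant_at (INR (2 * N + 1)) (2 * RtoC PI * RtoC (INR k) * Ci) z / (2 * RtoC PI * Ci * RtoC (INR k) ^ 2)
      * Cexp (2 * RtoC PI * RtoC (INR k) * Ci * z)
    + terminant_at (INR (2 * N + 1)) (- (2 * RtoC PI * RtoC (INR k) * Ci)) z / (2 * RtoC PI * Ci * RtoC (INR k) ^ 2)
      * Cexp (- (2 * RtoC PI * RtoC (INR k) * Ci * z))) = expansion_term z k.
Proof.
  intros Hk Hs. unfold expansion_term. set (om := (2 * PI * INR k)%R). cbv zeta.
  assert (Pk := lt_0_INR k Hk). assert (Pi := PI_RGT_0).
  assert (Pom : 0 < om) by (unfold om; apply Rmult_lt_0_compat; lra).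
  assert (Nom : RtoC om <> 0) by (apply RtoC_neq; lra).
  assert (Nk := RtoC_INR_neq_0 k Hk).
  assert (Npi := RtoC_neq PI PI_neq0).
  assert (Ni := Ci_nz). assert (Nz := slit_neq_0 z Hs).
  assert (Eom : RtoC om = 2 * RtoC PI * RtoC (INR k)) by (unfold om; rewrite !RtoC_mult; reflexivity).
  rewrite <- Eom.
  replace (om * Ci) with (Ci * om) by ring.
  replace (- (Ci * om)) with (Ci * RtoC (- om)) by (rewrite RtoC_opp; ring).
  rewrite !terminant_at_eq by (auto; lra).
  assert (R := terminant_tail_sum N om z ltac:(lra) Nz).
  set (Sa := Csum 0 N _) in *. set (r1 := terminant_tail N (Ci * om * z)) in *. set (r2 := terminant_tail N (Ci * RtoC (- om) * z)) in *.
  replace (- (Ci * om * z)) with (Ci * RtoC (- om) * z) by (rewrite RtoC_opp; ring).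
  replace (- (Ci * RtoC (- om) * z)) with (Ci * om * z) by (rewrite RtoC_opp; ring).
  set (e2 := Cexp (Ci * RtoC (- om) * z)). set (e1 := Cexp (Ci * om * z)).
  assert (Ee : e1 * e2 = 1).
  { unfold e1, e2. rewrite <- Cexp_plus, <- Cexp_0. f_equal. rewrite RtoC_opp. ring. }
  set (E1 := expint (Ci * om) z). set (E2 := expint (Ci * RtoC (- om)) z).
  assert (Hii : Ci * Ci = - (1)). { unfold Ci, Copp, Cmult, RtoC; simpl. f_equal; ring. }
  assert (Hmain : forall e e' E r : C, e * e' = 1 ->
     - e' / (2 * RtoC PI * Ci) * (E + r) / (2 * RtoC PI * Ci * RtoC (INR k) ^ 2) * e = / (om * om) * (E + r)).
  { intros e e' E r H.
    replace (- e' / (2 * RtoC PI * Ci) * (E + r) / (2 * RtoC PI * Ci * RtoC (INR k) ^ 2) * e)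
      with (- (e * e') * (E + r) / ((Ci * Ci) * (2 * RtoC PI * RtoC (INR k)) ^ 2)) by (field; auto).
    rewrite H, Hii, <- Eom. simpl. field. auto. }
  rewrite (Hmain e1 e2 E1 r1 Ee), (Hmain e2 e1 E2 r2 ltac:(rewrite Cmult_comm; exact Ee)).
  replace (1 / om ^ 2 * Sa + (/ (om * om) * (E1 + r1) + / (om * om) * (E2 + r2)))
    with (/ (om * om) * (E1 + E2) + / (om * om) * (r1 + r2 + Sa)) by (simpl; field; auto).
  rewrite R. ring.
Qed.

(** * Complex powers *)

(** The principal value of [x^(-s)]. *)
Definition npow (s x : C) : C := Cexp (- s * Clog x).

Lemma Cder_npow (s x : C) : slit x -> Cder (npow s) x (- s * npow (s + 1) x).
Proof.
  intros Hx. assert (Nx := slit_neq_0 x Hx). unfold npow.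
  cder_val; auto. replace (- (s + 1) * Clog x) with (- s * Clog x - Clog x) by ring.
  rewrite Cexp_minus, Cexp_Clog by auto. field. auto.
Qed.

Lemma Cmod_npow (s : C) (x : R) : 0 < x -> Cmod (npow s x) = exp (- Re s * ln x).
Proof.
  intros Hx. unfold npow. rewrite Clog_R, Cmod_Cexp by auto. f_equal.
  rewrite re_scal_r, re_opp. reflexivity.
Qed.

Lemma npow_1 (s : C) : npow s 1 = 1.
Proof.
  unfold npow. rewrite Clog_R, ln_1 by lra. rewrite Cmult_0_r. apply Cexp_0.
Qed.

Lemma Cder_npow_shift (s : C) (u : R) : 0 <= u ->
  Cder (fun t => npow s (t + 1)) u (- s * npow (s + 1) (u + 1) * 1).
Proof.
  intros Hu. apply (Cder_comp (npow s) (fun t => t + 1)). apply Cder_shift. apply Cder_npow.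
  apply slit_shift_l. apply slit_1. auto.
Qed.

Lemma Rcont_npow (s : C) (u : R) : 0 <= u -> Rcont (fun t => npow s (t + 1)) u.
Proof.
  intros Hu. apply (Ccont_Rcont (fun t => npow s (t + 1))). eapply Cder_Ccont, Cder_npow_shift, Hu.
Qed.

Lemma Clim_npow (s : C) : 0 < Re s -> Clim (fun m => npow s (INR m + 1)) 0.
Proof.
  intros Hs eps Heps.
  destruct (INR_unbounded (exp (- ln eps / Re s))) as [n0 Hn]. exists n0. intros n Hle.
  rewrite Cminus_0_r, <- RtoC_plus, Cmod_npow by (assert (P := pos_INR n); lra).
  rewrite <- (exp_ln eps) by auto. apply exp_mono.
  apply le_INR in Hle. assert (Q : ln (exp (- ln eps / Re s)) <= ln (INR n + 1)).
  { apply ln_le. apply exp_pos. lra. }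
  rewrite ln_exp in Q. apply Rmult_le_compat_l with (r := Re s) in Q; [|lra].
  replace (Re s * (- ln eps / Re s))%R with (- ln eps)%R in Q by (field; lra). lra.
Qed.

Lemma dominating_npow (M d : R) : 0 <= M -> 0 < d ->
  dominating (fun u => M * exp (- (1 + d) * ln (1 + u)))%R (fun u => - (M / d * exp (- d * ln (1 + u))))%R 0 0.
Proof.
  intros HM Hd. split; [|split].
  - intros x y Hxy. apply (is_RInt_derive (V := R_CompleteNormedModule) (fun u => - (M / d * exp (- d * ln (1 + u))))%R).
    + intros u Hu. rewrite Rmin_left in Hu by lra. auto_derive. lra.
      replace (- (1 + d) * ln (1 + u))%R with (- d * ln (1 + u) + - ln (1 + u))%R by ring.
      rewrite exp_plus, exp_Ropp, exp_ln by lra. field. lra.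
    + intros u Hu. rewrite Rmin_left in Hu by lra.
      apply (ex_derive_continuous (V := R_NormedModule)). auto_derive. lra.
  - intros u Hu. apply Rmult_le_pos; auto. left; apply exp_pos.
  - intros eps Heps. set (K := (M / d + 1)%R).
    assert (HK0 : 0 <= M / d) by (apply Rdiv_le_0_compat; lra).
    assert (HK : 0 < K) by (unfold K; lra).
    exists (exp (- ln (eps / K) / d))%R. intros b Hb Hb2. rewrite Rminus_0_r, Rabs_Ropp.
    rewrite Rabs_pos_eq by (apply Rmult_le_pos; auto; left; apply exp_pos).
    assert (Pe : 0 < eps / K) by (apply Rdiv_lt_0_compat; auto).
    assert (Q : exp (- d * ln (1 + b)) <= eps / K).
    { rewrite <- (exp_ln (eps / K)) by auto. apply exp_mono.
      assert (Q : ln (exp (- ln (eps / K) / d)) <= ln (1 + b)) by (apply ln_le; [apply exp_pos|lra]).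
      rewrite ln_exp in Q. apply Rmult_le_compat_l with (r := d) in Q; [|lra].
      replace (d * (- ln (eps / K) / d))%R with (- ln (eps / K))%R in Q by (field; lra). lra. }
    assert (P := exp_pos (- d * ln (1 + b))).
    apply Rle_trans with (K * (eps / K))%R. apply Rmult_le_compat; try lra. unfold K; lra. right; field; lra.
Qed.

Lemma Cexp_second (w : C) : Cmod (Cexp w - 1 - w) <= 4 * Cmod w ^ 2 * exp (Cmod w).
Proof.
  assert (W0 := Cmod_ge_0 w).
  assert (Hv : forall v : C, forall t : R, 0 <= t <= 1 -> Cmod (0 + t * (v - 0)) <= Cmod v).
  { intros v t Ht. replace (0 + t * (v - 0)) with (t * v) by ring.
    assert (V0 := Cmod_ge_0 v). rewrite Cmod_mult, Cmod_R, Rabs_pos_eq by lra. nra. }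
  assert (A : forall v, Cmod (Cexp v - 1) <= 2 * (exp (Cmod v) * Cmod v)).
  { intros v. rewrite <- Cexp_0. replace (Cmod v) with (Cmod (v - 0)) at 2 by (f_equal; ring).
    apply (Cder_mvt_seg Cexp Cexp 0 v). intros; apply Cder_Cexp.
    intros t Ht. rewrite Cmod_Cexp. apply exp_mono.
    eapply Rle_trans. apply Rle_abs. eapply Rle_trans. apply re_le_Cmod. apply Hv; auto. }
  replace (Cexp w - 1 - w) with ((fun v => Cexp v - 1 - v) w - (fun v => Cexp v - 1 - v) 0).
  2: { cbv beta. rewrite Cexp_0. ring. }
  eapply Rle_trans. apply (Cder_mvt_seg (fun v => Cexp v - 1 - v) (fun v => Cexp v - 1) 0 w (2 * (exp (Cmod w) * Cmod w))).
  - intros t Ht. assert (D := Cder_Cexp (0 + t * (w - 0))). cder_val. ring.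
  - intros t Ht. specialize (Hv w t Ht). eapply Rle_trans. apply A.
    apply Rmult_le_compat_l. lra. apply Rmult_le_compat; auto using Cmod_ge_0. left; apply exp_pos. apply exp_mono; auto.
  - replace (w - 0) with w by ring. right. simpl. ring.
Qed.

(** * Transforms of periodic functions and their continuation *)

Definition Dirichlet (p : C -> C) (s : C) : C := Cint_inf (fun u => periodize p u * npow s (u + 1)) 0.

(** Analytic on a disc about 0 that contains the period [[0, 1]], with mean value 0 over the
    period. The mean is expressed by a primitive, which is what integration by parts needs; any
    radius greater than 1 would do in place of 5. *)
Definition mean_zero (p : C -> C) : Prop :=
  (forall z, Cmod z < 5 -> exists l, Cder p z l) /\
  exists P, (forall z, Cmod z < 5 -> Cder P z (p z)) /\ P 0 = P 1.

Lemma mean_zero_cont (p : C -> C) (x : R) : mean_zero p -> 0 <= x <= 1 -> Ccont p x.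
Proof.
  intros [H _] Hx. destruct (H x) as [l Hl]. rewrite Cmod_R, Rabs_pos_eq; lra. eapply Cder_Ccont; eauto.
Qed.

Lemma mean_zero_pw_cont (p : C -> C) : mean_zero p -> pw_cont (periodize p).
Proof. intros H. apply periodize_pw_cont. intros x Hx. apply mean_zero_cont; auto. Qed.

Lemma mean_zero_bounded_on_pos (p : C -> C) : mean_zero p -> exists M, 0 <= M /\ (forall u, 0 <= u -> Cmod (periodize p u) <= M) .
Proof.
  intros H.
  destruct (Cmod_bounded p 0 1 Rle_0_1) as [M [HM0 HM]]. intros t Ht. apply mean_zero_cont; auto.
  exists M. split; auto. intros u Hu. apply HM. assert (F := nat_floor_bounds u Hu). lra.
Qed.

Lemma npow_shift_bound (s : C) (u d : R) : 0 <= u -> 1 + d <= Re s ->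
  Cmod (npow s (u + 1)) <= exp (- (1 + d) * ln (1 + u)).
Proof.
  intros Hu Hd. rewrite <- RtoC_plus, Cmod_npow by lra. apply exp_mono. rewrite (Rplus_comm u).
  assert (0 <= ln (1 + u)) by (rewrite <- ln_1; apply ln_le; lra). nra.
Qed.

Lemma Dirichlet_spec (p : C -> C) (s : C) : mean_zero p -> 1 < Re s ->
  is_Cint_inf (fun u => periodize p u * npow s (u + 1)) 0 (Dirichlet p s).
Proof.
  intros Hp Hs. destruct (mean_zero_bounded_on_pos p Hp) as [M [HM0 HM]].
  set (d := (Re s - 1)%R).
  destruct (is_Cint_inf_ex (fun u => periodize p u * npow s (u + 1)) _ _ 0 0 (dominating_npow M d HM0 ltac:(unfold d; lra))) as [l Hl].
  - intros u Hu. rewrite Cmod_mult. apply Rmult_le_compat; auto using Cmod_ge_0.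
    apply npow_shift_bound; auto. unfold d; lra.
  - apply pw_cont_int. apply mean_zero_pw_cont; auto. intros u Hu. apply Rcont_npow; auto.
  - eapply Cint_inf_spec; eauto.
Qed.

Lemma Dirichlet_der (p : C -> C) (s : C) : mean_zero p -> 1 < Re s -> exists l, Cder (Dirichlet p) s l.
Proof.
  intros Hp Hs. destruct (mean_zero_bounded_on_pos p Hp) as [M [HM0 HM]].
  set (d := ((Re s - 1) / 3)%R). assert (Hd : 0 < d) by (unfold d; lra).
  assert (Hln : forall u, 0 <= u -> 0 <= ln (1 + u)) by (intros u Hu; rewrite <- ln_1; apply ln_le; lra).
  (* Powers of [l = ln (1+u)] are absorbed by the margin [3 d] between [Re s] and 1. *)
  assert (HL2 : forall l, 0 <= l -> l ^ 2 <= 2 / d ^ 2 * exp (d * l)).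
  { intros l Hl. assert (Q := exp_pow_le 2 (d * l) ltac:(nra)).
    rewrite Rpow_mult_distr in Q. simpl (INR (fact 2)) in Q.
    assert (Pd : 0 < d ^ 2) by (apply pow_lt; auto).
    apply Rmult_le_reg_l with (d ^ 2)%R; auto.
    replace (d ^ 2 * (2 / d ^ 2 * exp (d * l)))%R with (2 * exp (d * l))%R by (field; lra). lra. }
  assert (HI' : exists l, is_Cint_inf (fun u => periodize p u * (- (Clog (u + 1)) * npow s (u + 1))) 0 l).
  { assert (HM2 : 0 <= M * (1 + 2 / d ^ 2)).
    { apply Rmult_le_pos; auto. assert (0 <= 2 / d ^ 2) by (apply Rdiv_le_0_compat; [lra|apply pow_lt; auto]). lra. }
    apply (is_Cint_inf_ex _ _ _ 0 0 (dominating_npow (M * (1 + 2 / d ^ 2)) d HM2 Hd)).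
    - intros u Hu. rewrite !Cmod_mult, Cmod_opp, Rmult_assoc.
      apply Rmult_le_compat; auto using Cmod_ge_0.
      apply Rmult_le_pos; apply Cmod_ge_0.
      rewrite <- RtoC_plus, Clog_R, Cmod_R, Cmod_npow, (Rplus_comm u) by lra.
      specialize (Hln u Hu). rewrite Rabs_pos_eq by auto. set (l := ln (1 + u)) in *.
      assert (E : (exp (- Re s * l) = exp (- (1 + d) * l) * exp (- (2 * d) * l))%R).
      { rewrite <- exp_plus. f_equal. unfold d. field. }
      rewrite E. assert (Q := HL2 l Hln). assert (P1 := exp_pos (- (1 + d) * l)).
      assert (P2 := exp_pos (- (2 * d) * l)).
      assert (E2 : (exp (d * l) * exp (- (2 * d) * l) = exp (- d * l))%R) by (rewrite <- exp_plus; f_equal; ring).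
      assert (E3 : exp (- d * l) <= 1) by (rewrite <- exp_0; apply exp_mono; nra).
      assert (E4 : exp (- (2 * d) * l) <= 1) by (rewrite <- exp_0; apply exp_mono; nra).
      assert (B : l * exp (- (2 * d) * l) <= 1 + 2 / d ^ 2).
      { assert (l <= 1 + l ^ 2) by nra.
        apply Rle_trans with ((1 + l ^ 2) * exp (- (2 * d) * l))%R. apply Rmult_le_compat_r; lra.
        assert (Pq : 0 <= 2 / d ^ 2) by (apply Rdiv_le_0_compat; [lra|apply pow_lt; auto]).
        assert (l ^ 2 * exp (- (2 * d) * l) <= 2 / d ^ 2 * exp (d * l) * exp (- (2 * d) * l)) by (apply Rmult_le_compat_r; lra).
        rewrite Rmult_assoc, E2 in H0. nra. }
      nra.
    - apply pw_cont_int. apply mean_zero_pw_cont; auto. intros u Hu.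
      apply (Ccont_Rcont (fun t => - Clog (t + 1) * npow s (t + 1))).
      assert (D := Cder_npow_shift s u Hu). ccont. apply slit_shift_l; auto using slit_1. }
  destruct HI' as [I' HI']. exists I'.
  assert (Pd2 : 0 < d ^ 2) by (apply pow_lt; auto).
  assert (HMM : 0 <= M * (8 / d ^ 2)). { apply Rmult_le_pos; auto. apply Rdiv_le_0_compat; lra. }
  apply (is_Cint_inf_der (fun s u => periodize p u * npow s (u + 1)) (fun u => periodize p u * (- (Clog (u + 1)) * npow s (u + 1)))
    (Dirichlet p) I' s 0 d 0 _ _ Hd (dominating_npow (M * (8 / d ^ 2)) d HMM Hd)).
  - intros h Hh. apply Dirichlet_spec; auto. rewrite re_plus. assert (Q := re_le_Cmod h).
    apply Rabs_le_between in Q. unfold d in Hh. lra.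
  - exact HI'.
  - intros h Hh u Hu.
    assert (Hu1 : 0 < u + 1) by lra.
    assert (Ep : npow (s + h) (u + 1) = npow s (u + 1) * Cexp (- h * Clog (u + 1))).
    { unfold npow. rewrite <- Cexp_plus. f_equal. ring. }
    rewrite Ep.
    replace (periodize p u * (npow s (u + 1) * Cexp (- h * Clog (u + 1))) - periodize p u * npow s (u + 1) -
       h * (periodize p u * (- Clog (u + 1) * npow s (u + 1))))
     with (periodize p u * (npow s (u + 1) * (Cexp (- h * Clog (u + 1)) - 1 - - h * Clog (u + 1)))) by ring.
    rewrite !Cmod_mult.
    assert (E2 := Cexp_second (- h * Clog (u + 1))).
    rewrite <- RtoC_plus, Clog_R in * by auto. rewrite Cmod_npow by auto.
    assert (Em : Cmod (- h * ln (u + 1)) = (Cmod h * ln (u + 1))%R).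
    { rewrite Cmod_mult, Cmod_opp, Cmod_R, Rabs_pos_eq. reflexivity. rewrite Rplus_comm; auto. }
    rewrite Em in E2. rewrite (Rplus_comm u) in *. specialize (Hln u Hu). set (l := ln (1 + u)) in *.
    assert (H0 := Cmod_ge_0 h). set (a := Cmod h) in *.
    specialize (HM u Hu). assert (HM1 := Cmod_ge_0 (periodize p u)).
    apply Rle_trans with (M * (exp (- Re s * l) * (4 * (a * l) ^ 2 * exp (a * l))))%R.
    { apply Rmult_le_compat; auto. apply Rmult_le_pos. left; apply exp_pos. apply Cmod_ge_0.
      apply Rmult_le_compat_l; auto. left; apply exp_pos. }
    replace (a * a * (M * (8 / d ^ 2) * exp (- (1 + d) * l)))%R with (M * (a * a * (8 / d ^ 2 * exp (- (1 + d) * l))))%R by ring.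
    apply Rmult_le_compat_l; auto.
    replace (exp (- Re s * l) * (4 * (a * l) ^ 2 * exp (a * l)))%R
      with (a * a * (4 * l ^ 2 * (exp (- Re s * l) * exp (a * l))))%R by ring.
    apply Rmult_le_compat_l. nra.
    apply Rle_trans with (4 * (2 / d ^ 2 * exp (d * l)) * (exp (- Re s * l) * exp (d * l)))%R.
    { apply Rmult_le_compat.
      assert (0 <= l ^ 2) by (apply pow_le; auto). lra.
      apply Rmult_le_pos; left; apply exp_pos.
      assert (Q := HL2 l Hln). lra.
      apply Rmult_le_compat_l. left; apply exp_pos. apply exp_mono. nra. }
    right. replace (- Re s * l)%R with (- (1 + d) * l + - (d * l) + - (d * l))%R by (unfold d; field).
    rewrite !exp_plus, !exp_Ropp. assert (Pe := exp_pos (d * l)). field. lra.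
Qed.

Lemma is_Cint_inf_sum (f : R -> C) (J : nat -> C) (l : C) : is_Cint_inf f 0 l ->
  (forall n, is_CRInt f (INR n) (INR n + 1)%R (J n)) -> Clim (fun m => Csum 0 m J) l.
Proof.
  intros H HJ. apply is_Cint_inf_Clim in H. eapply Clim_ext; [|exact H]. exists 0%nat. intros m _.
  apply CRInt_unique. apply CRInt_sum. exact HJ.
Qed.

(** A primitive of [p] is periodic because [p] has mean 0; subtracting its own mean keeps it in
    the class. *)
Lemma mean_zero_antider (p : C -> C) : mean_zero p ->
  exists q, mean_zero q /\ (forall z, Cmod z < 5 -> Cder q z (p z)) /\ q 0 = q 1.
Proof.
  intros [Hp [P [HP HP01]]].
  destruct (disc_primitive P 0 5) as [Q HQ].
  { intros z Hz. rewrite Cminus_0_r in Hz. eexists. apply HP; auto. }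
  set (m := Q 1 - Q 0).
  assert (HQ' : forall z, Cmod z < 5 -> Cder Q z (P z)).
  { intros z Hz. apply HQ. rewrite Cminus_0_r. auto. }
  assert (HD : forall z, Cmod z < 5 -> Cder (fun z => P z - m) z (p z)).
  { intros z Hz. assert (HPz := HP z Hz). cder_val. ring. }
  exists (fun z => P z - m). split; [split|split].
  - intros z Hz. eexists. apply HD; auto.
  - exists (fun z => Q z - m * z). split.
    + intros z Hz. assert (HQz := HQ' z Hz). cder_val. ring.
    + unfold m. ring.
  - exact HD.
  - rewrite HP01. reflexivity.
Qed.

Lemma Cder_sub_const (p : C -> C) (n z l : C) :
  Cder p (z - n) l -> Cder (fun u => p (u - n)) z l.
Proof.
  intros H. eapply Cder_eq. apply (Cder_comp p (fun u => u - n)). cder. exact H. ring.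
Qed.

(** Integration by parts over each period. As [q 0 = q 1] the boundary terms telescope. *)
Lemma Dirichlet_rec (p q : C -> C) (s : C) : mean_zero p -> mean_zero q ->
  (forall z, Cmod z < 5 -> Cder q z (p z)) -> q 0 = q 1 -> 1 < Re s ->
  Dirichlet p s = - q 0 + s * Dirichlet q (s + 1).
Proof.
  intros Hp Hq Hd H01 Hs.
  assert (H1 := Dirichlet_spec p s Hp Hs).
  assert (H2 := Dirichlet_spec q (s + 1) Hq ltac:(rewrite re_plus; simpl; lra)).
  assert (H := is_Cint_inf_minus _ _ _ _ _ H1 (is_Cint_inf_scal s _ _ _ H2)).
  assert (HL := is_Cint_inf_sum _ (fun n => q 0 * (npow s (INR (S n) + 1) - npow s (INR n + 1))) _ H).
  assert (HC : Clim (fun m => Csum 0 m (fun n => q 0 * (npow s (INR (S n) + 1) - npow s (INR n + 1)))) (- q 0)).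
  { assert (L := Clim_minus _ _ _ _ (Clim_scal (q 0) _ _ (Clim_npow s ltac:(lra))) (Clim_const (q 0))).
    replace (- q 0) with (q 0 * 0 - q 0) by ring.
    eapply Clim_ext; [|exact L]. exists 0%nat. intros m _. cbv beta.
    induction m as [|m IH]. unfold Csum; simpl. rewrite Cplus_0_l, npow_1. ring.
    rewrite Csum_S, <- IH. rewrite Nat.add_0_l. ring. }
  assert (E : Dirichlet p s - s * Dirichlet q (s + 1) = - q 0).
  { eapply Clim_unique; [|exact HC]. apply HL. intros n. assert (Pn := pos_INR n).
    apply is_CRInt_ext with (f := fun u : R => p (u - INR n) * npow s (u + 1) - s * (q (u - INR n) * npow (s + 1) (u + 1))).
    { intros x Hx. rewrite Rmin_left, Rmax_right in Hx by lra. unfold periodize. rewrite (nat_floor_eq n) by lra.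
      rewrite RtoC_minus. reflexivity. }
    replace (q 0 * (npow s (INR (S n) + 1) - npow s (INR n + 1))) with
      ((fun u : C => q (u - INR n) * npow s (u + 1)) (INR n + 1)%R - (fun u : C => q (u - INR n) * npow s (u + 1)) (INR n)).
    2: { cbv beta. replace ((INR n + 1)%R - INR n) with (RtoC 1) by (rewrite RtoC_plus; ring).
         replace (INR n - INR n) with (RtoC 0) by ring. rewrite <- H01, S_INR. ring. }
    apply (is_CRInt_FTC (fun u : C => q (u - INR n) * npow s (u + 1))); intros x Hx; rewrite Rmin_left, Rmax_right in Hx by lra.
    all: assert (Hx5 : Cmod (x - INR n) < 5) by (rewrite <- RtoC_minus, Cmod_R, Rabs_pos_eq; lra).
    all: assert (fourier_rem1 := Cder_sub_const q (INR n) _ _ (Hd _ Hx5)).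
    all: assert (fourier_rem2 := Cder_npow_shift s x ltac:(lra)).
    - cder_val. ring.
    - apply (Ccont_Rcont (fun u => p (u - INR n) * npow s (u + 1) - s * (q (u - INR n) * npow (s + 1) (u + 1)))).
      destruct (proj1 Hp (x - INR n) Hx5) as [l Hl].
      assert (fourier_rem3 := Cder_sub_const p (INR n) _ _ Hl). assert (D4 := Cder_npow_shift (s + 1) x ltac:(lra)).
      ccont. }
  replace (Dirichlet p s) with (Dirichlet p s - s * Dirichlet q (s + 1) + s * Dirichlet q (s + 1)) by ring. rewrite E. ring.
Qed.

(** Each integration by parts moves the boundary of the half plane one unit to the left. *)
Lemma Dirichlet_continue (m : nat) : forall p, mean_zero p -> exists f,
  (forall s, 1 - INR m < Re s -> exists l, Cder f s l) /\ (forall s, 1 < Re s -> f s = Dirichlet p s).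
Proof.
  induction m as [|m IH]; intros p Hp.
  - exists (Dirichlet p). split; auto. intros s Hs. simpl in Hs. apply Dirichlet_der; auto. lra.
  - destruct (mean_zero_antider p Hp) as [q [Hq [Hd H01]]]. destruct (IH q Hq) as [f [Hf1 Hf2]].
    exists (fun s => - q 0 + s * f (s + 1)). split.
    + intros s Hs. rewrite S_INR in Hs. destruct (Hf1 (s + 1)) as [l Hl]. rewrite re_plus; simpl; lra.
      assert (D := Cder_comp f (fun s => s + 1) s _ _ (Cder_shift 1 s) Hl). eexists. cder.
    + intros s Hs. rewrite (Dirichlet_rec p q) by auto. rewrite Hf2; auto. rewrite re_plus; simpl; lra.
Qed.

Lemma halfplane_open (a : R) (z : C) : a < Re z -> exists r, 0 < r /\ forall w, Cmod (w - z) < r -> a < Re w.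
Proof.
  intros H. exists (Re z - a)%R. split. lra. intros w Hw. assert (Q := re_le_Cmod (w - z)).
  rewrite Re_minus in Q. apply Rabs_le_between in Q. lra.
Qed.

(** The continuations to the half planes [Re s > 1 - m] agree where both are defined, by
    [segment_identity]. *)
Lemma Dirichlet_entire (p : C -> C) : mean_zero p -> exists F,
  (forall s, exists l, Cder F s l) /\ (forall s, 1 < Re s -> F s = Dirichlet p s).
Proof.
  intros Hp. destruct (choose_fun _ (fun m => Dirichlet_continue m p Hp)) as [f Hf].
  assert (Hcoh : forall m m' s, 1 - INR m < Re s -> 1 - INR m' < Re s -> f m s = f m' s).
  { intros m m' s H1 H2. set (a := Rmax (1 - INR m) (1 - INR m')).
    assert (A1 : 1 - INR m <= a) by apply Rmax_l. assert (A2 : 1 - INR m' <= a) by apply Rmax_r.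
    assert (A3 : a < Re s) by (apply Rmax_lub_lt; auto).
    assert (A4 : a <= 1). { apply Rmax_lub; assert (P1 := pos_INR m); assert (P2 := pos_INR m'); lra. }
    destruct (segment_identity (fun w => a < Re w) (fun w => f m w - f m' w) 2 s) as [d [Hd HD]].
    - intros z Hz. apply halfplane_open; auto.
    - intros z Hz. destruct (proj1 (Hf m) z) as [l1 L1]. lra. destruct (proj1 (Hf m') z) as [l2 L2]. lra.
      eexists. apply Cder_minus; eauto.
    - intros t Ht. rewrite re_plus, re_scal_l, Re_minus, re_RtoC.
      destruct (Req_dec t 1) as [-> | Nt]. lra.
      assert (0 <= t * (Re s - a)) by (apply Rmult_le_pos; lra).
      assert (0 < (1 - t) * (2 - a)) by (apply Rmult_lt_0_compat; lra). lra.
    - exists 1%R. split. lra. intros z Hz.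
      assert (1 < Re z).
      { assert (Q := re_le_Cmod (z - 2)). rewrite Re_minus, re_RtoC in Q. apply Rabs_le_between in Q. lra. }
      rewrite (proj2 (Hf m)), (proj2 (Hf m')) by auto. ring.
    - specialize (HD s). cbv beta in HD. rewrite Cmod_diag in HD.
      specialize (HD Hd). replace (f m s) with (f m s - f m' s + f m' s) by ring. rewrite HD. ring. }
  assert (Hm : forall s : C, exists m, 1 - INR m < Re s).
  { intros s. destruct (INR_unbounded (1 - Re s)) as [m Hm]. exists m. lra. }
  destruct (choose_fun _ Hm) as [mu Hmu].
  exists (fun s => f (mu s) s). split.
  - intros s. destruct (proj1 (Hf (mu s)) s (Hmu s)) as [l Hl]. exists l.
    eapply Cder_ext_loc; [|exact Hl].
    destruct (halfplane_open _ _ (Hmu s)) as [r [Hr HR]]. exists r. split; auto. intros h Hh.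
    apply Hcoh; auto. apply HR. replace (s + h - s) with h by ring. auto.
  - intros s Hs. apply (proj2 (Hf (mu s))). auto.
Qed.

(** * The zeta function and the Glaisher-Kinkelin constant *)

Lemma mean_zero_B3 : mean_zero Bern3.
Proof.
  split. intros z _. eexists. apply Cder_Bern3.
  exists (fun x => / 4 * (x * x * (x * x)) - / 2 * (x * x * x) + / 4 * (x * x)). split.
  - intros z _. cder_val. unfold Bern3. field.
  - field.
Qed.

(** Three integrations by parts, i.e. Euler-Maclaurin on one period. *)
Lemma Bern3_zeta_period (s : C) (n : nat) : 1 - s <> 0 ->
  is_CRInt (fun u => s * (s + 1) * (s + 2) / 6 * (periodize Bern3 u * npow (s + 3) (u + 1))) (INR n) (INR n + 1)%R
   (- (s / 12) * (npow (s + 1) (INR n + 2) - npow (s + 1) (INR n + 1))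
    - / 2 * (npow s (INR n + 2) + npow s (INR n + 1))
    + (npow (s - 1) (INR n + 2) - npow (s - 1) (INR n + 1)) / (1 - s)).
Proof.
  intros N1. assert (Pn := pos_INR n).
  apply is_CRInt_ext with (f := fun u : R => s * (s + 1) * (s + 2) / 6 * (Bern3 (u - INR n) * npow (s + 3) (u + 1))).
  { intros x Hx. rewrite Rmin_left, Rmax_right in Hx by lra. unfold periodize. rewrite (nat_floor_eq n) by lra.
    rewrite RtoC_minus. reflexivity. }
  set (G := fun u : C => / 6 * (- (s * (s + 1)) * (Bern3 (u - INR n) * npow (s + 2) (u + 1))
     - s * (3 * Bern2 (u - INR n) * npow (s + 1) (u + 1)) - (6 * (u - INR n) - 3) * npow s (u + 1))
     + / (1 - s) * npow (s - 1) (u + 1)).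
  match goal with |- is_CRInt _ _ _ ?l => replace l with (G (INR n + 1)%R - G (INR n)) end.
  2: { unfold G. rewrite RtoC_plus. replace (INR n + 1 - INR n) with (RtoC 1) by ring.
       replace (INR n - INR n) with (RtoC 0) by ring. replace (INR n + 1 + 1) with (INR n + 2) by ring.
       unfold Bern3, Bern2. field. auto. }
  apply (is_CRInt_FTC G); intros x Hx; rewrite Rmin_left, Rmax_right in Hx by lra.
  all: assert (Dsh := fun sg => Cder_npow_shift sg x ltac:(lra)).
  all: assert (fourier_rem1 := Cder_sub_const Bern3 (INR n) x _ (Cder_Bern3 _)).
  - assert (fourier_rem2 := Cder_sub_const Bern2 (INR n) x _ (Cder_Bern2 _)).
    assert (E1 := Dsh (s + 2)). assert (E2 := Dsh (s + 1)). assert (E3 := Dsh s). assert (E4 := Dsh (s - 1)).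
    unfold G. cder_val.
    replace (s - 1 + 1) with s by ring. replace (s + 1 + 1) with (s + 2) by ring. replace (s + 2 + 1) with (s + 3) by ring.
    field. auto.
  - apply (Ccont_Rcont (fun u => s * (s + 1) * (s + 2) / 6 * (Bern3 (u - INR n) * npow (s + 3) (u + 1)))).
    assert (E := Dsh (s + 3)). ccont.
Qed.

(** The continuation of zeta, given a continuation [F] of the transform of [B_3]. *)
Definition zeta_cont (F : C -> C) (s : C) : C :=
  / (s - 1) + / 2 + s / 12 - s * (s + 1) * (s + 2) / 6 * F (s + 3).

Lemma zeta_series_eq (s : C) : 1 < Re s -> zeta_series s = zeta_cont (Dirichlet Bern3) s.
Proof.
  intros Hs. assert (N1 : 1 - s <> 0).
  { intros E. assert (Q : Re (1 - s) = 0%R) by (rewrite E; reflexivity). rewrite Re_minus, re_RtoC in Q. lra. }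
  assert (N2 : s - 1 <> 0). { intros E. apply N1. replace (1 - s) with (- (s - 1)) by ring. rewrite E. ring. }
  assert (H := is_Cint_inf_scal (s * (s + 1) * (s + 2) / 6) _ _ _ (Dirichlet_spec Bern3 (s + 3) mean_zero_B3 ltac:(rewrite re_plus, re_RtoC; lra))).
  assert (HL := is_Cint_inf_sum _ _ _ H (fun n => Bern3_zeta_period s n N1)).
  unfold zeta_series. apply Clim_Clim_seq.
  assert (L1 := Clim_npow (s + 1) ltac:(rewrite re_plus, re_RtoC; lra)).
  assert (L2 := Clim_npow s ltac:(lra)).
  assert (L3 := Clim_npow (s - 1) ltac:(rewrite Re_minus, re_RtoC; lra)).
  assert (G := Clim_plus _ _ _ _ (Clim_minus _ _ _ _ (Clim_plus _ _ _ _ (Clim_minus _ _ _ _ (Clim_const (/ (s - 1) + / 2 + s / 12)) (Clim_scal (s / 12) _ _ L1))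
    (Clim_scal (/ 2) _ _ L2)) HL) (Clim_scal (/ (1 - s)) _ _ L3)).
  match type of G with Clim _ ?l => replace l with (zeta_cont (Dirichlet Bern3) s) in G end.
  2: { unfold zeta_cont. ring. }
  assert (Sh : Clim (fun m => Csum 1 (m + 1) (fun n : nat => Cexp (- s * RtoC (ln (INR n))))) (zeta_cont (Dirichlet Bern3) s)).
  { eapply Clim_ext; [|exact G]. exists 0%nat. intros m _. cbv beta.
    induction m as [|m IH].
    - unfold Csum; simpl. rewrite ln_1, !Cplus_0_l, !npow_1, Cmult_0_r, Cexp_0. field. auto.
    - replace (S m + 1)%nat with (S (m + 1)) by lia. rewrite (Csum_S 1), <- IH, (Csum_S 0).
      rewrite !Nat.add_0_l. replace (1 + (m + 1))%nat with (S (S m)) by lia.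
      assert (E : Cexp (- s * RtoC (ln (INR (S (S m))))) = npow s (INR m + 2)).
      { unfold npow. replace (INR m + 2) with (RtoC (INR (S (S m)))). rewrite Clog_R. reflexivity.
        apply lt_0_INR; lia. rewrite !S_INR, !RtoC_plus. ring. }
      rewrite E. rewrite !S_INR, !RtoC_plus. replace (INR m + 1 + 1) with (INR m + 2) by ring. field. auto. }
  apply Clim_decr. eapply Clim_ext; [|exact Sh]. exists 0%nat. intros m _. rewrite Nat.add_1_r. reflexivity.
Qed.

Lemma Dirichlet_B3_2 : Dirichlet Bern3 2 = 6 * barnes_rem 1.
Proof.
  assert (H := Stieltjes_spec (periodize Bern3) 2 1 pw_cont_B3 bounded_on_pos_B3 slit_1 (le_n _)).
  unfold barnes_rem. replace (6 * (/ 6 * Stieltjes (periodize Bern3) 2 1)) with (Stieltjes (periodize Bern3) 2 1) by field.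
  eapply is_Cint_inf_unique. apply (Dirichlet_spec Bern3 2 mean_zero_B3). simpl; lra.
  eapply is_Cint_inf_ext; [|exact H]. intros u Hu. cbv beta. f_equal.
  unfold npow. assert (Su : slit (u + 1)) by (apply slit_shift_l; [apply slit_1|lra]).
  replace (- (2) * Clog (u + 1)) with (- (INR 2 * Clog (u + 1))).
  rewrite Cexp_opp, Cexp_pow, Cexp_Clog. reflexivity. apply slit_neq_0; auto.
  replace (RtoC (INR 2)) with (RtoC 2) by (f_equal; simpl; ring). ring.
Qed.

(** At [s = -1] the factor [s + 1] vanishes, so the derivative of the last term of [zeta_cont]
    involves only the value [F 2], not [F']. *)
Theorem log_glaisher_eq : log_glaisher = glaisher_const.
Proof.
  destruct (Dirichlet_entire Bern3 mean_zero_B3) as [F [HF1 HF2]].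
  assert (HD : forall s : C, s <> RtoC 1 -> exists l, Cder (zeta_cont F) s l).
  { intros s Hs. destruct (HF1 (s + 3)) as [l Hl].
    assert (D := Cder_comp F (fun s => s + 3) s _ _ (Cder_shift 3 s) Hl).
    eexists. unfold zeta_cont, Cdiv. cder. apply Cminus_eq_contra; auto. }
  (* The segment from [2 + 2i] to [-1] avoids the pole at 1. *)
  destruct (analytic_continuation_eq (fun s => (1 < Re s)%R) (fun s => s <> RtoC 1) zeta_series (zeta_cont F)) with (a := (2, 2)%R : C) (b := - (1))
    as [d [Hd HDd]].
  - exact HD.
  - intros s Hs. rewrite zeta_series_eq by auto. unfold zeta_cont. rewrite HF2; auto. rewrite re_plus, re_RtoC. lra.
  - intros s Hs. exists (Cmod (s - 1)). split. apply Cmod_gt_0, Cminus_eq_contra; auto.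
    intros w Hw E. subst w. rewrite Cmod_minus_sym in Hw. lra.
  - exists 1%R. split. lra. intros z Hz. assert (Q := re_le_Cmod (z - (2, 2)%R)). rewrite Re_minus in Q.
    apply Rabs_le_between in Q. simpl in Q. simpl. lra.
  - intros t Ht E. assert (E1 : Im ((2, 2)%R + t * (- (1) - (2, 2)%R)) = Im 1) by (rewrite E; reflexivity).
    assert (E2 : Re ((2, 2)%R + t * (- (1) - (2, 2)%R)) = Re 1) by (rewrite E; reflexivity).
    unfold Re, Im in E1, E2. simpl in E1, E2. lra.
  - fold zeta in HDd. destruct (HF1 2) as [l Hl].
    assert (DZ : Cder (zeta_cont F) (- (1)) (- (1 / 4) + 1 / 12 + barnes_rem 1)).
    { unfold zeta_cont.
      assert (Hl' : Cder F (- (1) + 3) l) by (replace (- (1) + 3) with (RtoC 2) by ring; exact Hl).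
      assert (N2 : - (1) - 1 <> 0).
      { intros E. assert (Q : Re (- (1) - 1) = 0%R) by (rewrite E; reflexivity). simpl in Q. lra. }
      assert (D := Cder_comp F (fun s => s + 3) _ _ _ (Cder_shift 3 _) Hl').
      unfold Cdiv. cder_val. exact N2. replace (- (1) + 3) with (RtoC 2) by ring. rewrite HF2 by (simpl; lra). rewrite Dirichlet_B3_2. field. }
    unfold log_glaisher, glaisher_const.
    rewrite (is_C_derive_unique zeta (- (1)) (- (1 / 4) + 1 / 12 + barnes_rem 1)). field.
    apply Cder_is_derive. eapply Cder_ext_loc; [|exact DZ].
    exists d. split; auto. intros h Hh. symmetry. apply HDd. replace (- (1) + h - - (1)) with h by ring. auto.
Qed.

(** * The expansion *)

(** The sums [a k + b k] are the terms [expansion_term z k], whose sum is [barnes_rem z], and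
    this is [main - logBarnesG1p z]. If one of the two series converges, so does the other, by
    subtraction. *)
Theorem theorem1p4 (N : nat -> nat) (z : C)
    (hz : z <> RtoC 0) (harg : (Rabs (Carg z) < PI)%R) :
  let main : C :=
    1 / 4 * z ^ 2 + z * logGamma1p z
    - (1 / 2 * z * (z + 1) + 1 / 12) * Clog z - log_glaisher in
  let kk (k : nat) : C := RtoC (INR k) in
  let a (k : nat) : C :=
    1 / (2 * RtoC PI * kk k) ^ 2
    * Csum 0 (N k) (fun n : nat =>
        (- (1)) ^ n * (2 * RtoC (INR (fact (2 * n + 1))))
        / (2 * RtoC PI * kk k * z) ^ (2 * n + 2)) in
  let T (k : nat) (c : C) : C := terminant_at (INR (2 * N k + 1)) c z in
  let b (k : nat) : C :=
    T k (2 * RtoC PI * kk k * Ci) / (2 * RtoC PI * Ci * kk k ^ 2)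
      * Cexp (2 * RtoC PI * kk k * Ci * z)
    + T k (- (2 * RtoC PI * kk k * Ci)) / (2 * RtoC PI * Ci * kk k ^ 2)
      * Cexp (- (2 * RtoC PI * kk k * Ci * z)) in
  let is_sum (u : nat -> C) (s : C) : Prop :=
    @is_series C_AbsRing C_NormedModule (fun j : nat => u (S j)) s in
  is_sum (fun k : nat => a k + b k) (main - logBarnesG1p z)
  /\ ((exists s : C, is_sum a s) \/ (exists s : C, is_sum b s) ->
      exists s t : C,
        is_sum a s /\ is_sum b t /\ logBarnesG1p z = main - s - t).
Proof.
  intros main kk a T b is_sum.
  assert (Hs : slit z) by (apply sector_PI; split; auto).
  assert (Hab : forall k, a (S k) + b (S k) = expansion_term z (S k)).
  { intros k. apply (term_eq_expansion_term (N (S k)) (S k) z); auto. lia. }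
  assert (Hmain : main - logBarnesG1p z = barnes_rem z).
  { unfold main. rewrite logGamma1p_eq, logBarnesG1p_eq, log_glaisher_eq by auto.
    unfold LogBarnes, qpol. simpl. field. }
  assert (Hsum : is_sum (fun k => a k + b k) (barnes_rem z)).
  { unfold is_sum. apply is_series_Clim.
    eapply Clim_ext; [|exact (expansion_term_sum z Hs)]. exists 0%nat. intros n _.
    rewrite Csum_shift. apply Csum_ext. intros k _. symmetry. apply Hab. }
  assert (Hdiff : forall u v s t, (forall k, u k + v k = a k + b k) -> is_sum u s -> t = barnes_rem z - s -> is_sum v t).
  { intros u v s t Huv Hu ->. unfold is_sum in *. apply is_series_Clim. apply is_series_Clim in Hu.
    apply is_series_Clim in Hsum.
    eapply Clim_ext; [|apply (Clim_minus _ _ _ _ Hsum Hu)]. exists 0%nat. intros n _. cbv beta.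
    rewrite (Csum_ext _ (fun j => u (S j) + v (S j))) by (intros; symmetry; apply Huv).
    rewrite Csum_plus. ring. }
  rewrite Hmain. split; [exact Hsum|].
  assert (HG : logBarnesG1p z = main - barnes_rem z) by (rewrite <- Hmain; ring).
  intros [[s H] | [t H]].
  - exists s, (barnes_rem z - s). split; [exact H|split].
    + eapply (Hdiff a b s); auto.
    + rewrite HG. ring.
  - exists (barnes_rem z - t), t. split; [|split; [exact H|]].
    + eapply (Hdiff b a t); auto. intros; ring.
    + rewrite HG. ring.
Qed.
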